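(* Let $\rho\in\mathbb R$ and let $\eta^{\rho,z_0}$ denote the $\mathrm{SLE}_0(\rho)$ in $\mathbb H$ starting at $0$, with reference point $\infty$ and force point $z_0\in\overline{\mathbb H}\setminus\{0\}$, re-parametrized by arc-length. If $z_0\in\mathbb R\setminus\{0\}$, let $h_{\rho,z_0}:\mathbb H\to\mathbb R$ be the field $$h_{\rho,z_0}(z)=\begin{cases}\pi(1+\tfrac\rho2)-\arg(z)-\tfrac\rho2\arg(z-z_0),&z_0>0,\\ \pi-\arg(z)-\tfrac\rho2\arg(z-z_0),&z_0<0,\end{cases}$$ where the branches of $\arg(z)$ and $\arg(z-z_0)$ take values in $(0,\pi)$. Then $\eta^{\rho,z_0}$ is a flow-line of $h_{\rho,z_0}$. If $z_0=re^{i\theta}\in\mathbb H$, $\theta\in(0,\pi)$, let $h_{\rho,z_0}:\mathbb H_{z_0}\to\mathbb R$, where $\mathbb H_{z_0}:=\pi_{z_0}^{-1}(\mathbb H)\subset M_{z_0}$, be the field $$h_{\rho,z_0}(z)=\pi-\arg(z)-\tfrac\rho4\big(\arg(z-z_0)+\arg(z-\bar z_0)\big),$$ where the branches of $\arg(z)$ and $\arg(z-\bar z_0)$ take values in $(0,\pi)$. Then the lift of $\eta^{\rho,z_0}$ by $\pi_{z_0}$, starting at $(r,\theta-\pi)$, is a flow-line of $h_{\rho,z_0}$.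
   Context: $\mathbb H$ is the upper half-plane. The $\mathrm{SLE}_0(\rho)$ in $\mathbb H$ starting at $0$ with reference point $\infty$ and force point $z_0$ is the curve whose (half-plane capacity) driving function solves $\dot W_t=\mathrm{Re}\frac{\rho}{W_t-z_t}$, $W_0=0$, where $z_t=g_t(z_0)$ and $\partial_tg_t(z)=\frac2{g_t(z)-W_t}$, $g_0(z)=z$, $\gamma(t)=\lim_{y\to0+}g_t^{-1}(W_t+iy)$, run up to $\tau_{0+}=\lim_{\varepsilon\to0+}\inf\{t:|W_t-z_t|=\varepsilon\}$. For $z_0\in\mathbb C$, $M_{z_0}=\{(r,\theta):r>0,\theta\in\mathbb R\}$ is the logarithmic Riemann surface centered at $z_0$, with the complex structure induced by $\pi_{z_0}:M_{z_0}\to\mathbb C$, $(r,\theta)\mapsto z_0+re^{i\theta}$. A point $(r,\theta)\in M_{z_0}$ is written as $z=z_0+re^{i\theta}$, so $M_{z_0}$ is locally identified with $\mathbb C$ and $\arg(\cdot-z_0):M_{z_0}\to\mathbb R$, $(r,\theta)\mapsto\theta$, is single-valued; other functions of $z$ such as $\arg(z)$ and $\arg(z-\bar z_0)$ are evaluated at the projection $\pi_{z_0}(z)$. A $C^1$ curve $\eta$, parametrized by arc-length, is a flow-line of a field $h$ if $\eta'(t)=e^{ih(\eta(t))}$ (on $M_{z_0}$, using the local identification with $\mathbb C$). *)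

(* Defs.v *)
From Stdlib Require Import Reals List Sorted Lra.
From Coquelicot Require Import Coquelicot.
Open Scope R_scope.

Definition upper (z : C) : Prop := 0 < Im z.

Definition expi (a : R) : C := (cos a, sin a).

(* On the upper half-plane this is the branch of the argument with values in
   (0, PI); see [argH_spec]. It is only ever applied to points with Im z > 0. *)
Definition argH (z : C) : R := acos (Re z / Cmod z).

Lemma argH_spec (z : C) :
  upper z -> 0 < argH z < PI /\ z = (Cmod z * expi (argH z))%C.
Proof.
destruct z as [x y]; unfold upper, argH, expi; cbn -[Cmod Cmult]; intros Hy.
assert (Hm : Cmod (x, y) ^ 2 = x ^ 2 + y ^ 2).
{ unfold Cmod; cbn [fst snd]. rewrite pow2_sqrt; nra. }
assert (Hp : 0 < Cmod (x, y)).
{ apply Cmod_gt_0. intros E. injection E. lra. }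
set (m := Cmod (x, y)) in *.
assert (Hx : (x / m) * m = x) by (field; lra).
assert (H0 : - m < x < m) by (split; nra).
assert (H1 : -1 < x / m < 1)
  by (split; apply (Rmult_lt_reg_r m); lra).
split; [now apply acos_bound_lt|].
rewrite cos_acos by lra. rewrite sin_acos by lra.
assert (Hs : sqrt (1 - (x / m)²) = y / m).
{ replace (1 - (x / m)²) with ((y / m)²).
  - apply sqrt_Rsqr. apply Rlt_le, Rdiv_lt_0_compat; lra.
  - unfold Rsqr. replace (y * y) with (m ^ 2 - x ^ 2) by lra.
    replace (y / m * (y / m)) with ((y ^ 2) / m ^ 2) by (field; lra).
    replace (y ^ 2) with (m ^ 2 - x ^ 2) by lra. field; lra. }
rewrite Hs. unfold RtoC, Cmult; cbn [fst snd]. f_equal; field; lra.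
Qed.

(* The half-open interval [0, T). *)
Definition in_time (T : Rbar) (t : R) : Prop := 0 <= t /\ Rbar_lt t T.

(* Derivative relative to D: one-sided at an endpoint of D belonging to D. *)
Definition deriv_on {V : NormedModule R_AbsRing}
    (D : R -> Prop) (u : R -> V) (t : R) (l : V) : Prop :=
  filterdiff u (within D (locally t)) (fun h : R => scal h l).

Definition C1_on (D : R -> Prop) (u : R -> C) : Prop :=
  exists u' : R -> C,
    (forall t, D t -> deriv_on (V := C_R_NormedModule) D u t (u' t)) /\
    continuous_on D u'.

(* Graph of the Loewner map driven by W: [loewner_map W t z w] says that g_t(z)
   is defined (z is not swallowed by time t) and equals w. *)
Definition loewner_map (W : R -> R) (t : R) (z w : C) : Prop :=
  exists u : R -> C,
    u 0 = z /\ u t = w /\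
    forall s, 0 <= s <= t ->
      u s <> RtoC (W s) /\
      deriv_on (V := C_R_NormedModule) (fun r => 0 <= r <= t) u s
        (2 / (u s - W s))%C.

(* gamma(t) = lim_{y -> 0+} g_t^{-1}(W_t + i y); here f y = g_t^{-1}(W_t + i y). *)
Definition loewner_trace (W : R -> R) (T : Rbar) (gamma : R -> C) : Prop :=
  forall t, in_time T t ->
    exists f : R -> C,
      (forall y, 0 < y -> upper (f y) /\ loewner_map W t (f y) (W t, y)) /\
      filterlim f (at_right 0) (locally (gamma t)).

(* Limit of an extended-real valued function, in the order topology of Rbar. *)
Definition is_Rbar_lim {A : Type} (f : A -> Rbar) (F : (A -> Prop) -> Prop)
    (l : Rbar) : Prop :=
  (forall a, Rbar_lt a l -> F (fun x => Rbar_lt a (f x))) /\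
  (forall b, Rbar_lt l b -> F (fun x => Rbar_lt (f x) b)).

(* inf {t : |W_t - z_t| = eps}, equal to p_infty when the set is empty. *)
Definition hitting_time (T : Rbar) (W : R -> R) (z : R -> C) (eps : R) : Rbar :=
  Glb_Rbar (fun t => in_time T t /\ Cmod (W t - z t)%C = eps).

(* gamma is the SLE_0(rho) in the upper half-plane from 0 to infinity with force
   point z0, parametrized by half-plane capacity on [0, T), with driving
   function W and force point evolution z_t = g_t(z0). The last but one clause
   says T = tau_{0+}; since hitting times are taken in [0, T), it also forces the
   solution (W, z) to be maximal. *)
Record SLE0 (rho : R) (z0 : C) (T : Rbar) (W : R -> R) (z gamma : R -> C) :
    Prop := {
  SLE0_start : W 0 = 0;
  SLE0_driving : forall t, in_time T t ->
    deriv_on (V := R_NormedModule) (in_time T) W t (Re (rho / (W t - z t))%C);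
  SLE0_force : forall t, in_time T t -> loewner_map W t z0 (z t);
  SLE0_lifetime : is_Rbar_lim (hitting_time T W z) (at_right 0) T;
  SLE0_trace : loewner_trace W T gamma
}.

Fixpoint polygon_length (gamma : R -> C) (p : list R) : R :=
  match p with
  | a :: (b :: _) as q => Cmod (gamma b - gamma a)%C + polygon_length gamma q
  | _ => 0
  end.

Definition arc_length (gamma : R -> C) (t : R) : Rbar :=
  Lub_Rbar (fun S => exists p : list R,
    Sorted Rle p /\ List.Forall (fun s => 0 <= s <= t) p /\ S = polygon_length gamma p).

(* eta, on [0, L), is the curve gamma, on [0, T), re-parametrized by arc-length. *)
Record arclength_reparam (T : Rbar) (gamma : R -> C) (L : Rbar) (eta : R -> C) :
    Prop := {
  reparam_rectifiable : forall t, in_time T t -> is_finite (arc_length gamma t);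
  reparam_length :
    L = Lub_Rbar (fun s => exists t, in_time T t /\ s = arc_length gamma t);
  reparam_eq : forall t, in_time T t -> eta (arc_length gamma t) = gamma t
}.

(* Flow-lines on a surface X over C whose local coordinates are given by
   proj : X -> C, for a field h defined on the open subset U of X. The curve may
   start on the boundary of U, so the flow equation is required for s > 0 only;
   C^1 regularity is required up to s = 0. Unit speed follows from the equation. *)
Definition flow_line {X : UniformSpace} (proj : X -> C) (U : X -> Prop)
    (h : X -> R) (L : Rbar) (eta : R -> X) : Prop :=
  continuous_on (in_time L) eta /\
  C1_on (in_time L) (fun s => proj (eta s)) /\
  forall s, 0 < s -> Rbar_lt s L ->
    U (eta s) /\
    is_derive (V := C_R_NormedModule) (fun r => proj (eta r)) s
      (expi (h (eta s))).

(* The logarithmic surface M_{z0} is the set of pairs (r, theta), r > 0, in R * R. *)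
Definition log_surface : UniformSpace :=
  prod_UniformSpace R_UniformSpace R_UniformSpace.

Definition log_proj (z0 : C) (p : log_surface) : C :=
  (z0 + fst p * expi (snd p))%C.

Definition log_upper (z0 : C) (p : log_surface) : Prop :=
  0 < fst p /\ upper (log_proj z0 p).

Record is_lift (z0 : C) (L : Rbar) (eta : R -> C) (p0 : log_surface)
    (teta : R -> log_surface) : Prop := {
  lift_start : teta 0 = p0;
  lift_cont : continuous_on (in_time L) teta;
  lift_pos : forall s, in_time L s -> 0 < fst (teta s);
  lift_proj : forall s, in_time L s -> log_proj z0 (teta s) = eta s
}.

Definition h_real (rho x0 : R) (z : C) : R :=
  if Rlt_dec 0 x0
  then PI * (1 + rho / 2) - argH z - rho / 2 * argH (z - x0)%C
  else PI - argH z - rho / 2 * argH (z - x0)%C.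

Definition h_log (rho : R) (z0 : C) (p : log_surface) : R :=
  PI - argH (log_proj z0 p)
     - rho / 4 * (snd p + argH (log_proj z0 p - Cconj z0)%C).

(* Main.v *)
(* Write v_s = g_s(.) - W_s. Any two solutions of v' = 2/v - W' satisfy
   (v1^2 - v2^2)' = - 2 W' (v1^2 - v2^2) / (v1 + v2), whose coefficient stays
   integrable, of order (t - s)^(-1/2), along trajectories that hit the tip at
   time t. Hence gamma^2 is C^1, with
   (gamma^2)' = - 4 exp (int_0^t W'_s / v_s ds), v_s = g_s(gamma(t)) - W_s.
   Since zeta = z - W and its conjugate solve the same equation as v,
   (v - zeta) (v - conj zeta) is multiplied over [0, t] by
   exp (int_0^t b_s / v_s ds) with b = - 4 Re (1 / zeta), and the SLE_0(rho)
   equation says W' = (rho / 4) b. So the exponent above is rho / 4 times a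
   continuous logarithm of |zeta_t|^2 / ((gamma - z0) (gamma - conj z0)); its
   imaginary part gives the field. As gamma(t) ~ 2 i sqrt t, the curve
   x |-> gamma(x^2) is regular and C^1 up to x = 0, and arc length follows. *)

Require Import Defs.
From Corelib Require Import ssreflect.
From Stdlib Require Import Reals List Sorted Lra Lia Ranalysis5 ClassicalEpsilon.
From Coquelicot Require Import Coquelicot.
Open Scope general_if_scope.
Open Scope R_scope.

(** * Calculus for complex-valued functions of a real variable *)

Lemma is_derive_eq (f : R -> R) (x l l' : R) :
  is_derive f x l -> l = l' -> is_derive f x l'.
Proof. now intros H <-. Qed.

Lemma derive_le_0_antitone (f df : R -> R) (a b : R) :
  a <= b ->
  (forall x, a < x < b -> is_derive f x (df x)) ->
  (forall x, a <= x <= b -> continuous f x) ->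
  (forall x, a < x < b -> df x <= 0) -> f b <= f a.
Proof.
intros Hab Hd Hc Hs.
destruct (MVT_gen f a b
  (fun x => if Rlt_dec a x then if Rlt_dec x b then df x else 0 else 0))
  as [c [Hc1 Hc2]].
- rewrite -> Rmin_left, Rmax_right by lra. intros x Hx.
  destruct (Rlt_dec a x); [|lra]. destruct (Rlt_dec x b); [|lra]. now apply Hd.
- rewrite -> Rmin_left, Rmax_right by lra. intros x Hx.
  apply continuity_pt_filterlim. now apply Hc.
- assert (H : (if Rlt_dec a c then if Rlt_dec c b then df c else 0 else 0) <= 0).
  { destruct (Rlt_dec a c); [|lra]. destruct (Rlt_dec c b); [|lra]. now apply Hs. }
  cbv beta in Hc2. nra.
Qed.

Lemma derive_ge_0_monotone (f df : R -> R) (a b : R) :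
  a <= b ->
  (forall x, a < x < b -> is_derive f x (df x)) ->
  (forall x, a <= x <= b -> continuous f x) ->
  (forall x, a < x < b -> 0 <= df x) -> f a <= f b.
Proof.
intros Hab Hd Hc Hs.
enough (- f b <= - f a) by lra.
apply (derive_le_0_antitone (fun x => - f x) (fun x => - df x)); auto.
- intros x Hx. apply: is_derive_opp. auto.
- intros x Hx. apply: continuous_opp. auto.
- intros x Hx. specialize (Hs x Hx). lra.
Qed.

Definition cderive (f : R -> C) (x : R) (l : C) : Prop :=
  is_derive (fun s => Re (f s)) x (Re l) /\
  is_derive (fun s => Im (f s)) x (Im l).

Definition ccont (f : R -> C) (x : R) : Prop :=
  continuous (fun s => Re (f s)) x /\ continuous (fun s => Im (f s)) x.

Lemma Cext (z w : C) : Re z = Re w -> Im z = Im w -> z = w.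
Proof. destruct z, w; cbn; now intros -> ->. Qed.

Lemma cderive_eq (f : R -> C) (x : R) (l l' : C) :
  cderive f x l -> l = l' -> cderive f x l'.
Proof. now intros H <-. Qed.

Lemma cderive_cont (f : R -> C) (x : R) (l : C) : cderive f x l -> ccont f x.
Proof.
intros [H1 H2]; split; apply: ex_derive_continuous; eexists; eassumption.
Qed.

Lemma cderive_const (c : C) (x : R) : cderive (fun _ => c) x 0.
Proof. split; apply: is_derive_const. Qed.

Lemma cderive_R (f : R -> R) (x l : R) :
  is_derive f x l -> cderive (fun s => RtoC (f s)) x (RtoC l).
Proof. intros H; split; cbn; [exact H|apply: is_derive_const]. Qed.

Lemma cderive_minus (f g : R -> C) (x : R) (l m : C) :
  cderive f x l -> cderive g x m -> cderive (fun s => f s - g s)%C x (l - m)%C.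
Proof.
intros [H1 H2] [H3 H4]; split; cbn.
- apply (is_derive_minus (fun s => Re (f s)) (fun s => Re (g s))); assumption.
- apply (is_derive_minus (fun s => Im (f s)) (fun s => Im (g s))); assumption.
Qed.

Lemma cderive_conj (f : R -> C) (x : R) (l : C) :
  cderive f x l -> cderive (fun s => Cconj (f s)) x (Cconj l).
Proof.
intros [H1 H2]; split; cbn; [exact H1|]. apply: is_derive_opp; assumption.
Qed.

Lemma cderive_mult (f g : R -> C) (x : R) (l m : C) :
  cderive f x l -> cderive g x m ->
  cderive (fun s => f s * g s)%C x (l * g x + f x * m)%C.
Proof.
intros [H1 H2] [H3 H4]; split; cbn; unfold Re, Im in *.
- eapply is_derive_eq.
  + apply (is_derive_minus (fun s => fst (f s) * fst (g s))
      (fun s => snd (f s) * snd (g s)));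
    (apply: is_derive_mult; [eassumption..|intros; apply: Rmult_comm]).
  + cbn. unfold plus, minus, opp, mult; cbn. unfold plus, minus, opp, mult; cbn. ring.
- eapply is_derive_eq.
  + apply (is_derive_plus (fun s => fst (f s) * snd (g s))
      (fun s => snd (f s) * fst (g s)));
    (apply: is_derive_mult; [eassumption..|intros; apply: Rmult_comm]).
  + cbn. unfold plus, minus, opp, mult; cbn. unfold plus, minus, opp, mult; cbn. ring.
Qed.

Lemma ccont_const (c : C) (x : R) : ccont (fun _ => c) x.
Proof. split; apply: continuous_const. Qed.

Lemma ccont_R (f : R -> R) (x : R) :
  continuous f x -> ccont (fun s => RtoC (f s)) x.
Proof. intros H; split; cbn; [exact H|apply: continuous_const]. Qed.

Lemma ccont_plus (f g : R -> C) (x : R) :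
  ccont f x -> ccont g x -> ccont (fun s => f s + g s)%C x.
Proof. intros [H1 H2] [H3 H4]; split; cbn; apply: continuous_plus; assumption. Qed.

Lemma ccont_minus (f g : R -> C) (x : R) :
  ccont f x -> ccont g x -> ccont (fun s => f s - g s)%C x.
Proof.
intros [H1 H2] [H3 H4]; split; cbn.
- apply (continuous_minus (fun s => Re (f s)) (fun s => Re (g s))); assumption.
- apply (continuous_minus (fun s => Im (f s)) (fun s => Im (g s))); assumption.
Qed.

Lemma ccont_conj (f : R -> C) (x : R) :
  ccont f x -> ccont (fun s => Cconj (f s)) x.
Proof.
intros [H1 H2]; split; cbn; [exact H1|]. apply: continuous_opp; assumption.
Qed.

Lemma ccont_mult (f g : R -> C) (x : R) :
  ccont f x -> ccont g x -> ccont (fun s => f s * g s)%C x.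
Proof.
intros [H1 H2] [H3 H4]; split; cbn; unfold Re, Im in *.
- apply (continuous_minus (fun s => fst (f s) * fst (g s))
      (fun s => snd (f s) * snd (g s))); apply: continuous_mult; assumption.
- apply (continuous_plus (fun s => fst (f s) * snd (g s))
      (fun s => snd (f s) * fst (g s))); apply: continuous_mult; assumption.
Qed.

Lemma Cmod_sqr (z : C) : Cmod z * Cmod z = Re z * Re z + Im z * Im z.
Proof. generalize (Cmod2_alt z); lra. Qed.

Lemma Csqr_neq0 (z : C) : z <> 0 -> 0 < Re z * Re z + Im z * Im z.
Proof. rewrite -Cmod_sqr => /Cmod_gt_0. nra. Qed.

Lemma Cinv_Re (z : C) : Re (/ z)%C = Re z / (Re z * Re z + Im z * Im z).
Proof. destruct z as [x y]; cbn. now rewrite !Rmult_1_r. Qed.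

Lemma Cinv_Im (z : C) : Im (/ z)%C = - Im z / (Re z * Re z + Im z * Im z).
Proof. destruct z as [x y]; cbn. now rewrite !Rmult_1_r. Qed.

Lemma continuous_Rdiv (f g : R -> R) (x : R) :
  continuous f x -> continuous g x -> g x <> 0 ->
  continuous (fun s => f s / g s) x.
Proof.
intros Hf Hg Hn. apply: continuous_mult; [exact Hf|].
apply continuity_pt_filterlim. apply continuity_pt_inv; [|exact Hn].
now apply continuity_pt_filterlim.
Qed.

Lemma ccont_inv (f : R -> C) (x : R) :
  ccont f x -> f x <> 0 -> ccont (fun s => / f s)%C x.
Proof.
intros [H1 H2] Hn. generalize (Csqr_neq0 _ Hn) => Hp.
assert (Hc : continuous (fun s => Re (f s) * Re (f s) + Im (f s) * Im (f s)) x).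
{ apply: continuous_plus; apply: continuous_mult; assumption. }
split.
- apply (continuous_ext
    (fun s => Re (f s) / (Re (f s) * Re (f s) + Im (f s) * Im (f s)))).
  { intros s. now rewrite Cinv_Re. }
  apply continuous_Rdiv; auto; lra.
- apply (continuous_ext
    (fun s => - Im (f s) / (Re (f s) * Re (f s) + Im (f s) * Im (f s)))).
  { intros s. now rewrite Cinv_Im. }
  apply continuous_Rdiv; auto; [|lra]. apply: continuous_opp; assumption.
Qed.

Lemma ccont_div (f g : R -> C) (x : R) :
  ccont f x -> ccont g x -> g x <> 0 -> ccont (fun s => f s / g s)%C x.
Proof. intros Hf Hg Hn. apply ccont_mult; auto. now apply ccont_inv. Qed.

Lemma continuous_Cmod (f : R -> C) (x : R) :
  ccont f x -> continuous (fun s => Cmod (f s)) x.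
Proof.
intros [H1 H2].
apply (continuous_ext
  (fun s => sqrt (Re (f s) * Re (f s) + Im (f s) * Im (f s)))).
{ intros s. unfold Cmod, Re, Im. f_equal. ring. }
apply (continuous_comp _ sqrt); [|apply continuous_sqrt].
apply: continuous_plus; apply: continuous_mult; assumption.
Qed.

Lemma ccont_ext (f g : R -> C) (x : R) :
  (forall s, f s = g s) -> ccont f x -> ccont g x.
Proof.
intros E [H1 H2]; split.
- apply (continuous_ext (fun s => Re (f s))); auto. intros s; now rewrite E.
- apply (continuous_ext (fun s => Im (f s))); auto. intros s; now rewrite E.
Qed.

Lemma Re_Cmod (z : C) : Rabs (Re z) <= Cmod z.
Proof. apply re_le_Cmod. Qed.

Lemma Im_Cmod (z : C) : Rabs (Im z) <= Cmod z.
Proof. apply Rle_trans with (2 := Rmax_Cmod z). apply Rmax_r. Qed.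

Lemma Cmod_le_abs (z : C) : Cmod z <= Rabs (Re z) + Rabs (Im z).
Proof.
generalize (Cmod_sqr z) (Cmod_ge_0 z).
unfold Rabs; destruct (Rcase_abs (Re z)), (Rcase_abs (Im z)); nra.
Qed.

Lemma Cmod_minus_le (p q : C) : Cmod (p - q) <= Cmod p + Cmod q.
Proof.
apply Rle_trans with (1 := Cmod_triangle _ _). rewrite Cmod_opp. lra.
Qed.

Lemma mean_value_inequality (F f : R -> C) (G g : R -> R) (a b : R) :
  a <= b ->
  (forall x, a < x < b -> cderive F x (f x)) ->
  (forall x, a <= x <= b -> ccont F x) ->
  (forall x, a < x < b -> is_derive G x (g x)) ->
  (forall x, a <= x <= b -> continuous G x) ->
  (forall x, a < x < b -> Cmod (f x) <= g x) ->
  Cmod (F b - F a) <= G b - G a.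
Proof.
intros Hab HF HcF HG HcG Hfg.
set (d := (F b - F a)%C).
assert (HGm : G a <= G b).
{ apply (derive_ge_0_monotone G g); auto.
  intros x Hx. apply Rle_trans with (2 := Hfg x Hx). apply Cmod_ge_0. }
destruct (Req_dec (Cmod d) 0) as [E|E]; [lra|].
assert (Hd : 0 < Cmod d) by (generalize (Cmod_ge_0 d); lra).
assert (H : (Re d * Re (F b) + Im d * Im (F b)) - Cmod d * G b <=
            (Re d * Re (F a) + Im d * Im (F a)) - Cmod d * G a).
{ apply (derive_le_0_antitone
    (fun x => (Re d * Re (F x) + Im d * Im (F x)) - Cmod d * G x)
    (fun x => (Re d * Re (f x) + Im d * Im (f x)) - Cmod d * g x)); auto.
  - intros x Hx. destruct (HF x Hx) as [H1 H2]. specialize (HG x Hx).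
    apply: is_derive_minus; [apply: is_derive_plus|];
      apply: is_derive_scal; assumption.
  - intros x Hx. destruct (HcF x Hx) as [H1 H2]. specialize (HcG x Hx).
    apply: continuous_minus; [apply: continuous_plus|];
      apply: continuous_mult; auto; apply: continuous_const.
  - intros x Hx. specialize (Hfg x Hx).
    assert (Re d * Re (f x) + Im d * Im (f x) <= Cmod d * Cmod (f x)).
    { replace (Re d * Re (f x) + Im d * Im (f x)) with (Re (Cconj d * f x)%C)
        by (unfold Re, Im; cbn; ring).
      rewrite -(Cmod_conj d) -Cmod_mult.
      apply Rle_trans with (2 := Re_Cmod _). apply Rle_abs. }
    nra. }
assert (Hq : (Re d * Re (F b) + Im d * Im (F b)) -
  (Re d * Re (F a) + Im d * Im (F a)) = Cmod d * Cmod d).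
{ rewrite Cmod_sqr. unfold d. destruct (F a), (F b); cbn. ring. }
nra.
Qed.

Definition cint (f : R -> C) (a b : R) : C :=
  (RInt (fun s => Re (f s)) a b, RInt (fun s => Im (f s)) a b).

Definition cexp (z : C) : C := (exp (Re z) * cos (Im z), exp (Re z) * sin (Im z)).

Lemma is_derive_RInt_below (T : Rbar) (f : R -> R) (a b : R) :
  (forall s : R, Rbar_lt s T -> continuous f s) -> Rbar_lt a T -> Rbar_lt b T ->
  is_derive (fun x => RInt f a x) b (f b).
Proof.
intros Hc Ha Hb. apply: is_derive_RInt; [|now apply Hc].
assert (Hl : locally b (fun x : R => Rbar_lt x T)).
{ exact (open_Rbar_lt' b T Hb). }
revert Hl. apply filter_imp. intros x Hx. apply: RInt_correct.
apply: ex_RInt_continuous. intros s [_ Hs]. apply Hc.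
apply (Rbar_le_lt_trans s (Rmax a x)); [exact Hs|].
unfold Rmax; destruct (Rle_dec a x); assumption.
Qed.

Lemma cderive_cint (T : Rbar) (f : R -> C) (a b : R) :
  (forall s : R, Rbar_lt s T -> ccont f s) -> Rbar_lt a T -> Rbar_lt b T ->
  cderive (cint f a) b (f b).
Proof.
intros Hc Ha Hb; split; cbn.
- apply (is_derive_RInt_below T (fun s => Re (f s))); auto. apply Hc.
- apply (is_derive_RInt_below T (fun s => Im (f s))); auto. apply Hc.
Qed.

Lemma cint_point (f : R -> C) (a : R) : cint f a a = 0.
Proof. unfold cint. now rewrite !RInt_point. Qed.

Lemma cderive_cexp (f : R -> C) (x : R) (l : C) :
  cderive f x l -> cderive (fun s => cexp (f s)) x (l * cexp (f x))%C.
Proof.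
intros [H1 H2].
assert (He : is_derive (fun s => exp (Re (f s))) x (Re l * exp (Re (f x)))).
{ apply (is_derive_comp exp (fun s => Re (f s))); [|assumption].
  apply is_derive_exp. }
assert (Hcos : is_derive (fun s => cos (Im (f s))) x (Im l * - sin (Im (f x)))).
{ apply (is_derive_comp cos (fun s => Im (f s))); [|assumption].
  apply is_derive_cos. }
assert (Hsin : is_derive (fun s => sin (Im (f s))) x (Im l * cos (Im (f x)))).
{ apply (is_derive_comp sin (fun s => Im (f s))); [|assumption].
  apply is_derive_sin. }
split.
- apply (is_derive_eq _ _ _ _ (is_derive_mult _ _ _ _ _ He Hcos Rmult_comm)).
  unfold plus, mult; cbn. unfold Re, Im. ring.
- apply (is_derive_eq _ _ _ _ (is_derive_mult _ _ _ _ _ He Hsin Rmult_comm)).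
  unfold plus, mult; cbn. unfold Re, Im. ring.
Qed.

Lemma cexp_plus (z w : C) : cexp (z + w) = (cexp z * cexp w)%C.
Proof.
destruct z as [a b], w as [c d]; unfold cexp; cbn.
apply Cext; cbn; rewrite exp_plus ?cos_plus ?sin_plus; ring.
Qed.

Lemma cexp_0 : cexp 0 = 1.
Proof. unfold cexp; cbn. rewrite exp_0 cos_0 sin_0. apply Cext; cbn; ring. Qed.

Lemma Cmod_cexp (z : C) : Cmod (cexp z) = exp (Re z).
Proof.
apply Rsqr_inj; [apply Cmod_ge_0|apply Rlt_le, exp_pos|].
unfold Rsqr. rewrite Cmod_sqr. unfold cexp; cbn.
generalize (sin2_cos2 (Im z)); unfold Rsqr. intros H.
replace (exp (Re z) * exp (Re z)) with (exp (Re z) * exp (Re z) * 1) by ring.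
rewrite -H. ring.
Qed.

Lemma cexp_neq0 (z : C) : cexp z <> 0.
Proof.
intros E. generalize (exp_pos (Re z)). rewrite -Cmod_cexp E Cmod_0. lra.
Qed.

Lemma ccont_cexp (f : R -> C) (x : R) : ccont f x -> ccont (fun s => cexp (f s)) x.
Proof.
intros [H1 H2]. split; unfold Re, Im in *; cbn; (apply: continuous_mult;
 [apply (continuous_comp _ exp); [assumption|]
 |apply (continuous_comp _ _); [assumption|]]).
all: apply: ex_derive_continuous; auto_derive; easy.
Qed.

Lemma cexp_minus_1_le (z : C) : Cmod (cexp z - 1) <= Cmod z * exp (Cmod z).
Proof.
generalize (mean_value_inequality (fun s => cexp (s * z)%C)
  (fun s => (z * cexp (s * z)%C)%C)
  (fun s => Cmod z * exp (Cmod z) * s) (fun s => Cmod z * exp (Cmod z)) 0 1) => H.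
assert (Hd : forall x, cderive (fun s => cexp (s * z)%C) x (z * cexp (x * z))%C).
{ intros x. eapply cderive_eq.
  - apply cderive_cexp. apply cderive_mult; [|apply cderive_const].
    apply cderive_R. apply: is_derive_id.
  - cbn. apply Cext; cbn; ring. }
replace (cexp z - 1)%C with (cexp (1%R * z) - cexp (0%R * z))%C.
2: { replace (0%R * z)%C with (RtoC 0) by ring. rewrite cexp_0. now rewrite Cmult_1_l. }
replace (Cmod z * exp (Cmod z)) with
  (Cmod z * exp (Cmod z) * 1 - Cmod z * exp (Cmod z) * 0) by ring.
apply H; clear H; auto; try lra.
- intros x _. eapply cderive_cont, Hd.
- intros x _. auto_derive; [easy|ring].
- intros x _. apply: ex_derive_continuous. now auto_derive.
- intros x Hx. rewrite Cmod_mult Cmod_cexp.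
  apply Rmult_le_compat_l; [apply Cmod_ge_0|].
  assert (Hr : Re (x * z)%C <= Cmod z).
  { replace (Re (x * z)%C) with (x * Re z) by (unfold Re; cbn; ring).
    generalize (Re_Cmod z) (Cmod_ge_0 z).
    unfold Rabs; destruct Rcase_abs; nra. }
  destruct Hr as [Hr|Hr]; [left; now apply exp_increasing|right; now rewrite Hr].
Qed.

(** * The backward Loewner trajectory near the tip *)

Lemma integrating_factor (T : Rbar) (F g : R -> C) (a b : R) :
  a <= b -> Rbar_lt b T ->
  (forall x : R, Rbar_lt x T -> ccont g x) ->
  (forall x, a <= x <= b -> ccont F x) ->
  (forall x, a < x < b -> cderive F x (F x * g x)%C) ->
  F b = (F a * cexp (cint g a b))%C.
Proof.
intros Hab Hb Hg HcF HF.
assert (HT : forall x, x <= b -> Rbar_lt x T).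
{ intros x Hx. now apply (Rbar_le_lt_trans x b). }
assert (HI : forall x, a <= x <= b -> cderive (cint g a) x (g x)).
{ intros x Hx. apply (cderive_cint T); auto. apply HT; lra. }
assert (HIm : forall x, a <= x <= b ->
  cderive (fun x => 0 - cint g a x)%C x (0 - g x)%C).
{ intros x Hx. apply cderive_minus; [apply cderive_const|auto]. }
set (H := fun x => (F x * cexp (0 - cint g a x))%C).
assert (E : Cmod (H b - H a)%C <= 0 - 0).
{ apply (mean_value_inequality H (fun _ => 0) (fun _ => 0) (fun _ => 0)); auto.
  - intros x Hx. eapply cderive_eq.
    + apply cderive_mult; [now apply HF|]. apply cderive_cexp, HIm; lra.
    + cbv beta. ring.
  - intros x Hx. apply ccont_mult; [now apply HcF|]. apply ccont_cexp.
    now apply (cderive_cont _ _ _ (HIm x Hx)).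
  - intros x Hx. apply: is_derive_const.
  - intros x Hx. apply: continuous_const.
  - intros x Hx. rewrite Cmod_0. lra. }
assert (E' : H b = H a).
{ replace (H b) with (H a + (H b - H a))%C by ring.
  rewrite (Cmod_eq_0 (H b - H a)); [ring|].
  generalize (Cmod_ge_0 (H b - H a)%C); lra. }
unfold H in E'. rewrite cint_point in E'.
replace (0 - 0)%C with (RtoC 0) in E' by ring. rewrite cexp_0 in E'.
transitivity (F b * cexp (0 - cint g a b) * cexp (cint g a b))%C.
- rewrite -Cmult_assoc -cexp_plus.
  replace (0 - cint g a b + cint g a b)%C with (RtoC 0) by ring.
  rewrite cexp_0. ring.
- rewrite E'. ring.
Qed.

Record backward (w : R -> R) (t y : R) (v : R -> C) : Prop := {
  backward_cont : forall s, ccont v s;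
  backward_end : v t = (0, y);
  backward_pos : forall s, 0 < Im (v s);
  backward_ode : forall s, 0 < s < t -> cderive v s (2 / v s - w s)%C
}.

Section Estimates.

Variables (w : R -> R) (M t y : R) (v : R -> C).
Hypothesis Hv : backward w t y v.
Hypothesis Hy : 0 < y.
Hypothesis Hw : forall s, 0 <= s <= t -> Rabs (w s) <= M.

Let a s := Re (v s).
Let b s := Im (v s).
Let n s := a s * a s + b s * b s.

Lemma backward_b_pos s : 0 < b s.
Proof. apply Hv. Qed.

Lemma backward_n_pos s : 0 < n s.
Proof. unfold n. generalize (backward_b_pos s). nra. Qed.

Lemma backward_Re_derive s : 0 < s < t -> is_derive a s (2 * a s / n s - w s).
Proof.
intros Hs. destruct (backward_ode _ _ _ _ Hv s Hs) as [H _].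
apply (is_derive_eq _ _ _ _ H).
change (Re (2 / v s - w s)%C) with
  (2 * Re (/ v s)%C - 0 * Im (/ v s)%C - w s).
rewrite Cinv_Re. fold (a s) (b s) (n s). field. generalize (backward_n_pos s); lra.
Qed.

Lemma backward_Im_derive s : 0 < s < t -> is_derive b s (- (2 * b s / n s)).
Proof.
intros Hs. destruct (backward_ode _ _ _ _ Hv s Hs) as [_ H].
apply (is_derive_eq _ _ _ _ H).
change (Im (2 / v s - w s)%C) with
  (2 * Im (/ v s)%C + 0 * Re (/ v s)%C - 0).
rewrite Cinv_Im. fold (a s) (b s) (n s). field. generalize (backward_n_pos s); lra.
Qed.

Lemma backward_a_cont s : continuous a s.
Proof. apply (backward_cont _ _ _ _ Hv). Qed.

Lemma backward_b_cont s : continuous b s.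
Proof. apply (backward_cont _ _ _ _ Hv). Qed.

Lemma backward_a_end : a t = 0.
Proof. unfold a. now rewrite (backward_end _ _ _ _ Hv). Qed.

Lemma backward_b_end : b t = y.
Proof. unfold b. now rewrite (backward_end _ _ _ _ Hv). Qed.

Ltac derive_from_ode :=
  match goal with
  | Hx : 0 < ?x < t |- is_derive _ ?x _ =>
    let H1 := fresh in let H2 := fresh in let Hn := fresh in let Hb := fresh in
    pose proof (backward_Re_derive x Hx) as H1;
    pose proof (backward_Im_derive x Hx) as H2;
    pose proof (backward_n_pos x) as Hn;
    pose proof (backward_b_pos x) as Hb;
    auto_derive;
    [repeat split; try (eexists; eassumption); try lra
    |rewrite ?(is_derive_unique (fun x => a x) _ _ H1)
             ?(is_derive_unique (fun x => b x) _ _ H2);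
     try (field; lra)]
  end.

Lemma backward_Im_antitone s1 s2 : 0 <= s1 <= s2 -> s2 <= t -> Im (v s2) <= Im (v s1).
Proof.
intros H1 H2. apply (derive_le_0_antitone b (fun s => - (2 * b s / n s))); try lra.
- intros x Hx. apply backward_Im_derive. lra.
- intros x Hx. apply backward_b_cont.
- intros x Hx. generalize (backward_n_pos x) (backward_b_pos x) => Hn Hb.
  assert (0 < 2 * b x / n x) by (apply Rdiv_lt_0_compat; lra). lra.
Qed.

Lemma backward_Im_upper s : 0 <= s <= t -> Im (v s) * Im (v s) <= y * y + 4 * (t - s).
Proof.
intros Hs.
enough (b s * b s + 4 * s <= b t * b t + 4 * t).
{ rewrite backward_b_end in H. unfold b in H. lra. }
apply (derive_ge_0_monotone (fun x => b x * b x + 4 * x)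
  (fun x => 4 - 4 * (b x * b x / n x))); try lra.
- intros x Hx. assert (Hx' : 0 < x < t) by lra. derive_from_ode.
- intros x Hx. apply: continuous_plus; apply: continuous_mult;
    try apply backward_b_cont; [apply: continuous_const|apply: continuous_id].
- intros x Hx. generalize (backward_n_pos x) (backward_b_pos x) => Hn Hb.
  assert (b x * b x / n x <= 1); [|lra].
  apply Rle_div_l; [lra|]. unfold n. nra.
Qed.

Lemma backward_Re_bound s : 0 <= s <= t -> Rabs (Re (v s)) <= M * (t - s).
Proof.
intros Hs.
assert (HM : 0 <= M).
{ generalize (Hw s Hs) (Rabs_pos (w s)); lra. }
assert (Hc : forall k x, continuous (fun x => a x * b x + k * (t - x) * b x) x).
{ intros k x. apply: continuous_plus; apply: continuous_mult;
    try apply backward_b_cont; [apply backward_a_cont|].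
  apply: ex_derive_continuous. now auto_derive. }
assert (Hd : forall k x, 0 < x < t ->
  is_derive (fun x => a x * b x + k * (t - x) * b x) x
    (- w x * b x - k * b x - k * (t - x) * (2 * b x / n x))).
{ intros k x Hx. derive_from_ode. }
assert (Hb := backward_b_pos s).
assert (H1 : a s * b s + (- M) * (t - s) * b s <= a t * b t + (- M) * (t - t) * b t).
{ apply (derive_ge_0_monotone (fun x => a x * b x + (- M) * (t - x) * b x)
   (fun x => - w x * b x - (- M) * b x - (- M) * (t - x) * (2 * b x / n x)));
   try lra; auto.
  - intros x Hx. apply Hd. lra.
  - intros x Hx. generalize (backward_n_pos x) (backward_b_pos x) => Hn Hbx.
    assert (0 < 2 * b x / n x) by (apply Rdiv_lt_0_compat; lra).
    assert (Rabs (w x) <= M) as [_ Hwx]%Rabs_le_between by (apply Hw; lra).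
    assert (0 <= M * (t - x)) by nra. nra. }
assert (H2 : a t * b t + M * (t - t) * b t <= a s * b s + M * (t - s) * b s).
{ apply (derive_le_0_antitone (fun x => a x * b x + M * (t - x) * b x)
   (fun x => - w x * b x - M * b x - M * (t - x) * (2 * b x / n x)));
   try lra; auto.
  - intros x Hx. apply Hd. lra.
  - intros x Hx. generalize (backward_n_pos x) (backward_b_pos x) => Hn Hbx.
    assert (0 < 2 * b x / n x) by (apply Rdiv_lt_0_compat; lra).
    assert (Rabs (w x) <= M) as [Hwx _]%Rabs_le_between by (apply Hw; lra).
    assert (0 <= M * (t - x)) by nra. nra. }
rewrite backward_a_end in H1, H2. fold (a s). apply Rabs_le. split; nra.
Qed.

(* Im v - 2 (t - s) / Im v is nonincreasing in s while (Re v)^2 <= 2 (t - s). *)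
Lemma backward_Im_lower_short s :
  0 <= s <= t -> M * M * (t - s) <= 2 -> 2 * (t - s) <= Im (v s) * Im (v s).
Proof.
intros Hs HM. fold (b s).
assert (H : b t - 2 * (t - t) / b t <= b s - 2 * (t - s) / b s).
{ apply (derive_le_0_antitone (fun x => b x - 2 * (t - x) / b x)
    (fun x => 2 * (a x * a x - 2 * (t - x)) / (b x * n x))); try lra.
  - intros x Hx. assert (Hx' : 0 < x < t) by lra. derive_from_ode. unfold n. field.
    fold (n x). lra.
  - intros x Hx. generalize (backward_b_pos x) => Hb.
    apply: continuous_minus; [apply backward_b_cont|].
    apply continuous_Rdiv; [|apply backward_b_cont|lra].
    apply: ex_derive_continuous. now auto_derive.
  - intros x Hx. generalize (backward_n_pos x) (backward_b_pos x) => Hn Hb.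
    assert (Ha : a x * a x <= 2 * (t - x)).
    { assert (Hr : Rabs (Re (v x)) <= M * (t - x)) by (apply backward_Re_bound; lra).
      apply Rabs_le_between in Hr. fold (a x) in Hr.
      assert (a x * a x <= (M * (t - x)) * (M * (t - x))) by nra.
      assert (M * M * (t - x) <= 2) by nra.
      assert (M * M * (t - x) * (t - x) <= 2 * (t - x)) by nra. lra. }
    assert (0 < / (b x * n x)) by (apply Rinv_0_lt_compat; nra).
    unfold Rdiv. nra. }
rewrite backward_b_end in H. assert (Hb := backward_b_pos s).
assert (H0 : 2 * (t - t) / y = 0) by (field; lra).
assert (H1 : 2 * (t - s) / b s <= b s) by (rewrite H0 in H; lra).
apply Rle_div_l in H1; lra.
Qed.

Lemma backward_Im_lower t0 s :
  0 < M -> t <= t0 -> 0 <= s <= t ->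
  2 / (1 + M * M * t0) * (t - s) <= Im (v s) * Im (v s).
Proof.
intros HM Ht Hs. fold (b s).
assert (HD : 0 < 1 + M * M * t0) by nra.
assert (HM2 : 0 < M * M) by nra.
assert (Hb := backward_b_pos s).
destruct (Rle_dec (M * M * (t - s)) 2) as [H|H].
- apply Rle_trans with (2 := backward_Im_lower_short s Hs H).
  apply Rmult_le_compat_r; [lra|]. apply Rle_div_l; [lra|]. nra.
- set (s' := t - 2 / (M * M)).
  assert (E : M * M * (t - s') = 2) by (unfold s'; field; lra).
  assert (Hs' : s <= s' <= t) by (split; nra).
  assert (H1 : 2 * (t - s') <= b s' * b s') by (apply backward_Im_lower_short; lra).
  assert (H2 : b s' <= b s) by (apply backward_Im_antitone; lra).
  assert (Hb' := backward_b_pos s').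
  assert (b s' * b s' <= b s * b s) by nra.
  apply Rle_trans with (2 := H0). apply Rle_trans with (2 := H1).
  apply Rmult_le_reg_l with (M * M); [lra|].
  replace (M * M * (2 * (t - s'))) with 4 by lra.
  replace (M * M * (2 / (1 + M * M * t0) * (t - s)))
    with ((2 * (M * M) * (t - s)) / (1 + M * M * t0)) by (field; lra).
  apply Rle_div_l; [lra|]. nra.
Qed.

End Estimates.

Definition root4 (x : R) : R := sqrt (sqrt x).

Lemma root4_ge_0 x : 0 <= root4 x.
Proof. apply sqrt_pos. Qed.

Lemma root4_pow4 x : 0 <= x -> root4 x * root4 x * (root4 x * root4 x) = x.
Proof.
intros Hx. unfold root4. rewrite sqrt_sqrt; [now apply sqrt_sqrt|apply sqrt_pos].
Qed.

Lemma root4_le x y : x <= y -> root4 x <= root4 y.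
Proof. intros H. now apply sqrt_le_1_alt, sqrt_le_1_alt. Qed.

Lemma root4_mult x y : 0 <= x -> root4 (x * y) = root4 x * root4 y.
Proof.
intros Hx. unfold root4. rewrite (sqrt_mult_alt x); auto.
apply sqrt_mult_alt, sqrt_pos.
Qed.

Lemma root4_continuous x : continuous root4 x.
Proof. apply (continuous_comp sqrt sqrt); apply continuous_sqrt. Qed.

Lemma le_root4 X Y : 0 <= X -> X * X * (X * X) <= Y -> X <= root4 Y.
Proof.
intros HX H. apply root4_le in H. apply Rle_trans with (2 := H).
unfold root4. rewrite sqrt_square; [|nra]. rewrite sqrt_square; lra.
Qed.

Section Integrals.

Variable (T : Rbar).

Lemma cint_tail_le (g : R -> C) (e a t A : R) :
  a <= t -> Rbar_lt e T -> Rbar_lt t T ->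
  (forall s : R, Rbar_lt s T -> ccont g s) ->
  (forall s, a < s < t -> Cmod (g s) <= A / sqrt (t - s)) ->
  Cmod (cint g e t - cint g e a) <= 2 * A * sqrt (t - a).
Proof.
intros Hat He Ht Hg HA.
assert (HT : forall x, x <= t -> Rbar_lt x T).
{ intros x Hx. now apply (Rbar_le_lt_trans x t). }
replace (2 * A * sqrt (t - a)) with
  (- (2 * A) * sqrt (t - t) - - (2 * A) * sqrt (t - a)).
2: { rewrite Rminus_diag sqrt_0. ring. }
apply (mean_value_inequality (cint g e) g (fun s => - (2 * A) * sqrt (t - s))
  (fun s => A / sqrt (t - s))); auto.
- intros x Hx. apply (cderive_cint T); auto. apply HT; lra.
- intros x Hx. eapply cderive_cont, (cderive_cint T); auto. apply HT; lra.
- intros x Hx. assert (0 < sqrt (t - x)) by (apply sqrt_lt_R0; lra).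
  auto_derive; [lra|]. change (t + - x) with (t - x). field; lra.
- intros x Hx. apply: continuous_mult; [apply: continuous_const|].
  apply (continuous_comp (fun s => t - s) sqrt); [|apply continuous_sqrt].
  apply: ex_derive_continuous. now auto_derive.
Qed.

Lemma cint_close (g1 g2 : R -> C) (t A : R) :
  0 <= t -> Rbar_lt t T ->
  (forall s : R, Rbar_lt s T -> ccont g1 s) ->
  (forall s : R, Rbar_lt s T -> ccont g2 s) ->
  (forall s, 0 < s < t ->
    Cmod (g1 s - g2 s) <= A / (root4 (t - s) * root4 (t - s) * root4 (t - s))) ->
  Cmod (cint g1 0 t - cint g2 0 t) <= 4 * A * root4 t.
Proof.
intros H0t Ht Hg1 Hg2 HA.
assert (HT : forall x, x <= t -> Rbar_lt x T).
{ intros x Hx. now apply (Rbar_le_lt_trans x t). }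
replace (4 * A * root4 t) with
  (- (4 * A) * root4 (t - t) - - (4 * A) * root4 (t - 0)).
2: { rewrite Rminus_diag Rminus_0_r. unfold root4. rewrite !sqrt_0. ring. }
replace (cint g1 0 t - cint g2 0 t)%C with
  ((cint g1 0 t - cint g2 0 t) - (cint g1 0 0 - cint g2 0 0))%C.
2: { rewrite !cint_point. ring. }
assert (Hd : forall x, x <= t ->
  cderive (fun x => cint g1 0 x - cint g2 0 x)%C x (g1 x - g2 x)%C).
{ intros x Hx. apply cderive_minus; apply (cderive_cint T); auto. }
apply (mean_value_inequality (fun x => cint g1 0 x - cint g2 0 x)%C
  (fun x => g1 x - g2 x)%C (fun s => - (4 * A) * root4 (t - s))
  (fun s => A / (root4 (t - s) * root4 (t - s) * root4 (t - s)))); auto.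
- intros x Hx. apply Hd; lra.
- intros x Hx. eapply cderive_cont, Hd; lra.
- intros x Hx. unfold root4. assert (H1 : 0 < sqrt (t - x)) by (apply sqrt_lt_R0; lra).
  assert (H2 : 0 < sqrt (sqrt (t - x))) by (apply sqrt_lt_R0; lra).
  auto_derive; [repeat split; auto; lra|].
  change (t + - x) with (t - x).
  assert (E := sqrt_sqrt (sqrt (t - x)) (Rlt_le _ _ H1)).
  set (q := sqrt (sqrt (t - x))) in *. rewrite -E. field; lra.
- intros x Hx. apply: continuous_mult; [apply: continuous_const|].
  apply (continuous_comp (fun s => t - s) root4); [|apply root4_continuous].
  apply: ex_derive_continuous. now auto_derive.
Qed.

End Integrals.

(* The two bounds have singularities r^(-3/2) and r^(-1/2); their weighted
   geometric mean r^(-3/4) is integrable and small with eta. *)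
Lemma interpolate_bounds (X B K c r eta : R) :
  0 <= X -> 0 < c -> 0 < r -> 0 <= eta -> 0 <= B -> 0 <= K ->
  X <= B * K * eta / (sqrt (c * r) * sqrt (c * r) * sqrt (c * r)) ->
  X <= 3 * B / sqrt (c * r) ->
  X <= root4 (27 * (B * B * (B * B)) * K / (c * c * c)) * root4 eta /
    (root4 r * root4 r * root4 r).
Proof.
intros HX Hc Hr Heta HB HK H1 H2.
set (m := sqrt (c * r)) in *.
assert (Hm : 0 < m) by (apply sqrt_lt_R0; nra).
assert (Hmm : m * m = c * r) by (apply sqrt_sqrt; nra).
assert (Hr4 := root4_pow4 r (Rlt_le _ _ Hr)).
assert (Hr0 : 0 < root4 r) by (apply sqrt_lt_R0, sqrt_lt_R0; lra).
assert (Hr3 : 0 < root4 r * root4 r * root4 r) by (repeat apply Rmult_lt_0_compat; lra).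
apply Rle_div_r; [exact Hr3|].
assert (HBK : 0 <= 27 * (B * B * (B * B)) * K / (c * c * c)).
{ apply Rdiv_le_0_compat; [|repeat apply Rmult_lt_0_compat; lra].
  repeat apply Rmult_le_pos; lra. }
rewrite -(root4_mult _ eta HBK).
apply le_root4; [apply Rmult_le_pos; lra|].
apply Rle_div_r in H1; [|repeat apply Rmult_lt_0_compat; lra].
apply Rle_div_r in H2; [|lra].
assert (HXm : 0 <= X * m) by nra.
assert (H3 : (X * m) * (X * m) <= 3 * B * (3 * B)) by (apply Rmult_le_compat; lra).
assert (H4 : (X * m) * (X * m) * (X * m) <= 3 * B * (3 * B) * (3 * B)).
{ apply Rmult_le_compat; try lra. nra. }
assert (H5 : X * (m * m * m) * ((X * m) * (X * m) * (X * m)) <=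
  B * K * eta * (3 * B * (3 * B) * (3 * B))).
{ apply Rmult_le_compat; try lra.
  - apply Rmult_le_pos; [lra|]. repeat apply Rmult_le_pos; lra.
  - repeat apply Rmult_le_pos; lra. }
assert (E : X * (m * m * m) * ((X * m) * (X * m) * (X * m)) =
  X * X * (X * X) * (r * r * r) * (c * c * c)).
{ transitivity (X * X * (X * X) * ((m * m) * (m * m) * (m * m))); [ring|].
  rewrite Hmm. ring. }
set (q3 := root4 r * root4 r * root4 r) in *.
replace (X * q3 * (X * q3) * (X * q3 * (X * q3))) with (X * X * (X * X) * (r * r * r)).
2: { rewrite -{1 2 3}Hr4. unfold q3. ring. }
replace (27 * (B * B * (B * B)) * K / (c * c * c) * eta) with
  (B * K * eta * (3 * B * (3 * B) * (3 * B)) / (c * c * c)) by (field; lra).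
apply -> Rle_div_r; [|repeat apply Rmult_lt_0_compat; lra].
rewrite -E. exact H5.
Qed.

(** * Two backward trajectories *)

Lemma Im_pos_neq0 (z : C) : 0 < Im z -> z <> 0.
Proof. intros H E. rewrite E in H. cbn in H. lra. Qed.

Lemma sqrt_le_of_sqr (x y : R) : 0 <= y -> x <= y * y -> sqrt x <= y.
Proof.
intros Hy H. rewrite -(sqrt_square y Hy). now apply sqrt_le_1_alt.
Qed.

Lemma le_sqrt_of_sqr (x y : R) : 0 <= x -> x * x <= y -> x <= sqrt y.
Proof.
intros Hx H. rewrite -(sqrt_square x Hx). now apply sqrt_le_1_alt.
Qed.

Lemma cint_opp (T : Rbar) (g : R -> C) (a b : R) :
  a <= b -> Rbar_lt b T -> (forall s : R, Rbar_lt s T -> ccont g s) ->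
  cint (fun s => 0 - g s)%C a b = (0 - cint g a b)%C.
Proof.
intros Hab Hb Hg.
assert (Hr : forall f : R -> R, (forall s : R, Rbar_lt s T -> continuous f s) ->
  RInt (fun s => 0 + - f s) a b = 0 + - RInt f a b).
{ intros f Hf. transitivity (RInt (fun s => opp (f s)) a b).
  - apply RInt_ext. intros s _. apply: Rplus_0_l.
  - rewrite Rplus_0_l. apply: RInt_opp. apply: ex_RInt_continuous.
    rewrite -> Rmin_left, Rmax_right by lra.
    intros s Hs. apply Hf. apply (Rbar_le_lt_trans s b); [apply Hs|exact Hb]. }
apply injective_projections.
- apply (Hr (fun s => Re (g s))). intros s Hs. now apply Hg.
- apply (Hr (fun s => Im (g s))). intros s Hs. now apply Hg.
Qed.

Section PairEstimates.

Variables (T : Rbar) (w : R -> R) (M t0 : R).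
Hypothesis HM : 0 < M.
Hypothesis Ht0 : 0 <= t0.
Hypothesis Ht0T : Rbar_lt t0 T.
Hypothesis Hwc : forall s : R, Rbar_lt s T -> continuous w s.
Hypothesis HwM : forall s, 0 <= s <= t0 -> Rabs (w s) <= M.

Let c := 2 / (1 + M * M * t0).
Let C0 := M * M * t0 + 4.

Lemma rate_pos : 0 < c.
Proof. apply Rdiv_lt_0_compat; nra. Qed.

Lemma below_T x : x <= t0 -> Rbar_lt x T.
Proof. intros Hx. now apply (Rbar_le_lt_trans x t0). Qed.

Section OneSolution.

Variables (t y : R) (v : R -> C).
Hypothesis Ht : 0 <= t <= t0.
Hypothesis Hy : 0 < y.
Hypothesis Hv : backward w t y v.

Let HwM' : forall s, 0 <= s <= t -> Rabs (w s) <= M.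
Proof. intros s Hs. apply HwM. lra. Qed.

Lemma backward_neq0 s : v s <> 0.
Proof. apply Im_pos_neq0, Hv. Qed.

Lemma backward_Im_sqrt s : 0 <= s <= t -> sqrt (c * (t - s)) <= Im (v s).
Proof.
intros Hs. apply sqrt_le_of_sqr; [apply Rlt_le, Hv|].
apply (backward_Im_lower w M t y v); auto; lra.
Qed.

Lemma backward_Cmod_sqrt s : 0 <= s <= t -> sqrt (c * (t - s)) <= Cmod (v s).
Proof.
intros Hs. apply Rle_trans with (1 := backward_Im_sqrt s Hs).
apply Rle_trans with (2 := Im_Cmod _). apply Rle_abs.
Qed.

Lemma backward_Cmod_upper s :
  0 <= s <= t -> Cmod (v s) * Cmod (v s) <= C0 * (t - s + y * y).
Proof.
intros Hs. rewrite Cmod_sqr.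
generalize (backward_Im_upper w t y v Hv s Hs).
generalize (backward_Re_bound w M t y v Hv HwM' s Hs).
intros H1%Rabs_le_between H2.
assert (H3 : Re (v s) * Re (v s) <= M * (t - s) * (M * (t - s))) by nra.
assert (H4 : M * (t - s) * (M * (t - s)) <= M * M * t0 * (t - s)).
{ replace (M * (t - s) * (M * (t - s))) with (M * M * (t - s) * (t - s)) by ring.
  apply Rmult_le_compat_r; [lra|]. apply Rmult_le_compat_l; nra. }
unfold C0. assert (0 <= M * M * t0 * (y * y)) by (apply Rmult_le_pos; nra).
assert (0 <= M * M * t0) by nra. nra.
Qed.

End OneSolution.

Variables (t1 t2 y1 y2 : R) (v1 v2 : R -> C).
Hypothesis Ht1 : 0 <= t1.
Hypothesis Ht12 : t1 <= t2.
Hypothesis Ht2 : t2 <= t0.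
Hypothesis Hy1 : 0 < y1 <= 1.
Hypothesis Hy2 : 0 < y2 <= 1.
Hypothesis Hv1 : backward w t1 y1 v1.
Hypothesis Hv2 : backward w t2 y2 v2.

Let eta := t2 - t1 + y1 * y1 + y2 * y2.
Let Q s := (v1 s * v1 s - v2 s * v2 s)%C.
Let g s := (- (2 * w s) / (v1 s + v2 s))%C.
Let lambda := 4 * M / sqrt c * sqrt t0.

Lemma sum_neq0 s : (v1 s + v2 s)%C <> 0.
Proof.
apply Im_pos_neq0. cbn. generalize (backward_pos _ _ _ _ Hv1 s)
  (backward_pos _ _ _ _ Hv2 s). unfold Im. lra.
Qed.

Lemma sum_Cmod_sqrt s : 0 <= s <= t1 -> sqrt (c * (t1 - s)) <= Cmod (v1 s + v2 s).
Proof.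
intros Hs. assert (H : sqrt (c * (t1 - s)) <= Im (v1 s)).
{ apply (backward_Im_sqrt t1 y1); auto; lra. }
apply Rle_trans with (2 := Im_Cmod _). apply Rle_trans with (2 := Rle_abs _).
generalize (backward_pos _ _ _ _ Hv2 s). cbn. unfold Im in *. lra.
Qed.

Lemma mean_kernel_cont (s : R) : Rbar_lt s T -> ccont g s.
Proof.
intros Hs. apply ccont_div; [| |apply sum_neq0].
- apply (ccont_ext (fun s => (RtoC (-2) * w s)%C)).
  { intros x. apply Cext; cbn; ring. }
  apply ccont_mult; [apply ccont_const|]. apply ccont_R. now apply Hwc.
- apply ccont_plus; [apply Hv1|apply Hv2].
Qed.

Lemma square_gap_formula s : 0 <= s <= t1 -> Q t1 = (Q s * cexp (cint g s t1))%C.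
Proof.
intros Hs. apply (integrating_factor T).
- lra.
- apply below_T; lra.
- apply mean_kernel_cont.
- intros x Hx. apply ccont_minus; apply ccont_mult; (apply Hv1 || apply Hv2).
- intros x Hx.
  assert (D1 := backward_ode _ _ _ _ Hv1 x ltac:(lra)).
  assert (D2 := backward_ode _ _ _ _ Hv2 x ltac:(lra)).
  eapply cderive_eq.
  + apply cderive_minus; apply cderive_mult; eassumption.
  + unfold Q, g. generalize (backward_neq0 t1 y1 v1 Hv1 x)
      (backward_neq0 t2 y2 v2 Hv2 x) (sum_neq0 x) => N1 N2 N3.
    field. auto.
Qed.

Lemma sqrt_gap s : s < t1 -> 0 < sqrt (c * (t1 - s)).
Proof.
intros Hs. apply sqrt_lt_R0. apply Rmult_lt_0_compat; [apply rate_pos|lra].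
Qed.

Lemma mean_kernel_le s : 0 < s < t1 -> Cmod (g s) <= 2 * M / sqrt c / sqrt (t1 - s).
Proof.
intros Hs. unfold g. rewrite Cmod_div; [|apply sum_neq0].
rewrite Cmod_opp Cmod_mult !Cmod_R (Rabs_pos_eq 2); [|lra].
assert (Hg := sqrt_gap s ltac:(lra)).
assert (Hc := rate_pos).
assert (H1 : 0 < sqrt c) by now apply sqrt_lt_R0.
assert (H2 : 0 < sqrt (t1 - s)) by (apply sqrt_lt_R0; lra).
replace (2 * M / sqrt c / sqrt (t1 - s)) with (2 * M / sqrt (c * (t1 - s))).
2: { rewrite sqrt_mult; try lra. field; lra. }
apply Rmult_le_compat.
- generalize (Rabs_pos (w s)); lra.
- apply Rlt_le, Rinv_0_lt_compat.
  apply Rlt_le_trans with (1 := Hg). apply sum_Cmod_sqrt; lra.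
- generalize (HwM s ltac:(lra)); lra.
- apply Rinv_le_contravar; [exact Hg|apply sum_Cmod_sqrt; lra].
Qed.

Lemma mean_kernel_integral_le s : 0 <= s <= t1 -> Cmod (cint g s t1) <= lambda.
Proof.
intros Hs.
replace (cint g s t1) with (cint g s t1 - cint g s s)%C
    by (rewrite cint_point; ring).
  assert (Hc := rate_pos). assert (H1 : 0 < sqrt c) by now apply sqrt_lt_R0.
  apply Rle_trans with (2 * (2 * M / sqrt c) * sqrt (t1 - s)).
  - apply (cint_tail_le T); [lra|apply below_T; lra|apply below_T; lra|apply mean_kernel_cont|].
    intros x Hx. apply mean_kernel_le. lra.
  - unfold lambda. replace (4 * M / sqrt c) with (2 * (2 * M / sqrt c)) by (field; lra).
    apply Rmult_le_compat_l.
    + assert (0 < M / sqrt c) by (apply Rdiv_lt_0_compat; lra). lra.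
    + apply sqrt_le_1_alt. lra.
Qed.

Lemma square_gap_end_le : Cmod (Q t1) <= C0 * eta.
Proof.
unfold Q. rewrite (backward_end _ _ _ _ Hv1).
generalize (backward_Cmod_upper t2 y2 v2 ltac:(lra) Hv2 t1 ltac:(lra)) => H.
replace ((0, y1) * (0, y1) - v2 t1 * v2 t1)%C
  with (RtoC (- (y1 * y1)) + (- (v2 t1 * v2 t1)))%C.
2: { apply Cext; cbn; ring. }
apply Rle_trans with (1 := Cmod_triangle _ _).
rewrite Cmod_opp Cmod_mult Cmod_R Rabs_Ropp Rabs_pos_eq; [|nra].
apply Rle_trans with (y1 * y1 + C0 * (t2 - t1 + y2 * y2)); [lra|].
unfold eta. assert (1 <= C0) by (unfold C0; nra).
assert (0 <= y1 * y1) by nra. nra.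
Qed.

Lemma square_gap_le s : 0 <= s <= t1 -> Cmod (Q s) <= C0 * exp lambda * eta.
Proof.
intros Hs. assert (E := square_gap_formula s Hs).
apply (f_equal (fun z => Cmod z)) in E. rewrite Cmod_mult Cmod_cexp in E.
assert (Hl := mean_kernel_integral_le s Hs).
assert (Hr : - lambda <= Re (cint g s t1)).
{ generalize (Re_Cmod (cint g s t1)). unfold Rabs; destruct Rcase_abs; lra. }
assert (He : exp (- lambda) <= exp (Re (cint g s t1))).
{ destruct Hr as [Hr|Hr]; [left; now apply exp_increasing|right; now rewrite -Hr]. }
assert (H := square_gap_end_le).
assert (Hp := exp_pos lambda).
assert (Hi : exp (- lambda) * exp lambda = 1).
{ rewrite -exp_plus Rplus_opp_l. apply exp_0. }
assert (H2 : Cmod (Q s) * exp (- lambda) <= C0 * eta).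
{ apply Rle_trans with (2 := H). rewrite E.
  apply Rmult_le_compat_l; [apply Cmod_ge_0|exact He]. }
replace (Cmod (Q s)) with (Cmod (Q s) * exp (- lambda) * exp lambda).
2: { rewrite Rmult_assoc Hi. ring. }
replace (C0 * exp lambda * eta) with (C0 * eta * exp lambda) by ring.
apply Rmult_le_compat_r; lra.
Qed.

Let A := root4 (27 * (M * M * (M * M)) * (C0 * exp lambda) / (c * c * c)).

Lemma gap_ge_0 : 0 <= eta.
Proof. unfold eta. nra. Qed.

Lemma growth_pos : 0 < C0.
Proof. unfold C0. nra. Qed.

Lemma quotient_close (d p1 p2 p3 : C) (b s : R) :
  0 <= s < t1 -> Rabs b <= M ->
  sqrt (c * (t1 - s)) <= Cmod p1 -> sqrt (c * (t1 - s)) <= Cmod p2 ->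
  sqrt (c * (t1 - s)) <= Cmod p3 ->
  d = (b * Q s / (p1 * p2 * p3))%C ->
  Cmod d <= 3 * M / sqrt (c * (t1 - s)) ->
  Cmod d <= A * root4 eta /
    (root4 (t1 - s) * root4 (t1 - s) * root4 (t1 - s)).
Proof.
intros Hs Hb H1 H2 H3 E Hd.
assert (Hm := sqrt_gap s ltac:(lra)).
unfold A. apply interpolate_bounds with (c := c); auto.
- apply Cmod_ge_0.
- apply rate_pos.
- lra.
- apply gap_ge_0.
- lra.
- apply Rmult_le_pos; [apply Rlt_le, growth_pos|apply Rlt_le, exp_pos].
- set (m := sqrt (c * (t1 - s))) in *.
  assert (Hp : m * m * m <= Cmod (p1 * p2 * p3)).
  { rewrite !Cmod_mult. apply Rmult_le_compat; try lra; [nra|].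
    apply Rmult_le_compat; lra. }
  assert (Hm3 : 0 < m * m * m) by (repeat apply Rmult_lt_0_compat; lra).
  rewrite E Cmod_div; [|apply Cmod_gt_0; lra].
  rewrite Cmod_mult Cmod_R.
  replace (M * (C0 * exp lambda) * eta) with (M * (C0 * exp lambda * eta)) by ring.
  apply Rmult_le_compat.
  + apply Rmult_le_pos; [apply Rabs_pos|apply Cmod_ge_0].
  + apply Rlt_le, Rinv_0_lt_compat. lra.
  + apply Rmult_le_compat; auto; [apply Rabs_pos|apply Cmod_ge_0|].
    apply square_gap_le; lra.
  + now apply Rinv_le_contravar.
Qed.

Lemma Cmod_div_le (b m : R) (p : C) :
  0 < m -> m <= Cmod p -> Rabs b <= M -> Cmod (b / p)%C <= M / m.
Proof.
intros Hm Hp Hb. rewrite Cmod_div; [|apply Cmod_gt_0; lra]. rewrite Cmod_R.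
apply Rmult_le_compat; auto; [apply Rabs_pos|apply Rlt_le, Rinv_0_lt_compat; lra|].
now apply Rinv_le_contravar.
Qed.

Lemma kernel_close (b : R -> R) (s : R) :
  0 < s < t1 -> Rabs (b s) <= M ->
  Cmod (b s / v1 s - b s / v2 s)%C <= A * root4 eta /
    (root4 (t1 - s) * root4 (t1 - s) * root4 (t1 - s)).
Proof.
intros Hs Hb.
assert (H1 : sqrt (c * (t1 - s)) <= Cmod (v1 s)).
{ apply (backward_Cmod_sqrt t1 y1); auto; lra. }
assert (H2 : sqrt (c * (t1 - s)) <= Cmod (v2 s)).
{ apply Rle_trans with (sqrt (c * (t2 - s))).
  - apply sqrt_le_1_alt. apply Rmult_le_compat_l; [apply Rlt_le, rate_pos|lra].
  - apply (backward_Cmod_sqrt t2 y2); auto; lra. }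
assert (H3 := sum_Cmod_sqrt s ltac:(lra)).
assert (Hm := sqrt_gap s ltac:(lra)).
rewrite -(Cmod_opp (_ - _)).
apply quotient_close with (p1 := v1 s) (p2 := v2 s) (p3 := (v1 s + v2 s)%C) (b := b s);
  auto; try lra.
- unfold Q. generalize (backward_neq0 t1 y1 v1 Hv1 s)
      (backward_neq0 t2 y2 v2 Hv2 s) (sum_neq0 s) => N1 N2 N3. field. auto.
- rewrite Cmod_opp. apply Rle_trans with (1 := Cmod_minus_le _ _).
  assert (X1 := Cmod_div_le (b s) _ _ Hm H1 Hb).
  assert (X2 := Cmod_div_le (b s) _ _ Hm H2 Hb).
  assert (0 < M / sqrt (c * (t1 - s))) by (apply Rdiv_lt_0_compat; lra).
  replace (3 * M / sqrt (c * (t1 - s))) with (3 * (M / sqrt (c * (t1 - s)))) by (field; lra).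
  lra.
Qed.

Lemma mean_kernel_close (s : R) :
  0 < s < t1 ->
  Cmod (- g s - w s / v1 s)%C <= A * root4 eta /
    (root4 (t1 - s) * root4 (t1 - s) * root4 (t1 - s)).
Proof.
intros Hs.
assert (Hb := HwM s ltac:(lra)).
assert (H1 : sqrt (c * (t1 - s)) <= Cmod (v1 s)).
{ apply (backward_Cmod_sqrt t1 y1); auto; lra. }
assert (H3 := sum_Cmod_sqrt s ltac:(lra)).
assert (Hm := sqrt_gap s ltac:(lra)).
apply quotient_close with (p1 := v1 s) (p2 := (v1 s + v2 s)%C) (p3 := (v1 s + v2 s)%C) (b := w s);
  auto; try lra.
- unfold Q, g. generalize (backward_neq0 t1 y1 v1 Hv1 s) (sum_neq0 s) => N1 N3.
  field. auto.
- apply Rle_trans with (1 := Cmod_minus_le _ _).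
  assert (X1 := Cmod_div_le (w s) _ _ Hm H1 Hb).
  assert (X2 := Cmod_div_le (w s) _ _ Hm H3 Hb).
  assert (0 < M / sqrt (c * (t1 - s))) by (apply Rdiv_lt_0_compat; lra).
  replace (3 * M / sqrt (c * (t1 - s))) with (3 * (M / sqrt (c * (t1 - s)))) by (field; lra).
  replace (- g s)%C with (2%R * (w s / (v1 s + v2 s)))%C.
  + rewrite Cmod_mult Cmod_R Rabs_pos_eq; lra.
  + unfold g. generalize (sum_neq0 s) => N. field. auto.
Qed.

Let D := 4 * A * root4 t0 + 2 * (M / sqrt c) * root4 (t0 + 2).

Lemma modulus_ge_0 : 0 <= A.
Proof. apply root4_ge_0. Qed.

Lemma kernel_integral_close (b : R -> R) :
  (forall s : R, Rbar_lt s T -> continuous b s) ->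
  (forall s, 0 <= s <= t0 -> Rabs (b s) <= M) ->
  Cmod (cint (fun s => b s / v1 s)%C 0 t1 - cint (fun s => b s / v2 s)%C 0 t2)
    <= D * root4 eta.
Proof.
intros Hbc HbM.
assert (Hc1 : forall s : R, Rbar_lt s T -> ccont (fun s => b s / v1 s)%C s).
{ intros s Hs. apply ccont_div; [apply ccont_R; auto|apply Hv1|].
  now apply (backward_neq0 t1 y1). }
assert (Hc2 : forall s : R, Rbar_lt s T -> ccont (fun s => b s / v2 s)%C s).
{ intros s Hs. apply ccont_div; [apply ccont_R; auto|apply Hv2|].
  now apply (backward_neq0 t2 y2). }
assert (Hc := rate_pos).
assert (Hsc : 0 < sqrt c) by now apply sqrt_lt_R0.
assert (Hq := root4_ge_0 eta).
assert (H1 : Cmod (cint (fun s => b s / v1 s)%C 0 t1 - cint (fun s => b s / v2 s)%C 0 t1)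
  <= 4 * (A * root4 eta) * root4 t1).
{ apply (cint_close T); auto; [apply below_T; lra|].
  intros s Hs. apply kernel_close; auto. apply HbM; lra. }
assert (H2 : Cmod (cint (fun s => b s / v2 s)%C 0 t2 - cint (fun s => b s / v2 s)%C 0 t1)
  <= 2 * (M / sqrt c) * sqrt (t2 - t1)).
{ apply (cint_tail_le T); auto; try (apply below_T; lra).
  intros s Hs. replace (M / sqrt c / sqrt (t2 - s)) with (M / sqrt (c * (t2 - s))).
  - apply Cmod_div_le; [|apply (backward_Cmod_sqrt t2 y2); auto; lra|apply HbM; lra].
    apply sqrt_lt_R0, Rmult_lt_0_compat; lra.
  - assert (0 < sqrt (t2 - s)) by (apply sqrt_lt_R0; lra).
    rewrite sqrt_mult; try lra. field; lra. }
assert (H3 : root4 t1 <= root4 t0) by (apply root4_le; lra).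
assert (H4 : sqrt (t2 - t1) <= root4 (t0 + 2) * root4 eta).
{ assert (He : eta <= t0 + 2) by (unfold eta; nra).
  apply root4_le in He.
  apply Rle_trans with (root4 eta * root4 eta).
  - unfold root4. rewrite sqrt_sqrt; [|apply sqrt_pos]. apply sqrt_le_1_alt.
    unfold eta. nra.
  - apply Rmult_le_compat_r; auto. }
replace (_ - _)%C with
 ((cint (fun s => b s / v1 s)%C 0 t1 - cint (fun s => b s / v2 s)%C 0 t1) -
  (cint (fun s => b s / v2 s)%C 0 t2 - cint (fun s => b s / v2 s)%C 0 t1))%C by ring.
apply Rle_trans with (1 := Cmod_minus_le _ _).
unfold D. assert (HA := modulus_ge_0).
assert (HMc : 0 < M / sqrt c) by (apply Rdiv_lt_0_compat; lra).
assert (4 * (A * root4 eta) * root4 t1 <= 4 * (A * root4 eta) * root4 t0).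
{ apply Rmult_le_compat_l; auto. assert (0 <= A * root4 eta) by now apply Rmult_le_pos. lra. }
assert (2 * (M / sqrt c) * sqrt (t2 - t1) <= 2 * (M / sqrt c) * (root4 (t0 + 2) * root4 eta)).
{ apply Rmult_le_compat_l; lra. }
lra.
Qed.

Lemma square_gap_end_close (Hy12 : y1 = y2) :
  Cmod (Q t1 - RtoC (4 * (t2 - t1)))%C <=
    2 * M * sqrt (C0 * eta) * (t2 - t1).
Proof.
assert (H : Cmod ((v2 t2 * v2 t2 - RtoC (4 * t2)) - (v2 t1 * v2 t1 - RtoC (4 * t1)))%C <=
  2 * M * sqrt (C0 * eta) * t2 - 2 * M * sqrt (C0 * eta) * t1).
{ apply (mean_value_inequality (fun s => v2 s * v2 s - RtoC (4 * s))%C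
    (fun s => - (2 * w s) * v2 s)%C (fun s => 2 * M * sqrt (C0 * eta) * s)
    (fun _ => 2 * M * sqrt (C0 * eta))).
  - lra.
  - intros x Hx. assert (D2 := backward_ode _ _ _ _ Hv2 x ltac:(lra)).
    eapply cderive_eq.
    + apply cderive_minus; [apply cderive_mult; eassumption|].
      apply cderive_R with (l := 4). auto_derive; auto; ring.
    + assert (N := backward_neq0 t2 y2 v2 Hv2 x).
      replace (RtoC 4) with (2 + 2)%C by (apply Cext; cbn; ring). field. auto.
  - intros x Hx. apply ccont_minus; [apply ccont_mult; apply Hv2|].
    apply ccont_R. apply: ex_derive_continuous. now auto_derive.
  - intros x Hx. auto_derive; auto; ring.
  - intros x Hx. apply: ex_derive_continuous. now auto_derive.
  - intros x Hx. rewrite Cmod_mult Cmod_opp Cmod_mult !Cmod_R (Rabs_pos_eq 2); [|lra].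
    apply Rmult_le_compat.
    + generalize (Rabs_pos (w x)); lra.
    + apply Cmod_ge_0.
    + generalize (HwM x ltac:(lra)); lra.
    + apply le_sqrt_of_sqr; [apply Cmod_ge_0|].
      apply Rle_trans with (1 := backward_Cmod_upper t2 y2 v2 ltac:(lra) Hv2 x ltac:(lra)).
      apply Rmult_le_compat_l; [apply Rlt_le, growth_pos|].
      unfold eta. nra. }
replace (2 * M * sqrt (C0 * eta) * (t2 - t1)) with
  (2 * M * sqrt (C0 * eta) * t2 - 2 * M * sqrt (C0 * eta) * t1) by ring.
apply Rle_trans with (2 := H). right. f_equal.
unfold Q. rewrite (backward_end _ _ _ _ Hv1) (backward_end _ _ _ _ Hv2) Hy12.
rewrite Rmult_minus_distr_l RtoC_minus. ring.
Qed.

Lemma square_increment_eq :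
  (v2 0 * v2 0 - v1 0 * v1 0)%C =
  (- Q t1 * cexp (0 - cint g 0 t1))%C.
Proof.
rewrite (square_gap_formula 0); [|lra]. unfold Q.
transitivity ((v2 0 * v2 0 - v1 0 * v1 0) *
  (cexp (cint g 0 t1) * cexp (0 - cint g 0 t1)))%C; [|ring].
rewrite -cexp_plus. replace (cint g 0 t1 + (0 - cint g 0 t1))%C with (RtoC 0) by ring.
rewrite cexp_0. ring.
Qed.

Lemma mean_kernel_integral_close :
  Cmod ((0 - cint g 0 t1) - cint (fun s => w s / v1 s)%C 0 t1)%C <= 4 * A * root4 t0 * root4 eta.
Proof.
assert (Hc1 : forall s : R, Rbar_lt s T -> ccont (fun s => w s / v1 s)%C s).
{ intros s Hs. apply ccont_div; [apply ccont_R; auto|apply Hv1|].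
  now apply (backward_neq0 t1 y1). }
assert (E : cint (fun s => 0 - g s)%C 0 t1 = (0 - cint g 0 t1)%C).
{ apply (cint_opp T); [lra|apply below_T; lra|apply mean_kernel_cont]. }
rewrite -E.
apply Rle_trans with (4 * (A * root4 eta) * root4 t1).
- apply (cint_close T); auto; [apply below_T; lra| |].
  + intros s Hs. apply ccont_minus; [apply ccont_const|now apply mean_kernel_cont].
  + intros s Hs. replace (0 - g s)%C with (- g s)%C by ring. now apply mean_kernel_close.
- assert (root4 t1 <= root4 t0) by (apply root4_le; lra).
  assert (0 <= A * root4 eta) by (apply Rmult_le_pos; apply root4_ge_0). nra.
Qed.

Let X0 := 4 * A * root4 t0.

Let K := 2 * M * sqrt C0 * root4 (t0 + 2) * exp lambda +
  4 * exp (lambda + X0 * root4 (t0 + 2)) * (X0 * exp (X0 * root4 (t0 + 2))).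

Lemma square_increment (Hy12 : y1 = y2) :
  Cmod (v2 0 * v2 0 - v1 0 * v1 0 +
    4 * (t2 - t1)%R * cexp (cint (fun s => w s / v1 s) 0 t1))%C
  <= K * (t2 - t1) * root4 eta.
Proof.
assert (HG := mean_kernel_integral_le 0 ltac:(lra)).
assert (HGE := mean_kernel_integral_close).
assert (He := square_gap_end_close Hy12).
rewrite square_increment_eq.
set (G := (0 - cint g 0 t1)%C) in *.
set (E := cint (fun s => w s / v1 s)%C 0 t1) in *.
set (e := (Q t1 - RtoC (4 * (t2 - t1)))%C) in *.
assert (Hq := root4_ge_0 eta).
assert (HX : 0 <= X0).
{ unfold X0. assert (0 <= A * root4 t0) by (apply Rmult_le_pos; apply root4_ge_0). lra. }
fold X0 in HGE.
assert (Hq2 : root4 eta <= root4 (t0 + 2)).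
{ apply root4_le. unfold eta. nra. }
assert (HXq : X0 * root4 eta <= X0 * root4 (t0 + 2)) by (apply Rmult_le_compat_l; lra).
assert (HGl : Cmod G <= lambda).
{ replace G with (- cint g 0 t1)%C by (unfold G; ring). now rewrite Cmod_opp. }
assert (Hexp : forall z r, Cmod z <= r -> Cmod (cexp z) <= exp r).
{ intros z r Hz. rewrite Cmod_cexp.
  assert (Hr : Re z <= r).
  { generalize (Re_Cmod z) (Rle_abs (Re z)). lra. }
  destruct Hr as [Hr|Hr]; [left; now apply exp_increasing|right; now rewrite Hr]. }
assert (HEl : Cmod E <= lambda + X0 * root4 (t0 + 2)).
{ replace E with (G - (G - E))%C by ring.
  apply Rle_trans with (1 := Cmod_minus_le _ _). lra. }
replace (- Q t1 * cexp G + 4 * (t2 - t1)%R * cexp E)%C with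
  (- (e * cexp G) - RtoC (4 * (t2 - t1)) * cexp E * (cexp (G - E) - 1))%C.
2: { replace (cexp G) with (cexp E * cexp (G - E))%C.
  - unfold e. rewrite RtoC_mult. ring.
  - rewrite -cexp_plus. f_equal. ring. }
apply Rle_trans with (1 := Cmod_minus_le _ _).
rewrite Cmod_opp !Cmod_mult Cmod_R Rabs_pos_eq; [|lra].
assert (H1 : Cmod e * Cmod (cexp G) <=
  2 * M * sqrt (C0 * eta) * (t2 - t1) * exp lambda).
{ apply Rmult_le_compat; auto using Cmod_ge_0. }
assert (H2 : sqrt (C0 * eta) <= sqrt C0 * (root4 (t0 + 2) * root4 eta)).
{ rewrite sqrt_mult_alt; [|apply Rlt_le, growth_pos].
  apply Rmult_le_compat_l; [apply sqrt_pos|].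
  replace (sqrt eta) with (root4 eta * root4 eta) by apply sqrt_sqrt, sqrt_pos.
  now apply Rmult_le_compat_r. }
assert (H3 : Cmod (cexp (G - E) - 1) <= X0 * exp (X0 * root4 (t0 + 2)) * root4 eta).
{ apply Rle_trans with (1 := cexp_minus_1_le _).
  replace (X0 * exp (X0 * root4 (t0 + 2)) * root4 eta) with
    (X0 * root4 eta * exp (X0 * root4 (t0 + 2))) by ring.
  apply Rmult_le_compat; auto using Cmod_ge_0; [apply Rlt_le, exp_pos|].
  assert (Hr : Cmod (G - E) <= X0 * root4 (t0 + 2)) by lra.
  destruct Hr as [Hr|Hr]; [left; now apply exp_increasing|right; now rewrite Hr]. }
assert (H4 : 4 * (t2 - t1) * Cmod (cexp E) * Cmod (cexp (G - E) - 1) <=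
  4 * (t2 - t1) * exp (lambda + X0 * root4 (t0 + 2)) *
    (X0 * exp (X0 * root4 (t0 + 2)) * root4 eta)).
{ apply Rmult_le_compat; auto using Cmod_ge_0.
  - apply Rmult_le_pos; [lra|apply Cmod_ge_0].
  - apply Rmult_le_compat_l; [lra|]. now apply Hexp. }
assert (H5 : 2 * M * sqrt (C0 * eta) * (t2 - t1) * exp lambda <=
  2 * M * (sqrt C0 * (root4 (t0 + 2) * root4 eta)) * (t2 - t1) * exp lambda).
{ apply Rmult_le_compat_r; [apply Rlt_le, exp_pos|].
  apply Rmult_le_compat_r; [lra|]. apply Rmult_le_compat_l; lra. }
unfold K. lra.
Qed.

End PairEstimates.

Lemma kernel_integral_modulus (T : Rbar) (w b : R -> R) (M t0 : R) :
  0 < M -> 0 <= t0 -> Rbar_lt t0 T ->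
  (forall s : R, Rbar_lt s T -> continuous w s) ->
  (forall s, 0 <= s <= t0 -> Rabs (w s) <= M) ->
  (forall s : R, Rbar_lt s T -> continuous b s) ->
  (forall s, 0 <= s <= t0 -> Rabs (b s) <= M) ->
  exists K, forall t1 t2 y1 y2 v1 v2,
    0 <= t1 -> t1 <= t2 -> t2 <= t0 -> 0 < y1 <= 1 -> 0 < y2 <= 1 ->
    backward w t1 y1 v1 -> backward w t2 y2 v2 ->
    Cmod (cint (fun s => b s / v1 s)%C 0 t1 - cint (fun s => b s / v2 s)%C 0 t2)
    <= K * root4 (t2 - t1 + y1 * y1 + y2 * y2).
Proof.
intros HM Ht0 HT Hwc HwM Hbc HbM. eexists.
intros t1 t2 y1 y2 v1 v2 Ht1 Ht12 Ht2 Hy1 Hy2 Hv1 Hv2.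
eapply (kernel_integral_close T w); eassumption.
Qed.

Lemma square_increment_modulus (T : Rbar) (w : R -> R) (M t0 : R) :
  0 < M -> 0 <= t0 -> Rbar_lt t0 T ->
  (forall s : R, Rbar_lt s T -> continuous w s) ->
  (forall s, 0 <= s <= t0 -> Rabs (w s) <= M) ->
  exists K, forall t1 t2 y v1 v2,
    0 <= t1 -> t1 <= t2 -> t2 <= t0 -> 0 < y <= 1 ->
    backward w t1 y v1 -> backward w t2 y v2 ->
    Cmod (v2 0 * v2 0 - v1 0 * v1 0 +
      4 * (t2 - t1)%R * cexp (cint (fun s => w s / v1 s) 0 t1))%C
    <= K * (t2 - t1) * root4 (t2 - t1 + y * y + y * y).
Proof.
intros HM Ht0 HT Hwc HwM. eexists.
intros t1 t2 y v1 v2 Ht1 Ht12 Ht2 Hy Hv1 Hv2.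
eapply (square_increment T w); eauto.
Qed.

(** * The limit at the tip *)

Definition climit (f : R -> C) (l : C) : Prop :=
  filterlim (fun s => Re (f s)) (at_right 0) (locally (Re l)) /\
  filterlim (fun s => Im (f s)) (at_right 0) (locally (Im l)).

Lemma filterlim_Rplus (f g : R -> R) (l m : R) :
  filterlim f (at_right 0) (locally l) -> filterlim g (at_right 0) (locally m) ->
  filterlim (fun s => f s + g s) (at_right 0) (locally (l + m)).
Proof.
intros Hf Hg. eapply filterlim_comp_2; [exact Hf|exact Hg|].
apply: filterlim_plus.
Qed.

Lemma filterlim_Rmult (f g : R -> R) (l m : R) :
  filterlim f (at_right 0) (locally l) -> filterlim g (at_right 0) (locally m) ->
  filterlim (fun s => f s * g s) (at_right 0) (locally (l * m)).
Proof.
intros Hf Hg. eapply filterlim_comp_2; [exact Hf|exact Hg|].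
apply: filterlim_mult.
Qed.

Lemma filterlim_Ropp (f : R -> R) (l : R) :
  filterlim f (at_right 0) (locally l) -> filterlim (fun s => - f s) (at_right 0) (locally (- l)).
Proof.
intros Hf. eapply filterlim_comp; [exact Hf|]. apply: filterlim_opp.
Qed.

Lemma climit_const (c : C) : climit (fun _ => c) c.
Proof. split; apply filterlim_const. Qed.

Lemma climit_plus (f g : R -> C) (l m : C) :
  climit f l -> climit g m -> climit (fun s => f s + g s)%C (l + m)%C.
Proof. intros [H1 H2] [H3 H4]; split; now apply filterlim_Rplus. Qed.

Lemma climit_minus (f g : R -> C) (l m : C) :
  climit f l -> climit g m -> climit (fun s => f s - g s)%C (l - m)%C.
Proof.
intros [H1 H2] [H3 H4]; split; apply filterlim_Rplus; auto; now apply filterlim_Ropp.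
Qed.

Lemma climit_mult (f g : R -> C) (l m : C) :
  climit f l -> climit g m -> climit (fun s => f s * g s)%C (l * m)%C.
Proof.
intros [H1 H2] [H3 H4]; split.
- apply filterlim_Rplus; [|apply filterlim_Ropp]; now apply filterlim_Rmult.
- apply filterlim_Rplus; now apply filterlim_Rmult.
Qed.

Lemma climit_cexp (f : R -> C) (l : C) :
  climit f l -> climit (fun s => cexp (f s)) (cexp l).
Proof.
intros [H1 H2].
assert (He : filterlim (fun s => exp (Re (f s))) (at_right 0) (locally (exp (Re l)))).
{ eapply filterlim_comp; [exact H1|].
  apply: (ex_derive_continuous exp). now auto_derive. }
split; apply filterlim_Rmult; try exact He.
- eapply filterlim_comp; [exact H2|].
  apply: (ex_derive_continuous cos). now auto_derive.
- eapply filterlim_comp; [exact H2|].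
  apply: (ex_derive_continuous sin). now auto_derive.
Qed.

Lemma climit_Cmod (f : R -> C) (l : C) :
  climit f l -> filterlim (fun s => Cmod (f s)) (at_right 0) (locally (Cmod l)).
Proof.
intros [H1 H2].
assert (E : forall z, sqrt (Re z * Re z + Im z * Im z) = Cmod z).
{ intros z. unfold Cmod, Re, Im. f_equal. ring. }
rewrite -E. apply (filterlim_ext (fun s => sqrt (Re (f s) * Re (f s) + Im (f s) * Im (f s)))).
{ intros s. apply E. }
eapply filterlim_comp; [|apply: continuous_sqrt].
apply filterlim_Rplus; now apply filterlim_Rmult.
Qed.

Lemma limit_le (f g : R -> R) (l m : R) :
  (at_right 0) (fun s => f s <= g s) -> filterlim f (at_right 0) (locally l) ->
  filterlim g (at_right 0) (locally m) -> l <= m.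
Proof. intros H Hf Hg. exact (filterlim_le f g l m H Hf Hg). Qed.

Lemma climit_unique (f : R -> C) (l m : C) : climit f l -> climit f m -> l = m.
Proof.
intros [H1 H2] [H3 H4]. apply Cext.
- exact (filterlim_locally_unique _ _ _ H1 H3).
- exact (filterlim_locally_unique _ _ _ H2 H4).
Qed.

Lemma climit_ext (f g : R -> C) (l : C) :
  (at_right 0) (fun s => f s = g s) -> climit f l -> climit g l.
Proof.
intros E [H1 H2]; split; eapply filterlim_ext_loc; try eassumption;
  revert E; apply filter_imp; intros s ->; reflexivity.
Qed.

Lemma climit_exists (f : R -> C) :
  (forall eps : posreal, exists P, (at_right 0) P /\
    forall x y, P x -> P y -> Cmod (f x - f y) < eps) ->
  exists l, climit f l.
Proof.
intros H.
assert (Hc : forall p : C -> R, (forall z w, p (z - w)%C = p z - p w) ->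
  (forall z, Rabs (p z) <= Cmod z) ->
  exists l : R, filterlim (fun s => p (f s)) (at_right 0) (locally l)).
{ intros p Hp1 Hp2.
  apply (proj1 (filterlim_locally_cauchy (U := R_CompleteSpace) (fun s => p (f s)))).
  intros eps. destruct (H eps) as [P [HP HP']]. exists P. split; [exact HP|].
  intros x y Hx Hy. change (Rabs (p (f y) - p (f x)) < eps).
  rewrite -Hp1. apply Rle_lt_trans with (1 := Hp2 _). auto. }
destruct (Hc Re) as [l Hl]; [reflexivity|apply Re_Cmod|].
destruct (Hc Im) as [m Hm]; [reflexivity|apply Im_Cmod|].
now exists (l, m).
Qed.


Lemma at_right_le (d : R) : 0 < d -> at_right 0 (fun y => 0 < y <= d).
Proof.
intros Hd. exists (mkposreal d Hd). intros y Hy H0.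
change (Rabs (y - 0) < d) in Hy. apply Rabs_lt_between in Hy. lra.
Qed.

Lemma at_right_continuous (f : R -> R) :
  continuous f 0 -> filterlim f (at_right 0) (locally (f 0)).
Proof. intros H. eapply filterlim_filter_le_1; [apply filter_le_within|exact H]. Qed.

Lemma continuous_bounded (f : R -> R) (a b : R) :
  a <= b -> (forall s, a <= s <= b -> continuous f s) ->
  exists M, forall s, a <= s <= b -> Rabs (f s) <= M.
Proof.
intros Hab Hf.
destruct (continuity_ab_maj (fun s => Rabs (f s)) a b Hab) as [m [Hm _]].
- intros s Hs. apply continuity_pt_filterlim.
  apply (continuous_comp f Rabs); [now apply Hf|]. apply continuous_Rabs.
- now exists (Rabs (f m)).
Qed.

Lemma climit_imaginary : climit (fun y => (0, y)) 0.
Proof.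
split; [exact (filterlim_const (0 : R))|].
exact (at_right_continuous _ (continuous_id 0)).
Qed.

Lemma in_time_le {T : Rbar} (t t0 : R) : in_time T t0 -> 0 <= t <= t0 -> in_time T t.
Proof.
intros [_ H] Ht. split; [lra|]. apply (Rbar_le_lt_trans t t0); [apply Ht|exact H].
Qed.

Section Tip.

Variables (T : Rbar) (rho : R) (w b : R -> R) (V : R -> R -> R -> C) (gamma : R -> C).
Hypothesis Hwb : forall s, w s = rho / 4 * b s.
Hypothesis Hbc : forall s : R, Rbar_lt s T -> continuous b s.
Hypothesis HV : forall t y, in_time T t -> 0 < y -> backward w t y (V t y).
Hypothesis Hgamma : forall t, in_time T t ->
  climit (fun y => V t y 0) (gamma t).

Let regularized_exponent t y := cint (fun s => b s / V t y s)%C 0 t.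

Lemma driver_cont (s : R) : Rbar_lt s T -> continuous w s.
Proof.
intros Hs. apply (continuous_ext (fun s => rho / 4 * b s)); [easy|].
apply: continuous_mult; [apply: continuous_const|now apply Hbc].
Qed.

Lemma drivers_bounded t0 : in_time T t0 ->
  exists M, 0 < M /\ forall s, 0 <= s <= t0 -> Rabs (w s) <= M /\ Rabs (b s) <= M.
Proof.
intros Ht.
destruct (continuous_bounded w 0 t0 (proj1 Ht)) as [M1 H1].
{ intros s Hs. apply driver_cont. now apply (in_time_le s t0). }
destruct (continuous_bounded b 0 t0 (proj1 Ht)) as [M2 H2].
{ intros s Hs. apply Hbc. now apply (in_time_le s t0). }
exists (Rabs M1 + Rabs M2 + 1).
generalize (Rabs_pos M1) (Rabs_pos M2) (Rle_abs M1) (Rle_abs M2) => P1 P2 L1 L2.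
split; [lra|]. intros s Hs. specialize (H1 s Hs). specialize (H2 s Hs). lra.
Qed.

Lemma continuous_rate (K d : R) (p : R -> R) :
  (forall y, continuous p y) -> continuous (fun y => K * root4 (p y)) d.
Proof.
intros Hp. apply: continuous_mult; [apply: continuous_const|].
apply (continuous_comp p root4); [apply Hp|apply root4_continuous].
Qed.

Lemma regularized_exponent_limit t : in_time T t -> exists l, climit (regularized_exponent t) l.
Proof.
intros Ht. destruct (drivers_bounded t Ht) as [M [HM HMb]].
destruct (kernel_integral_modulus T w b M t) as [K HK]; auto.
{ apply Ht. } { apply Ht. } { apply driver_cont. }
{ intros s Hs; now apply HMb. } { intros s Hs; now apply HMb. }
apply climit_exists. intros eps.
set (p := fun d => Rabs K * root4 (d * d + d * d)).
assert (Hp : filterlim p (at_right 0) (locally (p 0))).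
{ apply at_right_continuous. apply continuous_rate. intros y.
  apply: ex_derive_continuous. now auto_derive. }
assert (H0 : p 0 = 0).
{ unfold p. rewrite Rmult_0_r Rplus_0_r /root4 !sqrt_0. ring. }
rewrite H0 in Hp.
assert (Hs : at_right 0 (fun d => (0 < d <= 1) /\ p d < eps)).
{ apply filter_and; [apply at_right_le; lra|].
  apply (Hp (fun x => x < eps)). exists eps. intros y Hy.
  change (Rabs (y - 0) < eps) in Hy. apply Rabs_lt_between in Hy. lra. }
destruct (filter_ex _ Hs) as [d [Hd Hpd]].
exists (fun y => 0 < y <= d). split; [apply at_right_le; lra|].
intros x y Hx Hy. apply Rle_lt_trans with (2 := Hpd).
apply Rle_trans with (1 := HK t t x y (V t x) (V t y)
  (proj1 Ht) (Rle_refl t) (Rle_refl t) ltac:(lra) ltac:(lra)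
  (HV t x Ht ltac:(lra)) (HV t y Ht ltac:(lra))).
apply Rle_trans with (Rabs K * root4 (t - t + x * x + y * y)).
- apply Rmult_le_compat_r; [apply root4_ge_0|apply Rle_abs].
- unfold p. apply Rmult_le_compat_l; [apply Rabs_pos|]. apply root4_le. nra.
Qed.

Definition tip_exponent (t : R) : C :=
  epsilon (inhabits (RtoC 0)) (fun l => climit (regularized_exponent t) l).

Let N := tip_exponent.

Lemma tip_exponent_limit t : in_time T t -> climit (regularized_exponent t) (N t).
Proof.
intros Ht. unfold N, tip_exponent.
apply (epsilon_spec (inhabits (RtoC 0)) (fun l => climit (regularized_exponent t) l)).
now apply regularized_exponent_limit.
Qed.

Lemma tip_exponent_0 : in_time T 0 -> N 0 = 0.
Proof.
intros Ht. apply (climit_unique (regularized_exponent 0)); [now apply tip_exponent_limit|].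
apply (climit_ext (fun _ => RtoC 0)); [|apply climit_const].
apply filter_forall. intros y. unfold regularized_exponent. now rewrite cint_point.
Qed.

Lemma rate_limit (K d : R) :
  filterlim (fun y => K * root4 (d + y * y + y * y)) (at_right 0) (locally (K * root4 d)).
Proof.
replace (K * root4 d) with (K * root4 (d + 0 * 0 + 0 * 0))
  by (f_equal; f_equal; ring).
apply (at_right_continuous (fun y => K * root4 (d + y * y + y * y))).
apply (continuous_rate K 0 (fun y => d + y * y + y * y)). intros y.
apply: ex_derive_continuous. now auto_derive.
Qed.

Lemma tip_exponent_modulus t0 : in_time T t0 ->
  exists K, forall t1 t2, 0 <= t1 -> t1 <= t2 -> t2 <= t0 ->
    Cmod (N t1 - N t2) <= K * root4 (t2 - t1).
Proof.
intros Ht. destruct (drivers_bounded t0 Ht) as [M [HM HMb]].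
destruct (kernel_integral_modulus T w b M t0) as [K HK]; auto.
{ apply Ht. } { apply Ht. } { apply driver_cont. }
{ intros s Hs; now apply HMb. } { intros s Hs; now apply HMb. }
exists K. intros t1 t2 Ht1 Ht12 Ht2.
assert (I1 : in_time T t1) by (apply (in_time_le t1 t0); auto; lra).
assert (I2 : in_time T t2) by (apply (in_time_le t2 t0); auto; lra).
refine (limit_le _ _ _ _ _
  (climit_Cmod _ _ (climit_minus _ _ _ _ (tip_exponent_limit t1 I1)
    (tip_exponent_limit t2 I2))) (rate_limit K (t2 - t1))).
generalize (at_right_le 1 ltac:(lra)). apply filter_imp. intros y Hy.
apply HK; auto; apply HV; auto; lra.
Qed.

Lemma tip_square_increment t0 : in_time T t0 ->
  exists K, forall t1 t2, 0 <= t1 -> t1 <= t2 -> t2 <= t0 ->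
    Cmod (gamma t2 * gamma t2 - gamma t1 * gamma t1 +
      4 * (t2 - t1)%R * cexp (rho / 4 * N t1))%C <= K * (t2 - t1) * root4 (t2 - t1).
Proof.
intros Ht. destruct (drivers_bounded t0 Ht) as [M [HM HMb]].
destruct (square_increment_modulus T w M t0) as [K HK]; auto.
{ apply Ht. } { apply Ht. } { apply driver_cont. } { intros s Hs; now apply HMb. }
exists K. intros t1 t2 Ht1 Ht12 Ht2.
assert (I1 : in_time T t1) by (apply (in_time_le t1 t0); auto; lra).
assert (I2 : in_time T t2) by (apply (in_time_le t2 t0); auto; lra).
assert (L : climit (fun y => V t2 y 0 * V t2 y 0 - V t1 y 0 * V t1 y 0 +
  4 * (t2 - t1)%R * cexp (rho / 4 * regularized_exponent t1 y))%C
  (gamma t2 * gamma t2 - gamma t1 * gamma t1 +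
      4 * (t2 - t1)%R * cexp (rho / 4 * N t1))%C).
{ apply climit_plus; [|].
  - apply climit_minus; apply climit_mult; auto.
  - apply climit_mult; [apply climit_const|].
    apply climit_cexp. apply climit_mult; [apply climit_const|].
    now apply tip_exponent_limit. }
refine (limit_le _ _ _ _ _ (climit_Cmod _ _ L) (rate_limit (K * (t2 - t1)) (t2 - t1))).
generalize (at_right_le 1 ltac:(lra)). apply filter_imp. intros y Hy.
assert (V1 := HV t1 y I1 ltac:(lra)). assert (V2 := HV t2 y I2 ltac:(lra)).
assert (H := HK t1 t2 y _ _ Ht1 Ht12 Ht2 Hy V1 V2).
replace (rho / 4 * regularized_exponent t1 y)%C with (cint (fun s => w s / V t1 y s)%C 0 t1); [exact H|].
assert (Hn : forall s, V t1 y s <> 0) by (intros s; now apply (backward_neq0 w t1 y)).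
assert (HcK : forall s : R, Rbar_lt s T -> ccont (fun s => b s / V t1 y s)%C s).
{ intros s Hs. apply ccont_div; [apply ccont_R; auto|apply V1|apply Hn]. }
assert (Hex : forall p : C -> R, (forall s : R, Rbar_lt s T ->
    continuous (fun s => p (b s / V t1 y s)%C) s) ->
    ex_RInt (fun s => p (b s / V t1 y s)%C) 0 t1).
{ intros p Hp. apply: ex_RInt_continuous. rewrite -> Rmin_left, Rmax_right by lra.
  intros s Hs. apply Hp. apply I1 || apply (in_time_le s t1); auto. }
assert (E : forall s, (w s / V t1 y s)%C = (RtoC (rho / 4) * (b s / V t1 y s))%C).
{ intros s. rewrite Hwb RtoC_mult. field. apply Hn. }
replace (rho / 4)%C with (RtoC (rho / 4)) by (rewrite RtoC_div; auto; lra).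
apply injective_projections.
- transitivity (RInt (fun s => scal (rho / 4) (Re (b s / V t1 y s)%C)) 0 t1).
  + apply RInt_ext. intros s _. rewrite E. unfold Re, scal; cbn. unfold mult; cbn. ring.
  + rewrite RInt_scal; [|apply Hex; intros s Hs; now apply HcK].
    unfold scal; cbn. unfold mult; cbn. unfold Re, regularized_exponent, cint. ring.
- transitivity (RInt (fun s => scal (rho / 4) (Im (b s / V t1 y s)%C)) 0 t1).
  + apply RInt_ext. intros s _. rewrite E. unfold Im, scal; cbn. unfold mult; cbn. ring.
  + rewrite RInt_scal; [|apply Hex; intros s Hs; now apply HcK].
    unfold scal; cbn. unfold mult; cbn. unfold Im, regularized_exponent, cint. ring.
Qed.

Lemma tip_start : in_time T 0 -> gamma 0 = 0.
Proof.
intros Ht. apply (climit_unique (fun y => V 0 y 0)); [now apply Hgamma|].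
apply (climit_ext (fun y => (0, y))); [|exact climit_imaginary].
generalize (at_right_le 1 ltac:(lra)). apply filter_imp. intros y Hy.
symmetry. apply (backward_end w 0 y). apply HV; auto; lra.
Qed.

Lemma tip_Im_lower t0 : in_time T t0 ->
  exists c, 0 < c /\ forall t, 0 <= t <= t0 ->
    0 <= Im (gamma t) /\ c * t <= Im (gamma t) * Im (gamma t).
Proof.
intros Ht. destruct (drivers_bounded t0 Ht) as [M [HM HMb]].
exists (2 / (1 + M * M * t0)).
assert (H0 : 0 <= t0) by apply Ht.
split; [apply Rdiv_lt_0_compat; nra|].
intros t Ht'. assert (It : in_time T t) by now apply (in_time_le t t0).
destruct (Hgamma t It) as [_ G2].
assert (HMw : forall s, 0 <= s <= t -> Rabs (w s) <= M).
{ intros s Hs. apply HMb. lra. }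
split.
- refine (limit_le (fun _ => 0) _ _ _ _ (filterlim_const _) G2).
  generalize (at_right_le 1 ltac:(lra)). apply filter_imp. intros y Hy.
  apply Rlt_le. apply (HV t y It). lra.
- refine (limit_le (fun _ => _ ) _ _ _ _ (filterlim_const _)
    (filterlim_Rmult _ _ _ _ G2 G2)).
  generalize (at_right_le 1 ltac:(lra)). apply filter_imp. intros y Hy.
  rewrite -{1}(Rminus_0_r t).
  apply (backward_Im_lower w M t y (V t y)); auto; try lra. apply HV; auto; lra.
Qed.

(* (v - zeta) (v - conj zeta) is driven by the single real kernel b, since
   zeta = z - W and its conjugate solve the same equation as v. *)
Lemma tip_force_point (zeta : R -> C) t :
  in_time T t ->
  (forall s, 0 <= s <= t -> ccont zeta s) ->
  (forall s, 0 <= s <= t -> zeta s <> 0) ->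
  (forall s, 0 < s < t -> cderive zeta s (2 / zeta s - w s)%C) ->
  (forall s, 0 <= s <= t -> RtoC (b s) = (- (2 / zeta s) - 2 / Cconj (zeta s))%C) ->
  (zeta t * Cconj (zeta t))%C =
  ((gamma t - zeta 0) * (gamma t - Cconj (zeta 0)) * cexp (N t))%C.
Proof.
intros Ht Hc Hn Hd Hb.
assert (Hn' : forall s, 0 <= s <= t -> Cconj (zeta s) <> 0).
{ intros s Hs E. apply (Hn s Hs). apply Cmod_eq_0. rewrite -Cmod_conj E. apply Cmod_0. }
assert (L1 : climit (fun y => (V t y 0 - zeta 0) * (V t y 0 - Cconj (zeta 0))
   * cexp (regularized_exponent t y))%C ((gamma t - zeta 0) * (gamma t - Cconj (zeta 0)) * cexp (N t))%C).
{ apply climit_mult; [|apply climit_cexp; now apply tip_exponent_limit].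
  apply climit_mult; (apply climit_minus; [auto|apply climit_const]). }
apply (climit_unique (fun y => ((0, y) - zeta t) * ((0, y) - Cconj (zeta t)))%C).
- replace (zeta t * Cconj (zeta t))%C with ((0 - zeta t) * (0 - Cconj (zeta t)))%C by ring.
  assert (Hy := climit_imaginary).
  apply climit_mult; (apply climit_minus; [auto|apply climit_const]).
- refine (climit_ext _ _ _ _ L1).
  generalize (at_right_le 1 ltac:(lra)). apply filter_imp. intros y Hy.
  assert (Hv := HV t y Ht ltac:(lra)).
  assert (Hvn : forall s, V t y s <> 0) by (intros s; now apply (backward_neq0 w t y)).
  symmetry. rewrite -(backward_end _ _ _ _ Hv).
  apply (integrating_factor T (fun s => (V t y s - zeta s) * (V t y s - Cconj (zeta s)))%C).
  + apply Ht.
  + apply Ht.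
  + intros s Hs. apply ccont_div; [apply ccont_R; auto|apply Hv|apply Hvn].
  + intros s Hs. specialize (Hc s Hs).
    apply ccont_mult; apply ccont_minus; try apply Hv; auto. now apply ccont_conj.
  + intros s Hs. assert (D1 := backward_ode _ _ _ _ Hv s Hs). specialize (Hd s Hs).
    eapply cderive_eq.
    * apply cderive_mult; apply cderive_minus; try eassumption.
      apply cderive_conj. eassumption.
    * rewrite Hb; [|lra].
      replace (Cconj (2 / zeta s - w s)) with (2 / Cconj (zeta s) - w s)%C.
      -- field. split; [|split]; auto; [apply Hn'|apply Hn]; lra.
      -- rewrite Cminus_conj Cdiv_conj; [|apply Hn; lra].
         f_equal; [f_equal|]; apply Cext; cbn; ring.
Qed.

End Tip.

(** * Loewner trajectories *)

Definition has_slope (D : R -> Prop) (f : R -> R) (t l : R) : Prop :=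
  forall eps, 0 < eps -> exists d, 0 < d /\
    forall r, D r -> Rabs (r - t) < d -> Rabs (f r - f t - (r - t) * l) <= eps * Rabs (r - t).

Lemma deriv_on_eps {V : NormedModule R_AbsRing} (D : R -> Prop) (u : R -> V) (t : R) (l : V) :
  deriv_on D u t l -> forall eps, 0 < eps -> exists d, 0 < d /\
    forall r, D r -> Rabs (r - t) < d ->
      norm (minus (minus (u r) (u t)) (scal (r - t) l)) <= eps * Rabs (r - t).
Proof.
intros [_ H] eps Heps.
assert (Hl : is_filter_lim (within D (locally t)) t).
{ intros P HP. now apply filter_le_within. }
destruct (H t Hl (mkposreal eps Heps)) as [d Hd].
exists d. split; [apply d|]. intros r Dr Hr. now apply Hd.
Qed.

Lemma deriv_on_slope (D : R -> Prop) (f : R -> R) (t l : R) :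
  deriv_on (V := R_NormedModule) D f t l -> has_slope D f t l.
Proof.
intros H eps Heps. destruct (deriv_on_eps _ _ _ _ H eps Heps) as [d [Hd Hd']].
exists d. split; [exact Hd|]. intros r Dr Hr. exact (Hd' r Dr Hr).
Qed.

Lemma deriv_on_C_eps (D : R -> Prop) (u : R -> C) (t : R) (l : C) :
  deriv_on (V := C_R_NormedModule) D u t l -> forall eps, 0 < eps -> exists d, 0 < d /\
    forall r, D r -> Rabs (r - t) < d ->
      Cmod (u r - u t - (r - t)%R * l)%C <= eps * Rabs (r - t).
Proof.
intros H eps Heps. destruct (deriv_on_eps _ _ _ _ H eps Heps) as [d [Hd Hd']].
exists d. split; [exact Hd|]. intros r Dr Hr. specialize (Hd' r Dr Hr).
rewrite Cmod_norm. apply Rle_trans with (2 := Hd'). right. apply (f_equal norm).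
apply injective_projections; unfold minus, plus, opp, scal; cbn;
  unfold mult, opp, plus; cbn; ring.
Qed.

Lemma deriv_on_C_slope (D : R -> Prop) (u : R -> C) (t : R) (l : C) :
  deriv_on (V := C_R_NormedModule) D u t l ->
  has_slope D (fun s => Re (u s)) t (Re l) /\ has_slope D (fun s => Im (u s)) t (Im l).
Proof.
intros H. split; intros eps Heps;
  destruct (deriv_on_C_eps _ _ _ _ H eps Heps) as [d [Hd Hd']];
  exists d; (split; [exact Hd|]); intros r Dr Hr; apply Rle_trans with (2 := Hd' r Dr Hr).
- apply Rle_trans with (2 := Re_Cmod _). right. f_equal. cbn. unfold Re. ring.
- apply Rle_trans with (2 := Im_Cmod _). right. f_equal. cbn. unfold Im. ring.
Qed.

Lemma has_slope_is_derive (D : R -> Prop) (f : R -> R) (t l : R) :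
  locally t D -> has_slope D f t l -> is_derive f t l.
Proof.
intros [e He] H. split; [apply is_linear_scal_l|].
intros x Hx. rewrite -(is_filter_lim_locally_unique _ _ Hx).
intros eps. destruct (H eps (cond_pos eps)) as [d [Hd Hd']].
assert (Hm : 0 < Rmin d e) by (apply Rmin_pos; [exact Hd|apply cond_pos]).
exists (mkposreal _ Hm). intros r Hr.
change (Rabs (r - t) < Rmin d e) in Hr.
apply (Hd' r).
- apply He. change (Rabs (r - t) < e). apply Rlt_le_trans with (1 := Hr), Rmin_r.
- apply Rlt_le_trans with (1 := Hr), Rmin_l.
Qed.

Lemma has_slope_continuous (D : R -> Prop) (f p : R -> R) (s l : R) :
  has_slope D f (p s) l -> continuous p s -> locally s (fun r => D (p r)) ->
  continuous (fun r => f (p r)) s.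
Proof.
intros H Hp HD. apply filterlim_locally. intros eps.
destruct (H 1 Rlt_0_1) as [d [Hd Hd']].
set (K := 1 + Rabs l). assert (HK : 0 < K) by (generalize (Rabs_pos l); unfold K; lra).
assert (He : 0 < Rmin d (eps / K)).
{ apply Rmin_pos; auto. apply Rdiv_lt_0_compat; auto. apply cond_pos. }
generalize (proj1 (filterlim_locally p (p s)) Hp (mkposreal _ He)) => Hp'.
generalize (filter_and _ _ HD Hp'). apply filter_imp. intros r [Dr Hr].
change (Rabs (p r - p s) < Rmin d (eps / K)) in Hr.
change (Rabs (f (p r) - f (p s)) < eps).
specialize (Hd' (p r) Dr ltac:(apply Rlt_le_trans with (1 := Hr), Rmin_l)).
assert (Hr2 : Rabs (p r - p s) < eps / K) by (apply Rlt_le_trans with (1 := Hr), Rmin_r).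
assert (H3 : K * Rabs (p r - p s) < eps).
{ apply (Rmult_lt_compat_l K) in Hr2; auto.
  replace (K * (eps / K)) with (pos eps) in Hr2 by (field; lra). exact Hr2. }
replace (f (p r) - f (p s)) with
  ((f (p r) - f (p s) - (p r - p s) * l) + (p r - p s) * l) by ring.
apply Rle_lt_trans with (1 := Rabs_triang _ _). rewrite Rabs_mult. unfold K in H3. lra.
Qed.

Lemma continuous_Rmax_0 (s : R) : continuous (Rmax 0) s.
Proof.
apply filterlim_locally. intros eps. exists eps. intros r Hr.
change (Rabs (r - s) < eps) in Hr. change (Rabs (Rmax 0 r - Rmax 0 s) < eps).
apply Rabs_def2 in Hr. unfold Rmax.
destruct (Rle_dec 0 r), (Rle_dec 0 s); apply Rabs_def1; lra.
Qed.

Definition clamp (t s : R) : R := Rmax 0 (Rmin s t).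

Lemma continuous_clamp (t s : R) : continuous (clamp t) s.
Proof.
apply (continuous_comp (fun s => Rmin s t) (Rmax 0)); [|apply continuous_Rmax_0].
apply filterlim_locally. intros eps. exists eps. intros r Hr.
change (Rabs (r - s) < eps) in Hr. change (Rabs (Rmin r t - Rmin s t) < eps).
apply Rabs_def2 in Hr. unfold Rmin.
destruct (Rle_dec r t), (Rle_dec s t); apply Rabs_def1; lra.
Qed.

Lemma clamp_in (t s : R) : 0 <= t -> 0 <= clamp t s <= t.
Proof.
intros Ht. unfold clamp, Rmax, Rmin.
destruct (Rle_dec s t); [destruct (Rle_dec 0 s)|destruct (Rle_dec 0 t)]; lra.
Qed.

Lemma clamp_id (t s : R) : 0 <= s <= t -> clamp t s = s.
Proof. intros Hs. unfold clamp. rewrite Rmin_left ?Rmax_right; lra. Qed.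

Lemma locally_Ioo (a b s : R) : a < s < b -> locally s (fun r => a < r < b).
Proof.
intros Hs. apply (locally_interval _ s a b); cbn; auto; lra.
Qed.

Lemma cderive_ext_loc (f g : R -> C) (s : R) (l : C) :
  locally s (fun r => f r = g r) -> cderive f s l -> cderive g s l.
Proof.
intros E [H1 H2]; split; eapply is_derive_ext_loc; try eassumption;
  revert E; apply filter_imp; intros r ->; reflexivity.
Qed.

Lemma ccont_ext_loc (f g : R -> C) (s : R) :
  locally s (fun r => f r = g r) -> ccont f s -> ccont g s.
Proof.
intros E [H1 H2].
split; [refine (continuous_ext_loc _ _ s _ H1)|refine (continuous_ext_loc _ _ s _ H2)];
  revert E; apply filter_imp; intros r ->; reflexivity.
Qed.

(* The Loewner equation on [0, t], without one-sided derivatives at 0 and t. *)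
Record trajectory (W : R -> R) (t : R) (u : R -> C) : Prop := {
  trajectory_neq : forall s, 0 <= s <= t -> u s <> RtoC (W s);
  trajectory_cont : forall s, ccont (fun r => u (clamp t r)) s;
  trajectory_ode : forall s, 0 < s < t -> cderive u s (2 / (u s - W s))%C
}.

Lemma loewner_map_trajectory (W : R -> R) (t : R) (x y : C) :
  0 <= t -> loewner_map W t x y -> exists u, u 0 = x /\ u t = y /\ trajectory W t u.
Proof.
intros Ht [u [H0 [H1 H]]]. exists u. split; [exact H0|]. split; [exact H1|].
split.
- intros s Hs. now apply H.
- intros s. assert (Hc := clamp_in t s Ht). destruct (H _ Hc) as [_ Hd].
  apply deriv_on_C_slope in Hd. destruct Hd as [D1 D2].
  assert (HD : locally s (fun r => 0 <= clamp t r <= t)).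
  { apply filter_forall. intros r. now apply clamp_in. }
  split.
  + exact (has_slope_continuous _ _ (clamp t) s _ D1 (continuous_clamp t s) HD).
  + exact (has_slope_continuous _ _ (clamp t) s _ D2 (continuous_clamp t s) HD).
- intros s Hs. destruct (H s ltac:(lra)) as [_ Hd].
  apply deriv_on_C_slope in Hd. destruct Hd as [D1 D2].
  assert (HD : locally s (fun r => 0 <= r <= t)).
  { generalize (locally_Ioo 0 t s Hs). apply filter_imp. intros r Hr. lra. }
  split; eapply has_slope_is_derive; eassumption.
Qed.

Lemma trajectory_restrict (W : R -> R) (t s : R) (u : R -> C) :
  0 <= s <= t -> trajectory W t u -> trajectory W s u.
Proof.
intros Hs [H1 H2 H3]. split.
- intros r Hr. apply H1. lra.
- intros r. apply (ccont_ext (fun x => u (clamp t (clamp s x)))).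
  { intros x. f_equal. apply clamp_id. generalize (clamp_in s x ltac:(lra)). lra. }
  destruct (H2 (clamp s r)) as [C1 C2].
  split; [apply (continuous_comp (clamp s) (fun x => Re (u (clamp t x))))
         |apply (continuous_comp (clamp s) (fun x => Im (u (clamp t x))))];
    auto using continuous_clamp.
- intros r Hr. apply H3. lra.
Qed.

Lemma locally_clamp (t s : R) : 0 < s < t -> locally s (fun r => clamp t r = r).
Proof.
intros Hs. generalize (locally_Ioo 0 t s Hs). apply filter_imp.
intros r Hr. apply clamp_id. lra.
Qed.

Lemma trajectory_unique (W : R -> R) (t : R) (u1 u2 : R -> C) :
  0 <= t -> (forall s, continuous (fun r => W (clamp t r)) s) ->
  trajectory W t u1 -> trajectory W t u2 -> u1 0 = u2 0 -> u1 t = u2 t.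
Proof.
intros Ht HW [N1 C1 D1] [N2 C2 D2] H0.
set (k := fun s =>
  (- (2 / ((u1 (clamp t s) - W (clamp t s)) * (u2 (clamp t s) - W (clamp t s)))))%C).
assert (Hn : forall u, (forall s, 0 <= s <= t -> u s <> RtoC (W s)) ->
  forall s, (u (clamp t s) - W (clamp t s))%C <> 0).
{ intros u Hu s E. apply (Hu _ (clamp_in t s Ht)).
  replace (u (clamp t s)) with ((u (clamp t s) - W (clamp t s)) + W (clamp t s))%C by ring.
  rewrite E. ring. }
assert (E : (u1 (clamp t t) - u2 (clamp t t))%C =
  ((u1 (clamp t 0) - u2 (clamp t 0)) * cexp (cint k 0 t))%C).
{ apply (integrating_factor p_infty (fun s => u1 (clamp t s) - u2 (clamp t s))%C).
  - exact Ht.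
  - easy.
  - intros s _. apply (ccont_ext (fun s =>
      (0 - 2 / ((u1 (clamp t s) - W (clamp t s)) * (u2 (clamp t s) - W (clamp t s))))%C)).
    { intros x. unfold k. ring. }
    apply ccont_minus; [apply ccont_const|]. apply ccont_div; [apply ccont_const| |].
    + apply ccont_mult; apply ccont_minus; auto; now apply ccont_R.
    + apply Cmult_neq_0; now apply Hn.
  - intros s _. now apply ccont_minus.
  - intros s Hs. apply (cderive_ext_loc (fun s => u1 s - u2 s)%C).
    { generalize (locally_clamp t s Hs). apply filter_imp. now intros r ->. }
    eapply cderive_eq; [apply cderive_minus; [apply D1|apply D2]; lra|].
    unfold k. assert (X1 := Hn u1 N1 s). assert (X2 := Hn u2 N2 s).
    rewrite (clamp_id t s ltac:(lra)) in X1 X2 |- *. field. auto. }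
rewrite !clamp_id in E; try lra. rewrite H0 in E.
replace (u1 t) with (u2 t + (u1 t - u2 t))%C by ring. rewrite E. ring.
Qed.

(** * From the driving function to the tip *)

Lemma trajectory_Im_pos (W : R -> R) (t : R) (u : R -> C) :
  0 <= t -> (forall s, continuous (fun r => W (clamp t r)) s) ->
  trajectory W t u -> 0 < Im (u 0) -> forall s, 0 <= s <= t -> 0 < Im (u s).
Proof.
intros Ht HW [N C D] H0.
set (v := fun s => (u (clamp t s) - W (clamp t s))%C).
assert (Hn : forall s, v s <> 0).
{ intros s E. apply (N _ (clamp_in t s Ht)).
  replace (u (clamp t s)) with (v s + W (clamp t s))%C by (unfold v; ring).
  rewrite E. ring. }
assert (Hvc : forall s, ccont v s).
{ intros s. apply ccont_minus; auto. now apply ccont_R. }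
destruct (continuity_ab_min (fun s => Cmod (v s)) 0 t Ht) as [x [Hx _]].
{ intros s _. apply continuity_pt_filterlim. now apply continuous_Cmod. }
set (m := Cmod (v x)) in *.
assert (Hm : 0 < m) by apply Cmod_gt_0, Hn.
set (k := 4 / (m * m)).
set (bt := fun s => Im (u (clamp t s))).
assert (Hbc : forall s, continuous bt s) by apply C.
assert (Hk : 0 < k) by (apply Rdiv_lt_0_compat; nra).
(* Im u cannot reach 0: (Im u)^2 e^(ks) is nondecreasing when k >= 4 / |u - W|^2. *)
assert (Hsq : forall s, 0 <= s <= t -> bt 0 * bt 0 * exp (k * 0) <= bt s * bt s * exp (k * s)).
{ intros s Hs.
  apply (derive_ge_0_monotone (fun s => bt s * bt s * exp (k * s))
    (fun s => exp (k * s) * (bt s * bt s) * (k - 4 / (Cmod (v s) * Cmod (v s))))).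
  - apply Hs.
  - intros r Hr. assert (Hr' : 0 < r < t) by lra.
    assert (Db : is_derive bt r (- (2 * bt r / (Cmod (v r) * Cmod (v r))))).
    { destruct (D r Hr') as [_ D2].
      apply (is_derive_ext_loc (fun s => Im (u s))).
      { generalize (locally_clamp t r Hr'). apply filter_imp.
        intros y Hy. unfold bt. now rewrite Hy. }
      apply (is_derive_eq _ _ _ _ D2).
      change (Im (2 / (u r - W r))%C) with
        (2 * Im (/ (u r - W r))%C + 0 * Re (/ (u r - W r))%C).
      rewrite Cinv_Im Cmod_sqr. unfold bt, v. rewrite clamp_id; [|lra].
      replace (Im (u r - W r)%C) with (Im (u r)) by (unfold Im; cbn; ring).
      field. assert (X := Csqr_neq0 _ (Hn r)). unfold v in X.
      rewrite clamp_id in X; [|lra].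
      replace (Im (u r - W r)%C) with (Im (u r)) in X by (unfold Im; cbn; ring). lra. }
    auto_derive; [repeat split; auto; eexists; exact Db|].
    rewrite ?(is_derive_unique (fun x => bt x) _ _ Db).
    field. apply Rgt_not_eq. apply Cmod_gt_0, Hn.
  - intros r Hr. apply: continuous_mult; [apply: continuous_mult; auto|].
    apply: ex_derive_continuous. now auto_derive.
  - intros r Hr. apply Rmult_le_pos.
    + apply Rmult_le_pos; [apply Rlt_le, exp_pos|nra].
    + assert (m <= Cmod (v r)) by (apply Hx; lra).
      assert (4 / (Cmod (v r) * Cmod (v r)) <= k); [|lra].
      unfold k. apply Rmult_le_compat_l; [lra|]. apply Rinv_le_contravar; nra. }
assert (E0 : bt 0 = Im (u 0)) by (unfold bt; now rewrite clamp_id; [|lra]).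
assert (Hb0 : forall s, 0 <= s <= t -> bt s <> 0).
{ intros s Hs E. specialize (Hsq s Hs). rewrite E E0 Rmult_0_r exp_0 in Hsq. nra. }
intros s Hs. replace (Im (u s)) with (bt s) by (unfold bt; now rewrite clamp_id).
destruct (Rlt_le_dec 0 (bt s)) as [H|H]; [exact H|exfalso].
destruct (Req_dec s 0) as [->|Hs0]; [lra|].
destruct (Ranalysis5.IVT_interv (fun s => - bt s) 0 s) as [r [Hr Hr0]].
- intros a _. apply continuity_pt_filterlim. apply: continuous_opp. apply Hbc.
- lra.
- lra.
- assert (bt s <> 0) by now apply Hb0. lra.
- apply (Hb0 r); lra.
Qed.

Lemma in_time_between {T : Rbar} (s : R) :
  Rbar_lt 0 T -> Rbar_lt s T -> exists t, in_time T t /\ s < t.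
Proof.
intros HT Hs. destruct T as [r| |]; cbn in *; try easy.
- exists ((Rmax 0 s + r) / 2).
  unfold in_time; cbn. unfold Rmax; destruct (Rle_dec 0 s); lra.
- exists (Rmax 0 s + 1). unfold in_time; cbn.
  unfold Rmax; destruct (Rle_dec 0 s); lra.
Qed.

Section SLETip.

Variables (rho : R) (z0 : C) (T : Rbar) (W : R -> R) (z gamma : R -> C).
Hypothesis Hsle : SLE0 rho z0 T W z gamma.

Lemma lifetime_pos : Rbar_lt 0 T.
Proof.
destruct (Rbar_lt_dec 0 T) as [H|H]; [exact H|exfalso].
assert (HT : Rbar_lt T p_infty).
{ apply Rbar_not_lt_le in H. now apply (Rbar_le_lt_trans T 0). }
destruct (SLE0_lifetime _ _ _ _ _ _ Hsle) as [_ Hl].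
destruct (filter_ex _ (Hl p_infty HT)) as [eps Heps].
enough (E : hitting_time T W z eps = p_infty) by now rewrite E in Heps.
apply is_glb_Rbar_unique. split.
- intros x [[Hx1 Hx2] _]. destruct H. now apply (Rbar_le_lt_trans 0 x).
- intros [r| |] Hr; cbn; auto.
Qed.

Lemma in_time_0 : in_time T 0.
Proof. split; [lra|apply lifetime_pos]. Qed.

Lemma driving_slope t : in_time T t -> has_slope (in_time T) W t (Re (rho / (W t - z t))%C).
Proof. intros Ht. apply deriv_on_slope, Hsle, Ht. Qed.

Lemma driving_cont (s : R) : Rbar_lt s T -> continuous (fun r => W (Rmax 0 r)) s.
Proof.
intros Hs.
assert (Hin : forall r : R, Rbar_lt r T -> in_time T (Rmax 0 r)).
{ intros r Hr. split; [apply Rmax_l|]. unfold Rmax; destruct (Rle_dec 0 r); auto.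
  apply lifetime_pos. }
apply (has_slope_continuous (in_time T) W (Rmax 0) s _ (driving_slope _ (Hin s Hs))).
- apply continuous_Rmax_0.
- generalize (open_Rbar_lt' s T Hs). apply filter_imp. exact Hin.
Qed.

Lemma driving_clamp_cont t s : in_time T t -> continuous (fun r => W (clamp t r)) s.
Proof.
intros Ht.
assert (Hin : forall r : R, in_time T (clamp t r)).
{ intros r. apply (in_time_le _ t); auto. apply clamp_in, Ht. }
apply (has_slope_continuous (in_time T) W (clamp t) s _ (driving_slope _ (Hin s))).
- apply continuous_clamp.
- now apply filter_forall.
Qed.

Lemma locally_in_time (s : R) : 0 < s -> Rbar_lt s T -> locally s (fun r => 0 < r /\ Rbar_lt r T).
Proof.
intros H0 Hs. apply filter_and.
- exact (open_Rbar_gt' s 0 H0).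
- exact (open_Rbar_lt' s T Hs).
Qed.

Lemma driving_derive s : 0 < s -> Rbar_lt s T -> is_derive W s (Re (rho / (W s - z s))%C).
Proof.
intros H0 Hs. apply (has_slope_is_derive (in_time T)).
- generalize (locally_in_time s H0 Hs). apply filter_imp.
  intros r [H1 H2]. split; [lra|exact H2].
- apply driving_slope. split; [lra|exact Hs].
Qed.

Lemma force_trajectory t : in_time T t ->
  exists u, trajectory W t u /\ forall s, 0 <= s <= t -> z s = u s.
Proof.
intros Ht.
destruct (loewner_map_trajectory W t _ _ (proj1 Ht) (SLE0_force _ _ _ _ _ _ Hsle t Ht))
  as [u [U0 [U1 U]]].
exists u. split; [exact U|]. intros s Hs.
assert (Is := in_time_le s t Ht Hs).
destruct (loewner_map_trajectory W s _ _ (proj1 Is) (SLE0_force _ _ _ _ _ _ Hsle s Is))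
  as [u' [U0' [U1' U']]].
rewrite -U1'. apply (trajectory_unique W s); auto.
- apply Is.
- intros r. now apply driving_clamp_cont.
- now apply (trajectory_restrict W t).
- congruence.
Qed.

Definition force_gap (s : R) : C := (z (Rmax 0 s) - W (Rmax 0 s))%C.

Let zeta := force_gap.

Lemma force_start : z 0 = z0.
Proof.
destruct (loewner_map_trajectory W 0 _ _ (Rle_refl 0) (SLE0_force _ _ _ _ _ _ Hsle 0 in_time_0))
  as [u [U0 [U1 _]]]. congruence.
Qed.

Lemma force_gap_0 : zeta 0 = z0.
Proof.
unfold zeta, force_gap. rewrite Rmax_left; [|lra].
rewrite force_start (SLE0_start _ _ _ _ _ _ Hsle). ring.
Qed.

Lemma force_gap_neq0 (s : R) : Rbar_lt s T -> zeta s <> 0.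
Proof.
intros Hs E. destruct (in_time_between s lifetime_pos Hs) as [t [Ht Hst]].
destruct (force_trajectory t Ht) as [u [U Hu]].
assert (Hr : 0 <= Rmax 0 s <= t).
{ destruct Ht. unfold Rmax; destruct (Rle_dec 0 s); lra. }
apply (trajectory_neq _ _ _ U _ Hr). rewrite -Hu; auto.
replace (z (Rmax 0 s)) with (zeta s + W (Rmax 0 s))%C by (unfold zeta, force_gap; ring).
rewrite E. ring.
Qed.

Lemma force_gap_cont (s : R) : Rbar_lt s T -> ccont zeta s.
Proof.
intros Hs. apply ccont_minus; [|apply ccont_R; now apply driving_cont].
destruct (in_time_between s lifetime_pos Hs) as [t [Ht Hst]].
destruct (force_trajectory t Ht) as [u [U Hu]].
apply (ccont_ext_loc (fun r => u (clamp t r))); [|apply U].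
generalize (open_Rbar_lt' s t Hst). apply filter_imp. intros r Hr. cbn in Hr.
assert (Hc : clamp t r = Rmax 0 r) by (unfold clamp; now rewrite Rmin_left; [|lra]).
rewrite Hc. symmetry. apply Hu. destruct Ht.
unfold Rmax; destruct (Rle_dec 0 r); lra.
Qed.

Definition force_kernel (s : R) : R := - 4 * Re (/ zeta s)%C.

Let b := force_kernel.

Lemma force_kernel_cont (s : R) : Rbar_lt s T -> continuous b s.
Proof.
intros Hs. apply: continuous_mult; [apply: continuous_const|].
apply (ccont_inv zeta s); [now apply force_gap_cont|now apply force_gap_neq0].
Qed.

Lemma force_kernel_eq (s : R) : Rbar_lt s T ->
  RtoC (b s) = (- (2 / zeta s) - 2 / Cconj (zeta s))%C.
Proof.
intros Hs. assert (Hn := force_gap_neq0 s Hs).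
replace (2 / Cconj (zeta s))%C with (2 * Cconj (/ zeta s))%C.
2: { rewrite Cinv_conj; auto. }
unfold b, force_kernel, Cdiv. apply Cext; unfold Re, Im; cbn; ring.
Qed.

Lemma driving_derive_kernel (s : R) : 0 < s -> Rbar_lt s T -> is_derive W s (rho / 4 * b s).
Proof.
intros H0 Hs. apply (is_derive_eq _ _ _ _ (driving_derive s H0 Hs)).
assert (Hn := force_gap_neq0 s Hs).
assert (E : (W s - z s)%C = (- zeta s)%C).
{ unfold zeta, force_gap. rewrite Rmax_right; [ring|lra]. }
rewrite E. replace (rho / - zeta s)%C with (RtoC (- rho) * / zeta s)%C.
2: { rewrite RtoC_opp. field. auto. }
unfold b, force_kernel. generalize (/ zeta s)%C. intros [x y]. unfold Re; cbn. field.
Qed.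

Lemma force_gap_derive (s : R) : 0 < s -> Rbar_lt s T ->
  cderive zeta s (2 / zeta s - (rho / 4 * b s)%R)%C.
Proof.
intros H0 Hs. destruct (in_time_between s lifetime_pos Hs) as [t [Ht Hst]].
destruct (force_trajectory t Ht) as [u [U Hu]].
assert (Hl := locally_Ioo 0 t s (conj H0 Hst)).
apply (cderive_ext_loc (fun r => u r - W r)%C).
{ revert Hl. apply filter_imp. intros r Hr. unfold zeta, force_gap.
  rewrite Rmax_right ?Hu; auto; lra. }
eapply cderive_eq.
- apply cderive_minus; [apply (trajectory_ode _ _ _ U); lra|].
  apply cderive_R. now apply driving_derive_kernel.
- unfold zeta, force_gap. rewrite Rmax_right; [|lra]. rewrite Hu; [easy|lra].
Qed.

Lemma trace_backward t : in_time T t ->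
  exists V : R -> R -> C,
    (forall y, 0 < y -> backward (fun s => rho / 4 * b s) t y (V y)) /\
    climit (fun y => V y 0) (gamma t).
Proof.
intros Ht. assert (Ht0 := proj1 Ht).
destruct (SLE0_trace _ _ _ _ _ _ Hsle t Ht) as [f [Hf Hlim]].
assert (Hu : forall y, exists u, 0 < y -> u 0 = f y /\ u t = (W t, y) /\ trajectory W t u).
{ intros y. destruct (Rlt_dec 0 y) as [Hy|Hy].
  - destruct (loewner_map_trajectory W t _ _ Ht0 (proj2 (Hf y Hy))) as [u Hu]. now exists u.
  - now exists (fun _ => RtoC 0). }
set (u := fun y => epsilon (inhabits (fun _ : R => RtoC 0))
  (fun u => 0 < y -> u 0 = f y /\ u t = (W t, y) /\ trajectory W t u)).
assert (Us : forall y, 0 < y -> u y 0 = f y /\ u y t = (W t, y) /\ trajectory W t (u y)).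
{ intros y. apply (epsilon_spec (inhabits (fun _ : R => RtoC 0)) _ (Hu y)). }
exists (fun y s => u y (clamp t s) - W (clamp t s))%C. split.
- intros y Hy. destruct (Us y Hy) as [U0 [U1 U]]. split.
  + intros s. apply ccont_minus; [apply U|]. apply ccont_R. now apply driving_clamp_cont.
  + rewrite clamp_id; [|lra]. rewrite U1. apply Cext; cbn; ring.
  + intros s. assert (Hi : 0 < Im (u y (clamp t s))).
    { apply (trajectory_Im_pos W t); auto; [intros r; now apply driving_clamp_cont| |now apply clamp_in].
      rewrite U0. now apply Hf. }
    unfold Im in *; cbn. lra.
  + intros s Hs. apply (cderive_ext_loc (fun r => u y r - W r)%C).
    { generalize (locally_clamp t s Hs). apply filter_imp. now intros r ->. }
    eapply cderive_eq.
    * apply cderive_minus; [now apply (trajectory_ode _ _ _ U)|].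
      apply cderive_R. apply driving_derive_kernel; [lra|].
      apply (in_time_le s t Ht). lra.
    * rewrite clamp_id; [easy|lra].
- assert (E : forall y, 0 < y -> (u y (clamp t 0) - W (clamp t 0))%C = f y).
  { intros y Hy. rewrite clamp_id; [|lra].
    rewrite (proj1 (Us y Hy)) (SLE0_start _ _ _ _ _ _ Hsle). ring. }
  apply (climit_ext f).
  { generalize (at_right_le 1 ltac:(lra)). apply filter_imp. intros y Hy.
    symmetry. apply E. lra. }
  split; eapply filterlim_comp; try exact Hlim.
  + apply: continuous_fst.
  + apply: continuous_snd.
Qed.

Theorem tip_description :
  exists N : R -> C,
    N 0 = 0 /\ gamma 0 = 0 /\
    (forall t0, in_time T t0 -> exists K, forall t1 t2, 0 <= t1 -> t1 <= t2 -> t2 <= t0 ->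
      Cmod (N t1 - N t2) <= K * root4 (t2 - t1)) /\
    (forall t0, in_time T t0 -> exists K, forall t1 t2, 0 <= t1 -> t1 <= t2 -> t2 <= t0 ->
      Cmod (gamma t2 * gamma t2 - gamma t1 * gamma t1 +
        4 * (t2 - t1)%R * cexp (rho / 4 * N t1))%C <= K * (t2 - t1) * root4 (t2 - t1)) /\
    (forall t0, in_time T t0 -> exists c, 0 < c /\ forall t, 0 <= t <= t0 ->
      0 <= Im (gamma t) /\
      c * t <= Im (gamma t) * Im (gamma t)) /\
    (forall t, in_time T t -> exists k : R, 0 < k /\
      RtoC k = ((gamma t - z0) * (gamma t - Cconj z0) * cexp (N t))%C).
Proof.
set (V := fun t => epsilon (inhabits (fun _ _ : R => RtoC 0)) (fun V =>
    (forall y, 0 < y -> backward (fun s => rho / 4 * b s) t y (V y)) /\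
    climit (fun y => V y 0) (gamma t))).
assert (Vs : forall t, in_time T t ->
    (forall y, 0 < y -> backward (fun s => rho / 4 * b s) t y (V t y)) /\
    climit (fun y => V t y 0) (gamma t)).
{ intros t Ht. apply (epsilon_spec (inhabits (fun _ _ : R => RtoC 0)) _ (trace_backward t Ht)). }
assert (HV : forall t y, in_time T t -> 0 < y -> backward (fun s => rho / 4 * b s) t y (V t y)).
{ intros t y Ht. now apply Vs. }
assert (HG : forall t, in_time T t -> climit (fun y => V t y 0) (gamma t)) by apply Vs.
exists (tip_exponent b V).
split; [|split; [|split; [|split; [|split]]]].
- apply (tip_exponent_0 T rho (fun s => rho / 4 * b s)); auto using force_kernel_cont, in_time_0.
- apply (tip_start T (fun s => rho / 4 * b s) V); auto using in_time_0.
- apply (tip_exponent_modulus T rho (fun s => rho / 4 * b s)); auto using force_kernel_cont.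
- apply (tip_square_increment T rho (fun s => rho / 4 * b s)); auto using force_kernel_cont.
- apply (tip_Im_lower T rho (fun s => rho / 4 * b s) b V); auto using force_kernel_cont.
- intros t Ht. assert (Hlt : forall s, s <= t -> Rbar_lt s T).
  { intros s Hs. apply (Rbar_le_lt_trans s t); [exact Hs|apply Ht]. }
  exists (Cmod (zeta t) ^ 2). split.
  { apply pow_lt, Cmod_gt_0, force_gap_neq0, Ht. }
  rewrite Cmod2_conj -force_gap_0.
  apply (tip_force_point T rho (fun s => rho / 4 * b s)); auto using force_kernel_cont.
  + intros s Hs. apply force_gap_cont, Hlt. lra.
  + intros s Hs. apply force_gap_neq0, Hlt. lra.
  + intros s Hs. apply force_gap_derive; [lra|]. apply Hlt. lra.
  + intros s Hs. apply force_kernel_eq, Hlt. lra.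
Qed.

End SLETip.

(** * The square root of time as parameter *)

Lemma continuous_small (g : R -> R) (s : R) :
  continuous g s -> g s = 0 -> forall eps : posreal, locally s (fun r => g r < eps).
Proof.
intros Hg H0 eps. generalize (proj1 (filterlim_locally g (g s)) Hg eps).
apply filter_imp. intros r Hr. change (Rabs (g r - g s) < eps) in Hr.
apply Rabs_def2 in Hr. lra.
Qed.

Lemma ccont_of_bound (f : R -> C) (g : R -> R) (s : R) :
  locally s (fun r => Cmod (f r - f s) <= g r) ->
  continuous g s -> g s = 0 -> ccont f s.
Proof.
intros Hf Hg H0.
split; apply filterlim_locally; intros eps;
  generalize (filter_and _ _ Hf (continuous_small g s Hg H0 eps));
  apply filter_imp; intros r [H1 H2].
- change (Rabs (Re (f r) - Re (f s)) < eps).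
  apply Rle_lt_trans with (2 := H2). apply Rle_trans with (2 := H1).
  apply Rle_trans with (2 := Re_Cmod _). right. reflexivity.
- change (Rabs (Im (f r) - Im (f s)) < eps).
  apply Rle_lt_trans with (2 := H2). apply Rle_trans with (2 := H1).
  apply Rle_trans with (2 := Im_Cmod _). right. reflexivity.
Qed.

Lemma is_derive_of_bound (f g : R -> R) (s l : R) :
  locally s (fun r => Rabs (f r - f s - (r - s) * l) <= Rabs (r - s) * g r) ->
  continuous g s -> g s = 0 -> is_derive f s l.
Proof.
intros Hf Hg H0. split; [apply is_linear_scal_l|].
intros x Hx. rewrite -(is_filter_lim_locally_unique _ _ Hx). intros eps.
generalize (filter_and _ _ Hf (continuous_small g s Hg H0 eps)).
apply filter_imp; intros r [H1 H2].
change (Rabs (f r - f s - (r - s) * l) <= eps * Rabs (r - s)).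
apply Rle_trans with (1 := H1). rewrite Rmult_comm.
apply Rmult_le_compat_r; [apply Rabs_pos|lra].
Qed.

Lemma cderive_of_bound (f : R -> C) (g : R -> R) (s : R) (l : C) :
  locally s (fun r => Cmod (f r - f s - (r - s)%R * l)%C <= Rabs (r - s) * g r) ->
  continuous g s -> g s = 0 -> cderive f s l.
Proof.
intros Hf Hg H0.
split; apply is_derive_of_bound with (g := g); auto; revert Hf; apply filter_imp;
  intros r Hr; apply Rle_trans with (2 := Hr).
- apply Rle_trans with (2 := Re_Cmod _). right. f_equal. unfold Re; cbn. ring.
- apply Rle_trans with (2 := Im_Cmod _). right. f_equal. unfold Im; cbn. ring.
Qed.

Lemma Rmax_0_lip (r s : R) : Rabs (Rmax 0 r - Rmax 0 s) <= Rabs (r - s).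
Proof.
unfold Rmax; destruct (Rle_dec 0 r), (Rle_dec 0 s); apply Rabs_le;
  generalize (Rle_abs (r - s)) (Rle_abs (- (r - s))); rewrite Rabs_Ropp; lra.
Qed.

Lemma continuous_root4_dist (s : R) : continuous (fun r => root4 (Rabs (r - s))) s.
Proof.
apply (continuous_comp (fun r => Rabs (r - s)) root4); [|apply root4_continuous].
apply (continuous_comp (fun r => r - s) Rabs); [|apply continuous_Rabs].
apply: ex_derive_continuous. now auto_derive.
Qed.

Lemma root4_0 : root4 0 = 0.
Proof. unfold root4. now rewrite !sqrt_0. Qed.

Definition root_time (T : Rbar) : Rbar :=
  match T with Finite r => Finite (sqrt r) | p_infty => p_infty | m_infty => m_infty end.

Lemma root_time_lt (T : Rbar) (x : R) :
  0 <= x -> (Rbar_lt x (root_time T) <-> Rbar_lt (x * x) T).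
Proof.
intros Hx. destruct T as [r| |]; cbn; try tauto. split; intros H.
- destruct (Rle_dec 0 r) as [Hr|Hr].
  + assert (X := sqrt_sqrt r Hr). nra.
  + rewrite sqrt_neg_0 in H; lra.
- rewrite -(sqrt_square x Hx). apply sqrt_lt_1_alt. nra.
Qed.

Lemma Rbar_lt_between (x : R) (S : Rbar) : Rbar_lt x S -> exists y : R, x < y /\ Rbar_lt y S.
Proof.
intros Hx. destruct S as [s| |]; cbn in *; try easy.
- exists ((x + s) / 2). lra.
- exists (x + 1). split; [lra|easy].
Qed.

Section SquareRootTime.

Variables (rho : R) (T : Rbar) (gamma N : R -> C).
Hypothesis HT : Rbar_lt 0 T.
Hypothesis HN0 : N 0 = 0.
Hypothesis Hg0 : gamma 0 = 0.
Hypothesis HN : forall t0, in_time T t0 ->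
  exists K, forall t1 t2, 0 <= t1 -> t1 <= t2 -> t2 <= t0 ->
    Cmod (N t1 - N t2) <= K * root4 (t2 - t1).
Hypothesis HS : forall t0, in_time T t0 ->
  exists K, forall t1 t2, 0 <= t1 -> t1 <= t2 -> t2 <= t0 ->
    Cmod (gamma t2 * gamma t2 - gamma t1 * gamma t1 +
      4 * (t2 - t1)%R * cexp (rho / 4 * N t1))%C <= K * (t2 - t1) * root4 (t2 - t1).
Hypothesis HIm : forall t0, in_time T t0 ->
  exists c, 0 < c /\ forall t, 0 <= t <= t0 ->
    0 <= Im (gamma t) /\ c * t <= Im (gamma t) * Im (gamma t).

Let e t := cexp (rho / 4 * N t).
Let S t := (gamma t * gamma t)%C.

Lemma near_time (s t0 : R) : in_time T t0 -> s < t0 ->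
  locally s (fun r => 0 <= Rmax 0 r <= t0).
Proof.
intros [H0 _] Hs. generalize (open_Rbar_lt' s t0 Hs). apply filter_imp.
intros r Hr. cbn in Hr. unfold Rmax; destruct (Rle_dec 0 r); lra.
Qed.

Lemma exponent_cont (s : R) : Rbar_lt s T -> ccont (fun r => N (Rmax 0 r)) s.
Proof.
intros Hs. destruct (in_time_between s HT Hs) as [t0 [Ht0 Hst]].
destruct (HN t0 Ht0) as [K HK].
assert (Hsy : forall t1 t2, 0 <= t1 <= t0 -> 0 <= t2 <= t0 ->
  Cmod (N t1 - N t2) <= Rabs K * root4 (Rabs (t1 - t2))).
{ assert (Hle : forall t1 t2, 0 <= t1 <= t2 -> t2 <= t0 ->
    Cmod (N t1 - N t2) <= Rabs K * root4 (Rabs (t1 - t2))).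
  { intros t1 t2 H1 H2. apply Rle_trans with (1 := HK t1 t2 ltac:(lra) ltac:(lra) H2).
    rewrite Rabs_minus_sym (Rabs_pos_eq (t2 - t1)); [|lra].
    apply Rmult_le_compat_r; [apply root4_ge_0|apply Rle_abs]. }
  intros t1 t2 H1 H2. destruct (Rle_dec t1 t2) as [H|H]; [apply Hle; lra|].
  replace (N t1 - N t2)%C with (- (N t2 - N t1))%C by ring.
  rewrite Cmod_opp Rabs_minus_sym. apply Hle; lra. }
apply ccont_of_bound with (g := fun r => Rabs K * root4 (Rabs (r - s))).
- assert (Hs' := locally_singleton _ _ (near_time s t0 Ht0 Hst)).
  generalize (near_time s t0 Ht0 Hst). apply filter_imp. intros r Hr.
  apply Rle_trans with (1 := Hsy _ _ Hr Hs').
  apply Rmult_le_compat_l; [apply Rabs_pos|]. apply root4_le, Rmax_0_lip.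
- apply: continuous_mult; [apply: continuous_const|apply continuous_root4_dist].
- rewrite Rminus_diag Rabs_R0 root4_0. ring.
Qed.

Lemma exp_factor_cont (s : R) : Rbar_lt s T -> ccont (fun r => e (Rmax 0 r)) s.
Proof.
intros Hs. apply ccont_cexp. apply ccont_mult; [apply ccont_const|now apply exponent_cont].
Qed.

Lemma exp_factor_0 : e 0 = 1.
Proof. unfold e. rewrite HN0 Cmult_0_r. apply cexp_0. Qed.

Lemma square_slope t0 : in_time T t0 ->
  exists K, 0 <= K /\ forall t r, 0 <= t <= t0 -> 0 <= r <= t0 ->
    Cmod (S r - S t - (r - t)%R * (- (4) * e t))%C <=
      Rabs (r - t) * (K * root4 (Rabs (r - t)) + 4 * Cmod (e r - e t)).
Proof.
intros Ht0. destruct (HS t0 Ht0) as [K HK].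
exists (Rabs K). split; [apply Rabs_pos|].
assert (Hle : forall t r, 0 <= t <= r -> r <= t0 ->
  Cmod (S r - S t + 4 * (r - t)%R * e t)%C <= (r - t) * (Rabs K * root4 (r - t))).
{ intros t r H1 H2. apply Rle_trans with (1 := HK t r ltac:(lra) ltac:(lra) H2).
  replace (K * (r - t) * root4 (r - t)) with ((r - t) * (K * root4 (r - t))) by ring.
  apply Rmult_le_compat_l; [lra|].
  apply Rmult_le_compat_r; [apply root4_ge_0|apply Rle_abs]. }
intros t r Ht Hr. destruct (Rle_dec t r) as [H|H].
- replace (S r - S t - (r - t)%R * (- (4) * e t))%C with
    (S r - S t + 4 * (r - t)%R * e t)%C by ring.
  apply Rle_trans with (1 := Hle t r ltac:(lra) ltac:(lra)).
  rewrite (Rabs_pos_eq (r - t)); [|lra]. apply Rmult_le_compat_l; [lra|].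
  generalize (Cmod_ge_0 (e r - e t)). lra.
- replace (S r - S t - (r - t)%R * (- (4) * e t))%C with
    (- (S t - S r + 4 * (t - r)%R * e r) + 4 * (t - r)%R * (e r - e t))%C.
  2: { rewrite !RtoC_minus. ring. }
  apply Rle_trans with (1 := Cmod_triangle _ _).
  rewrite Cmod_opp !Cmod_mult !Cmod_R (Rabs_pos_eq 4) ?(Rabs_pos_eq (t - r)); try lra.
  rewrite Rabs_minus_sym (Rabs_pos_eq (t - r)); [|lra].
  generalize (Hle r t ltac:(lra) ltac:(lra)). lra.
Qed.

Lemma square_bound_cont (K s : R) (k : R) : Rbar_lt s T ->
  continuous (fun r => k * (K * root4 (Rabs (r - s)) + 4 * Cmod (e (Rmax 0 r) - e (Rmax 0 s)))) s.
Proof.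
intros Hs. apply: continuous_mult; [apply: continuous_const|].
apply: continuous_plus; apply: continuous_mult; try apply: continuous_const.
- apply continuous_root4_dist.
- apply continuous_Cmod. apply ccont_minus; [now apply exp_factor_cont|apply ccont_const].
Qed.

Lemma square_cont (s : R) : Rbar_lt s T -> ccont (fun r => S (Rmax 0 r)) s.
Proof.
intros Hs. destruct (in_time_between s HT Hs) as [t0 [It Htt]].
destruct (square_slope t0 It) as [K [HK HKs]].
apply ccont_of_bound with (g := fun r => Rabs (r - s) *
  (1 * (K * root4 (Rabs (r - s)) + 4 * Cmod (e (Rmax 0 r) - e (Rmax 0 s))) +
   4 * Cmod (e (Rmax 0 s)))).
- assert (Hs' := locally_singleton _ _ (near_time s t0 It Htt)).
  generalize (near_time s t0 It Htt). apply filter_imp. intros r Hr.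
  set (a := Rmax 0 r) in *. set (b := Rmax 0 s) in *.
  assert (Hab : Rabs (a - b) <= Rabs (r - s)) by apply Rmax_0_lip.
  replace (S a - S b)%C with ((S a - S b - (a - b)%R * (- (4) * e b)) +
    (a - b)%R * (- (4) * e b))%C by ring.
  apply Rle_trans with (1 := Cmod_triangle _ _).
  rewrite !Cmod_mult Cmod_opp !Cmod_R (Rabs_pos_eq 4); [|lra].
  rewrite Rmult_1_l Rmult_plus_distr_l.
  apply Rplus_le_compat.
  + apply Rle_trans with (1 := HKs b a Hs' Hr).
    assert (X := root4_le _ _ Hab). assert (Y := root4_ge_0 (Rabs (a - b))).
    assert (Z := Cmod_ge_0 (e a - e b)).
    apply Rmult_le_compat; [apply Rabs_pos|nra|exact Hab|nra].
  + apply Rmult_le_compat_r; [|exact Hab]. generalize (Cmod_ge_0 (e b)). lra.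
- apply: continuous_mult.
  + apply (continuous_comp (fun r => r - s) Rabs); [|apply continuous_Rabs].
    apply: ex_derive_continuous. now auto_derive.
  + apply: continuous_plus; [now apply square_bound_cont|apply: continuous_const].
- rewrite Rminus_diag Rabs_R0. ring.
Qed.

Lemma curve_Im_pos (t : R) : 0 < t -> Rbar_lt t T -> 0 < Im (gamma t).
Proof.
intros Ht0 Ht. destruct (HIm t) as [c [Hc H]]; [split; [lra|exact Ht]|].
destruct (H t ltac:(lra)) as [H1 H2]. nra.
Qed.

Lemma curve_Im_ge_0 (t : R) : in_time T t -> 0 <= Im (gamma t).
Proof.
intros Ht. destruct (HIm t Ht) as [c [Hc H]].
apply (H t). split; [apply Ht|lra].
Qed.

Lemma curve_diff (t r : R) : 0 < t -> Rbar_lt t T -> in_time T r ->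
  (gamma r + gamma t)%C <> 0 /\ Im (gamma t) <= Cmod (gamma r + gamma t) /\
  (gamma r - gamma t)%C = ((S r - S t) / (gamma r + gamma t))%C.
Proof.
intros Ht0 Ht Hr. assert (H1 := curve_Im_pos t Ht0 Ht). assert (H2 := curve_Im_ge_0 r Hr).
assert (H3 : Im (gamma t) <= Im (gamma r + gamma t)%C) by (unfold Im in *; cbn; lra).
assert (Hn : (gamma r + gamma t)%C <> 0) by (apply Im_pos_neq0; lra).
split; [exact Hn|]. split.
- apply Rle_trans with (1 := H3). apply Rle_trans with (2 := Im_Cmod _). apply Rle_abs.
- unfold S. field. exact Hn.
Qed.

Lemma in_time_Rmax (r : R) : Rbar_lt r T -> in_time T (Rmax 0 r).
Proof.
intros Hr. split; [apply Rmax_l|]. unfold Rmax; destruct (Rle_dec 0 r); auto.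
Qed.

Lemma curve_cont (s : R) : Rbar_lt s T -> ccont (fun r => gamma (Rmax 0 r)) s.
Proof.
intros Hs. destruct (Rlt_le_dec 0 s) as [H0|H0].
- assert (Hp := curve_Im_pos s H0 Hs).
  apply ccont_of_bound with (g := fun r => Cmod (S (Rmax 0 r) - S (Rmax 0 s)) / Im (gamma s)).
  + generalize (open_Rbar_lt' s T Hs). apply filter_imp. intros r Hr.
    rewrite (Rmax_right 0 s); [|lra].
    destruct (curve_diff s (Rmax 0 r) H0 Hs (in_time_Rmax r Hr)) as [H1 [H2 H3]].
    rewrite H3 Cmod_div; auto. apply Rmult_le_compat_l; [apply Cmod_ge_0|].
    now apply Rinv_le_contravar.
  + apply continuous_Rdiv; [|apply: continuous_const|lra].
    apply continuous_Cmod, ccont_minus; [now apply square_cont|apply ccont_const].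
  + replace (S (Rmax 0 s) - S (Rmax 0 s))%C with (RtoC 0) by ring.
    rewrite Cmod_0. field. lra.
- apply ccont_of_bound with (g := fun r => sqrt (Cmod (S (Rmax 0 r)))).
  + apply filter_forall. intros r. rewrite (Rmax_left 0 s); [|lra]. rewrite Hg0.
    unfold S. rewrite Cmod_mult sqrt_square; [|apply Cmod_ge_0]. right. f_equal. ring.
  + apply (continuous_comp (fun r => Cmod (S (Rmax 0 r))) sqrt); [|apply continuous_sqrt].
    now apply continuous_Cmod, square_cont.
  + rewrite (Rmax_left 0 s); [|lra]. unfold S. rewrite Hg0 Cmult_0_r Cmod_0 sqrt_0. easy.
Qed.

Lemma curve_derive (t : R) : 0 < t -> Rbar_lt t T ->
  cderive gamma t (- (2) * e t / gamma t)%C.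
Proof.
intros H0 Ht. assert (Hp := curve_Im_pos t H0 Ht).
assert (Hn : gamma t <> 0) by now apply Im_pos_neq0.
destruct (in_time_between t HT Ht) as [t0 [It Htt]].
destruct (square_slope t0 It) as [K [HK HKs]].
set (l := (- (4) * e t)%C).
apply cderive_of_bound with (g := fun r =>
  / Im (gamma t) * (K * root4 (Rabs (r - t)) + 4 * Cmod (e (Rmax 0 r) - e (Rmax 0 t))) +
  Cmod l / (2 * Cmod (gamma t) * Im (gamma t)) * Cmod (gamma (Rmax 0 t) - gamma (Rmax 0 r))).
- generalize (locally_Ioo 0 t0 t (conj H0 Htt)). apply filter_imp. intros r Hr.
  rewrite !Rmax_right; try lra.
  assert (Ir : in_time T r).
  { split; [lra|]. apply (Rbar_lt_trans r t0); [apply Hr|apply It]. }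
  destruct (curve_diff t r H0 Ht Ir) as [H1 [H2 H3]].
  rewrite H3.
  replace ((S r - S t) / (gamma r + gamma t) - (r - t)%R * (- (2) * e t / gamma t))%C with
   ((S r - S t - (r - t)%R * l) / (gamma r + gamma t) +
    (r - t)%R * (l / (2 * gamma t) * ((gamma t - gamma r) / (gamma r + gamma t))))%C.
  2: { assert (N2 : RtoC 2 <> 0) by (intros E; injection E; lra).
       replace (- (2) * e t / gamma t)%C with (l / (2 * gamma t))%C.
       2: { unfold l. replace (RtoC 4) with (2 * 2)%C by (apply Cext; cbn; ring).
            field. auto. }
       replace (gamma t - gamma r)%C with (2 * gamma t - (gamma r + gamma t))%C
         by (apply Cext; cbn; ring).
       clear -H1 Hn N2. revert H1. generalize (gamma r + gamma t)%C. intros G HG.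
       field. auto. }
  assert (Hi : 0 < Cmod (gamma r + gamma t)) by lra.
  assert (Hi' : / Cmod (gamma r + gamma t) <= / Im (gamma t)) by now apply Rinv_le_contravar.
  apply Rle_trans with (1 := Cmod_triangle _ _).
  assert (X := HKs t r ltac:(lra) ltac:(lra)). fold l in X.
  set (k := K * root4 (Rabs (r - t)) + 4 * Cmod (e r - e t)) in *.
  rewrite Rmult_plus_distr_l. apply Rplus_le_compat.
  + rewrite Cmod_div; auto.
    replace (Rabs (r - t) * (/ Im (gamma t) * k)) with (Rabs (r - t) * k * / Im (gamma t)) by ring.
    apply Rmult_le_compat; auto; [apply Cmod_ge_0|apply Rlt_le, Rinv_0_lt_compat; lra].
  + rewrite Cmod_mult Cmod_R. apply Rmult_le_compat_l; [apply Rabs_pos|].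
    assert (N2 : (2 * gamma t)%C <> 0).
    { apply Cmult_neq_0; auto. intros E; injection E; lra. }
    rewrite Cmod_mult !Cmod_div; auto. rewrite Cmod_mult Cmod_R (Rabs_pos_eq 2); [|lra].
    assert (Y : 0 < Cmod (gamma t)) by now apply Cmod_gt_0.
    replace (Cmod l / (2 * Cmod (gamma t) * Im (gamma t)) * Cmod (gamma t - gamma r))
      with (Cmod l / (2 * Cmod (gamma t)) * (Cmod (gamma t - gamma r) * / Im (gamma t)))
      by (field; lra).
    apply Rmult_le_compat_l.
    * apply Rdiv_le_0_compat; [apply Cmod_ge_0|lra].
    * apply Rmult_le_compat_l; [apply Cmod_ge_0|exact Hi'].
- apply: continuous_plus; [now apply square_bound_cont|].
  apply: continuous_mult; [apply: continuous_const|].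
  apply continuous_Cmod, ccont_minus; [apply ccont_const|now apply curve_cont].
- rewrite Rminus_diag Rabs_R0 root4_0.
  replace (e (Rmax 0 t) - e (Rmax 0 t))%C with (RtoC 0) by ring.
  replace (gamma (Rmax 0 t) - gamma (Rmax 0 t))%C with (RtoC 0) by ring.
  rewrite Cmod_0. ring.
Qed.

Lemma root_time_Rmax (x : R) : Rbar_lt x (root_time T) -> Rbar_lt (Rmax 0 x * Rmax 0 x) T.
Proof.
intros Hx. unfold Rmax. destruct (Rle_dec 0 x) as [H|H].
- now apply root_time_lt.
- now rewrite Rmult_0_r.
Qed.

Lemma sqrt_curve_cont (x : R) : Rbar_lt x (root_time T) ->
  ccont (fun r => gamma (Rmax 0 r * Rmax 0 r)) x.
Proof.
intros Hx.
apply (ccont_ext (fun r => gamma (Rmax 0 (Rmax 0 r * Rmax 0 r)))).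
{ intros r. f_equal. apply Rmax_right. nra. }
apply root_time_Rmax, curve_cont in Hx. destruct Hx as [H1 H2].
assert (Hc : continuous (fun r => Rmax 0 r * Rmax 0 r) x)
  by (apply: continuous_mult; apply continuous_Rmax_0).
split.
- exact (continuous_comp (fun r => Rmax 0 r * Rmax 0 r) (fun t => Re (gamma (Rmax 0 t))) x Hc H1).
- exact (continuous_comp (fun r => Rmax 0 r * Rmax 0 r) (fun t => Im (gamma (Rmax 0 t))) x Hc H2).
Qed.

Lemma sqrt_N_cont (x : R) : Rbar_lt x (root_time T) ->
  ccont (fun r => N (Rmax 0 r * Rmax 0 r)) x.
Proof.
intros Hx.
apply (ccont_ext (fun r => N (Rmax 0 (Rmax 0 r * Rmax 0 r)))).
{ intros r. f_equal. apply Rmax_right. nra. }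
apply root_time_Rmax, exponent_cont in Hx. destruct Hx as [H1 H2].
assert (Hc : continuous (fun r => Rmax 0 r * Rmax 0 r) x)
  by (apply: continuous_mult; apply continuous_Rmax_0).
split.
- exact (continuous_comp (fun r => Rmax 0 r * Rmax 0 r) (fun t => Re (N (Rmax 0 t))) x Hc H1).
- exact (continuous_comp (fun r => Rmax 0 r * Rmax 0 r) (fun t => Im (N (Rmax 0 t))) x Hc H2).
Qed.

(* The derivative of x |-> gamma (x * x), extended by its limit 2 i to x <= 0. *)
Definition sqrt_velocity (x : R) : C :=
  if Rlt_dec 0 x then (- (4 * x)%R * e (x * x) / gamma (x * x))%C else (2 * Ci)%C.

Lemma sqrt_velocity_pos (x : R) : 0 < x ->
  sqrt_velocity x = (- (4 * x)%R * e (x * x) / gamma (x * x))%C.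
Proof. intros Hx. unfold sqrt_velocity. now destruct (Rlt_dec 0 x). Qed.

Lemma sqrt_velocity_neg (x : R) : x <= 0 -> sqrt_velocity x = (2 * Ci)%C.
Proof. intros Hx. unfold sqrt_velocity. destruct (Rlt_dec 0 x); [lra|easy]. Qed.

Lemma sqrt_curve_neq0 (x : R) : 0 < x -> Rbar_lt x (root_time T) -> gamma (x * x) <> 0.
Proof.
intros H0 Hx. apply Im_pos_neq0, curve_Im_pos; [nra|]. apply root_time_lt; [lra|exact Hx].
Qed.

Lemma sqrt_velocity_neq0 (x : R) : Rbar_lt x (root_time T) -> sqrt_velocity x <> 0.
Proof.
intros Hx. destruct (Rlt_le_dec 0 x) as [H0|H0].
- rewrite sqrt_velocity_pos; auto. assert (Hn := sqrt_curve_neq0 x H0 Hx).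
  apply Cmult_neq_0; [apply Cmult_neq_0; [|apply cexp_neq0]|].
  + intros E. injection E. intros. nra.
  + intros E. assert (X := Rinv_0_lt_compat _ (proj1 (Cmod_gt_0 _) Hn)).
    rewrite -Cmod_inv in X; auto. rewrite E Cmod_0 in X. lra.
- rewrite sqrt_velocity_neg; auto. intros E. injection E. lra.
Qed.

Lemma sqrt_curve_derive (x : R) : 0 < x -> Rbar_lt x (root_time T) ->
  cderive (fun r => gamma (r * r)) x (sqrt_velocity x).
Proof.
intros H0 Hx. assert (Hn := sqrt_curve_neq0 x H0 Hx).
apply root_time_lt in Hx; [|lra].
destruct (curve_derive (x * x) ltac:(nra) Hx) as [D1 D2].
assert (Hq : is_derive (fun r : R => r * r) x (2 * x)).
{ auto_derive; auto; ring. }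
assert (E : sqrt_velocity x = ((2 * x)%R * (- (2) * e (x * x) / gamma (x * x)))%C).
{ rewrite sqrt_velocity_pos; auto.
  replace ((4 * x)%R : C) with (2 * (2 * x)%R)%C by (apply Cext; cbn; ring). field. auto. }
rewrite E. set (d := (- (2) * e (x * x) / gamma (x * x))%C) in *.
split.
- apply (is_derive_eq _ _ _ _ (is_derive_comp (fun t => Re (gamma t)) (fun r => r * r) x _ _ D1 Hq)).
  unfold scal, Re; cbn. unfold mult; cbn. ring.
- apply (is_derive_eq _ _ _ _ (is_derive_comp (fun t => Im (gamma t)) (fun r => r * r) x _ _ D2 Hq)).
  unfold scal, Im; cbn. unfold mult; cbn. ring.
Qed.

Lemma sqrt_velocity_cont (x : R) : Rbar_lt x (root_time T) -> ccont sqrt_velocity x.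
Proof.
intros Hx. destruct (Rtotal_order 0 x) as [H0|[H0|H0]].
- apply (ccont_ext_loc (fun r =>
    (- (4 * r)%R * cexp (rho / 4 * N (Rmax 0 r * Rmax 0 r)) / gamma (Rmax 0 r * Rmax 0 r))%C)).
  + generalize (open_Rbar_gt' x 0 H0). apply filter_imp. intros r Hr. cbn in Hr.
    rewrite sqrt_velocity_pos; auto. now rewrite Rmax_right; [|lra].
  + apply ccont_div; [|now apply sqrt_curve_cont|rewrite Rmax_right; [now apply sqrt_curve_neq0|lra]].
    apply ccont_mult.
    * apply (ccont_ext (fun r => RtoC (- (4 * r)))).
      { intros r. now rewrite RtoC_opp. }
      apply ccont_R. apply: ex_derive_continuous. now auto_derive.
    * apply ccont_cexp, ccont_mult; [apply ccont_const|now apply sqrt_N_cont].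
- subst x.
  destruct (in_time_between 0 HT HT) as [t0 [It Htt]].
  destruct (square_slope t0 It) as [K [HK HKs]].
  destruct (HIm t0 It) as [c [Hc Hlow]].
  assert (Hsc : 0 < sqrt c) by now apply sqrt_lt_R0.
  set (B := fun r => (4 * Cmod (e (Rmax 0 (Rmax 0 r * Rmax 0 r)) - 1) +
    2 * (K * root4 (r * r) + 4 * Cmod (e (Rmax 0 (Rmax 0 r * Rmax 0 r)) - 1))) / sqrt c).
  apply ccont_of_bound with (g := B).
  + assert (Hs0 : 0 < sqrt t0) by now apply sqrt_lt_R0.
    generalize (open_Rbar_lt' 0 (sqrt t0) Hs0). apply filter_imp. intros r Hr. cbn in Hr.
    rewrite (sqrt_velocity_neg 0); [|lra].
    destruct (Rlt_le_dec 0 r) as [Hr0|Hr0].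
    2: { rewrite sqrt_velocity_neg; auto.
         replace (2 * Ci - 2 * Ci)%C with (RtoC 0) by ring. rewrite Cmod_0.
         apply Rdiv_le_0_compat; auto.
         generalize (Cmod_ge_0 (e (Rmax 0 (Rmax 0 r * Rmax 0 r)) - 1)) (root4_ge_0 (r * r)).
         intros Z1 Z2. assert (0 <= K * root4 (r * r)) by now apply Rmult_le_pos. lra. }
    unfold B. rewrite (Rmax_right 0 r); [|lra]. rewrite (Rmax_right 0 (r * r)); [|nra].
    assert (Hrr : 0 < r * r <= t0).
    { split; [nra|]. rewrite -(sqrt_sqrt t0); [|lra]. nra. }
    rewrite sqrt_velocity_pos; auto.
    set (g := (gamma (r * r) / r)%C).
    assert (Hrn : RtoC r <> 0) by (intros E; injection E; lra).
    assert (Hgr : gamma (r * r) = (g * r)%C) by (unfold g; field; auto).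
    destruct (Hlow (r * r) ltac:(lra)) as [L1 L2].
    assert (Img : Im g * r = Im (gamma (r * r))) by (rewrite Hgr; unfold Im; cbn; ring).
    assert (L3 : sqrt c <= Im g).
    { apply sqrt_le_of_sqr; [nra|]. rewrite -Img in L2.
      apply Rmult_le_reg_r with (r * r); [lra|]. lra. }
    assert (Hgn : g <> 0) by (apply Im_pos_neq0; lra).
    assert (Lg : sqrt c <= Cmod g).
    { apply Rle_trans with (1 := L3). apply Rle_trans with (2 := Im_Cmod _). apply Rle_abs. }
    assert (Hd : Cmod (g - 2 * Ci) <= K * root4 (r * r) + 4 * Cmod (e (r * r) - 1)).
    { assert (X := HKs 0 (r * r) ltac:(lra) ltac:(lra)).
      rewrite exp_factor_0 Rminus_0_r (Rabs_pos_eq (r * r)) in X; [|lra].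
      assert (E : (S (r * r) - S 0 - (r * r)%R * (- (4) * 1))%C = ((r * r)%R * ((g - 2 * Ci) * (g + 2 * Ci)))%C).
      { unfold S. rewrite Hg0 Hgr. destruct g as [p q]. apply Cext; cbn; ring. }
      rewrite E Cmod_mult Cmod_R Rabs_pos_eq in X; [|lra].
      apply Rmult_le_reg_l in X; [|lra].
      rewrite Cmod_mult in X.
      assert (Y : 1 <= Cmod (g + 2 * Ci)).
      { apply Rle_trans with (2 := Im_Cmod _). apply Rle_trans with (2 := Rle_abs _).
        change (1 <= Im g + (2 * 1 + 0 * 0)). lra. }
      generalize (Cmod_ge_0 (g - 2 * Ci)). nra. }
    replace (- (4 * r)%R * e (r * r) / gamma (r * r) - 2 * Ci)%C with
      ((- (4 * (e (r * r) - 1)) - 2 * Ci * (g - 2 * Ci)) / g)%C.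
    2: { rewrite Hgr RtoC_mult.
         transitivity ((- (4 * e (r * r)) + (4 + 4 * (Ci * Ci))) / g - 2 * Ci)%C.
         - replace (RtoC 4) with (2 * 2)%C by (apply Cext; cbn; ring). field. auto.
         - replace (4 + 4 * (Ci * Ci))%C with (RtoC 0) by (apply Cext; cbn; ring).
           field. auto. }
    rewrite Cmod_div; auto. apply Rmult_le_compat.
    * apply Cmod_ge_0.
    * apply Rlt_le, Rinv_0_lt_compat. lra.
    * apply Rle_trans with (1 := Cmod_minus_le _ _).
      rewrite Cmod_opp !Cmod_mult !Cmod_R Cmod_Ci (Rabs_pos_eq 4) ?(Rabs_pos_eq 2); lra.
    * apply Rinv_le_contravar; auto.
  + assert (He : continuous (fun r => Cmod (e (Rmax 0 (Rmax 0 r * Rmax 0 r)) - 1)) 0).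
    { apply continuous_Cmod, ccont_minus; [|apply ccont_const].
      apply (ccont_ext (fun r => e (Rmax 0 r * Rmax 0 r))).
      { intros r. rewrite (Rmax_right 0 (_ * _)); [easy|nra]. }
      apply ccont_cexp, ccont_mult; [apply ccont_const|now apply sqrt_N_cont]. }
    apply continuous_Rdiv; [|apply: continuous_const|lra].
    apply: continuous_plus; apply: continuous_mult; try apply: continuous_const; auto.
    apply: continuous_plus; apply: continuous_mult; try apply: continuous_const; auto.
    apply (continuous_comp (fun r => r * r) root4); [|apply root4_continuous].
    apply: ex_derive_continuous. now auto_derive.
  + unfold B. rewrite (Rmax_left 0 0); [|lra]. rewrite Rmult_0_r (Rmax_left 0 0); [|lra].
    rewrite exp_factor_0 root4_0. replace (1 - 1)%C with (RtoC 0) by ring. rewrite Cmod_0. field. lra.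
- apply (ccont_ext_loc (fun _ => (2 * Ci)%C)); [|apply ccont_const].
  generalize (open_Rbar_lt' x 0 H0). apply filter_imp. intros r Hr. cbn in Hr.
  rewrite sqrt_velocity_neg; [easy|lra].
Qed.

End SquareRootTime.

(** * Arc length *)

Lemma ccont_eps (f : R -> C) (s : R) : ccont f s -> forall eps, 0 < eps ->
  exists d, 0 < d /\ forall r, Rabs (r - s) < d -> Cmod (f r - f s) <= eps.
Proof.
intros Hf eps Heps.
assert (Hc : continuous (fun r => Cmod (f r - f s)) s).
{ apply continuous_Cmod, ccont_minus; [exact Hf|apply ccont_const]. }
assert (H0 : Cmod (f s - f s) = 0).
{ replace (f s - f s)%C with (RtoC 0) by ring. apply Cmod_0. }
destruct (continuous_small _ s Hc H0 (mkposreal eps Heps)) as [d Hd].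
exists d. split; [apply cond_pos|]. intros r Hr. apply Rlt_le, Hd. exact Hr.
Qed.

Lemma mean_value_slope (F f : R -> C) (l : C) (k a b : R) :
  a <= b ->
  (forall x, a < x < b -> cderive F x (f x)) ->
  (forall x, a <= x <= b -> ccont F x) ->
  (forall x, a < x < b -> Cmod (f x - l) <= k) ->
  Cmod (F b - F a - (b - a)%R * l)%C <= k * (b - a).
Proof.
intros Hab Hd Hc Hk.
replace (F b - F a - (b - a)%R * l)%C with ((F b - b * l) - (F a - a * l))%C
  by (rewrite RtoC_minus; ring).
replace (k * (b - a)) with (k * b - k * a) by ring.
assert (Hid : forall x, cderive (fun x => x * l)%C x l).
{ intros x. eapply cderive_eq.
  - apply cderive_mult; [|apply cderive_const].
    apply (cderive_R (fun x => x) x 1). apply: is_derive_id.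
  - cbv beta; ring. }
apply (mean_value_inequality (fun x => F x - x * l)%C (fun x => f x - l)%C
  (fun x => k * x) (fun _ => k)); auto.
- intros x Hx. apply cderive_minus; auto.
- intros x Hx. apply ccont_minus; auto. eapply cderive_cont, Hid.
- intros x Hx. auto_derive; auto; ring.
- intros x Hx. apply: ex_derive_continuous. now auto_derive.
Qed.

Lemma Cmod_reverse (z w : C) : Rabs (Cmod z - Cmod w) <= Cmod (z - w).
Proof.
assert (H1 := Cmod_triangle (z - w) w). assert (H2 := Cmod_triangle (w - z) z).
replace (z - w + w)%C with z in H1 by ring. replace (w - z + z)%C with w in H2 by ring.
replace (w - z)%C with (- (z - w))%C in H2 by ring. rewrite Cmod_opp in H2.
apply Rabs_le. lra.
Qed.

Definition has_cslope (D : R -> Prop) (u : R -> C) (t : R) (l : C) : Prop :=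
  forall eps, 0 < eps -> exists d, 0 < d /\
    forall r, D r -> Rabs (r - t) < d -> Cmod (u r - u t - (r - t)%R * l)%C <= eps * Rabs (r - t).

Lemma is_linear_scal_C (l : C) :
  is_linear (U := R_NormedModule) (V := C_R_NormedModule) (fun h : R => scal h l).
Proof. exact (is_linear_scal_l (V := C_R_NormedModule) l). Qed.

Lemma cslope_norm (u : R -> C) (r t : R) (l : C) (k : R) :
  Cmod (u r - u t - (r - t)%R * l)%C <= k ->
  norm (V := C_R_NormedModule)
    (minus (minus (u r : C_R_NormedModule) (u t)) (scal (minus r t) (l : C_R_NormedModule))) <= k.
Proof.
intros H. apply Rle_trans with (2 := H). right. rewrite Cmod_norm.
apply (f_equal (norm (V := C_R_NormedModule))).
apply injective_projections; unfold minus, plus, opp, scal; cbn;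
  unfold mult, opp, plus; cbn; ring.
Qed.

Lemma has_cslope_deriv_on (D : R -> Prop) (u : R -> C) (t : R) (l : C) :
  D t -> has_cslope D u t l -> deriv_on (V := C_R_NormedModule) D u t l.
Proof.
intros Dt H. split; [apply is_linear_scal_C|].
intros x Hx.
assert (E : t = x).
{ apply eq_sym, eq_close. intros eps.
  apply (locally_singleton t (fun y => D y -> ball x eps y)); [|exact Dt].
  apply (Hx (ball x eps)). now exists eps. }
subst x. intros eps. destruct (H eps (cond_pos eps)) as [d [Hd Hd']].
exists (mkposreal d Hd). intros r Hr Dr. apply cslope_norm. now apply Hd'.
Qed.

Lemma has_cslope_is_derive (D : R -> Prop) (u : R -> C) (t : R) (l : C) :
  locally t D -> has_cslope D u t l -> is_derive (V := C_R_NormedModule) u t l.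
Proof.
intros HD H. split; [apply is_linear_scal_C|].
intros x Hx. rewrite -(is_filter_lim_locally_unique _ _ Hx).
intros eps. destruct (H eps (cond_pos eps)) as [d [Hd Hd']].
assert (Hl : locally t (fun r => Rabs (r - t) < d)) by now exists (mkposreal d Hd).
generalize (filter_and _ _ HD Hl). apply filter_imp. intros r [Dr Hr].
apply cslope_norm. now apply Hd'.
Qed.

Lemma continuous_on_eq {U V : UniformSpace} (D : U -> Prop) (f g : U -> V) :
  (forall x, D x -> f x = g x) -> continuous_on D f -> continuous_on D g.
Proof.
intros E H x Dx. rewrite -E; auto.
apply (filterlim_ext_loc f); [|now apply H].
unfold within. apply filter_forall. exact E.
Qed.

Section RegularCurve.

Variables (S : Rbar) (curve c : R -> C).
Hypothesis HS : Rbar_lt 0 S.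
Hypothesis HCc : forall x : R, Rbar_lt x S -> ccont curve x.
Hypothesis HCd : forall x : R, 0 < x -> Rbar_lt x S -> cderive curve x (c x).
Hypothesis Hcc : forall x : R, Rbar_lt x S -> ccont c x.
Hypothesis Hc0 : forall x : R, Rbar_lt x S -> c x <> 0.

Definition curve_length (x : R) : R := RInt (fun s => Cmod (c s)) 0 x.

Arguments curve_length : simpl never.

Lemma lt_le_end (x y : R) : x <= y -> Rbar_lt y S -> Rbar_lt x S.
Proof. intros H1 H2. now apply (Rbar_le_lt_trans x y). Qed.

Lemma curve_length_derive (x : R) : Rbar_lt x S -> is_derive curve_length x (Cmod (c x)).
Proof.
intros Hx. apply (is_derive_RInt_below S (fun s => Cmod (c s))); auto.
intros s Hs. now apply continuous_Cmod, Hcc.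
Qed.

Lemma curve_length_cont (x : R) : Rbar_lt x S -> continuous curve_length x.
Proof. intros Hx. apply: ex_derive_continuous. eexists. now apply curve_length_derive. Qed.

Lemma curve_length_0 : curve_length 0 = 0.
Proof. unfold curve_length. apply: RInt_point. Qed.

Lemma curve_length_le (x y : R) : x <= y -> Rbar_lt y S -> curve_length x <= curve_length y.
Proof.
intros Hxy Hy. apply (derive_ge_0_monotone curve_length (fun s => Cmod (c s))); auto.
- intros s Hs. apply curve_length_derive, (lt_le_end s y); auto; lra.
- intros s Hs. apply curve_length_cont, (lt_le_end s y); auto; lra.
- intros s _. apply Cmod_ge_0.
Qed.

Lemma curve_slope (x k : R) : Rbar_lt x S -> 0 <= x -> 0 < k ->
  exists d, 0 < d /\ forall r, 0 <= r -> Rbar_lt r S -> Rabs (r - x) < d ->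
    Cmod (curve r - curve x - (r - x)%R * c x)%C <= k * Rabs (r - x).
Proof.
intros Hx H0 Hk. destruct (ccont_eps c x (Hcc x Hx) k Hk) as [d [Hd H]].
exists d. split; [exact Hd|]. intros r Hr0 Hr Hrx. apply Rabs_def2 in Hrx.
destruct (Rle_dec x r) as [Hxr|Hxr].
- rewrite (Rabs_pos_eq (r - x)); [|lra].
  apply (mean_value_slope curve c); auto.
  + intros s Hs. apply HCd; [lra|]. apply (lt_le_end s r); auto; lra.
  + intros s Hs. apply HCc, (lt_le_end s r); auto; lra.
  + intros s Hs. apply H. apply Rabs_def1; lra.
- replace (curve r - curve x - (r - x)%R * c x)%C with (- (curve x - curve r - (x - r)%R * c x))%C
    by (rewrite !RtoC_minus; ring).
  rewrite Cmod_opp Rabs_minus_sym (Rabs_pos_eq (x - r)); [|lra].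
  apply (mean_value_slope curve c); try lra.
  + intros s Hs. apply HCd; [lra|]. apply (lt_le_end s x); auto; lra.
  + intros s Hs. apply HCc, (lt_le_end s x); auto; lra.
  + intros s Hs. apply H. apply Rabs_def1; lra.
Qed.

Lemma curve_length_slope (x k : R) : Rbar_lt x S -> 0 < k ->
  exists d, 0 < d /\ forall r, Rabs (r - x) < d ->
    Rabs (curve_length r - curve_length x - (r - x) * Cmod (c x)) <= k * Rabs (r - x).
Proof.
intros Hx Hk. destruct (curve_length_derive x Hx) as [_ H].
destruct (H x (fun P HP => HP) (mkposreal k Hk)) as [d Hd].
exists d. split; [apply cond_pos|]. intros r Hr. exact (Hd r Hr).
Qed.

Lemma curve_length_lt (x y : R) : x < y -> Rbar_lt y S -> curve_length x < curve_length y.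
Proof.
intros Hxy Hy. assert (Hx : Rbar_lt x S) by (apply (lt_le_end x y); auto; lra).
assert (Hp : 0 < Cmod (c x)) by now apply Cmod_gt_0, Hc0.
destruct (curve_length_slope x (Cmod (c x) / 2) Hx ltac:(lra)) as [d [Hd H]].
set (r := x + Rmin (d / 2) (y - x)).
assert (Hm : 0 < Rmin (d / 2) (y - x)) by (apply Rmin_pos; lra).
assert (Hr : Rabs (r - x) < d).
{ unfold r. replace (x + Rmin (d / 2) (y - x) - x) with (Rmin (d / 2) (y - x)) by ring.
  rewrite Rabs_pos_eq; [|lra]. generalize (Rmin_l (d / 2) (y - x)). lra. }
assert (Hry : r <= y) by (unfold r; generalize (Rmin_r (d / 2) (y - x)); lra).
apply Rlt_le_trans with (curve_length r); [|now apply curve_length_le].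
specialize (H r Hr). rewrite (Rabs_pos_eq (r - x)) in H; [|unfold r; lra].
apply Rabs_le_between in H.
assert (0 < (r - x) * (Cmod (c x) / 2)) by (apply Rmult_lt_0_compat; [unfold r|]; lra).
lra.
Qed.

Lemma curve_length_inj (x y : R) : Rbar_lt x S -> Rbar_lt y S ->
  curve_length x = curve_length y -> x = y.
Proof.
intros Hx Hy E. destruct (Rtotal_order x y) as [H|[H|H]]; auto.
- generalize (curve_length_lt x y H Hy). lra.
- generalize (curve_length_lt y x H Hx). lra.
Qed.

Lemma chord_le (x y : R) : 0 <= x <= y -> Rbar_lt y S -> Cmod (curve y - curve x) <= curve_length y - curve_length x.
Proof.
intros Hxy Hy. apply (mean_value_inequality curve c curve_length (fun s => Cmod (c s))).
- lra.
- intros s Hs. apply HCd; [lra|]. apply (lt_le_end s y); auto; lra.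
- intros s Hs. apply HCc, (lt_le_end s y); auto; lra.
- intros s Hs. apply curve_length_derive, (lt_le_end s y); auto; lra.
- intros s Hs. apply curve_length_cont, (lt_le_end s y); auto; lra.
- intros s Hs. lra.
Qed.

Lemma chord_ge (X eps : R) : 0 <= X -> Rbar_lt X S -> 0 < eps ->
  exists d, 0 < d /\ forall x y, 0 <= x <= y -> y <= X -> y - x < d ->
    curve_length y - curve_length x - eps * (y - x) <= Cmod (curve y - curve x).
Proof.
intros HX HXS Heps.
assert (Hu : forall p : C -> R, (forall x : R, Rbar_lt x S -> continuous (fun s => p (c s)) x) ->
  uniform_continuity (fun s => p (c s)) (fun s => 0 <= s <= X)).
{ intros p Hp. apply Heine; [apply compact_P3|]. intros s Hs.
  apply continuity_pt_filterlim, Hp, (lt_le_end s X); auto; lra. }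
destruct (Hu Re (fun x Hx => proj1 (Hcc x Hx)) (mkposreal (eps / 4) ltac:(lra))) as [d1 H1].
destruct (Hu Im (fun x Hx => proj2 (Hcc x Hx)) (mkposreal (eps / 4) ltac:(lra))) as [d2 H2].
exists (Rmin d1 d2). split; [apply Rmin_pos; apply cond_pos|].
intros x y Hxy HyX Hd.
assert (Hc : forall s, x < s < y -> Cmod (c s - c x) <= eps / 2).
{ intros s Hs. apply Rle_trans with (1 := Cmod_le_abs _).
  assert (Hsx : Rabs (s - x) < Rmin d1 d2) by (rewrite Rabs_pos_eq; lra).
  assert (Y1 := H1 s x ltac:(lra) ltac:(lra) ltac:(apply Rlt_le_trans with (1 := Hsx), Rmin_l)).
  assert (Y2 := H2 s x ltac:(lra) ltac:(lra) ltac:(apply Rlt_le_trans with (1 := Hsx), Rmin_r)).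
  change (Re (c s - c x)%C) with (Re (c s) - Re (c x)).
  change (Im (c s - c x)%C) with (Im (c s) - Im (c x)). cbn in Y1, Y2. lra. }
assert (A1 : Cmod (curve y - curve x - (y - x)%R * c x)%C <= eps / 2 * (y - x)).
{ apply (mean_value_slope curve c); try lra; auto.
  - intros s Hs. apply HCd; [lra|]. apply (lt_le_end s X); auto; lra.
  - intros s Hs. apply HCc, (lt_le_end s X); auto; lra. }
assert (A2 : Cmod (RtoC (curve_length y) - RtoC (curve_length x) -
    (y - x)%R * RtoC (Cmod (c x)))%C <= eps / 2 * (y - x)).
{ apply (mean_value_slope (fun s => RtoC (curve_length s)) (fun s => RtoC (Cmod (c s)))); try lra.
  - intros s Hs. apply cderive_R, curve_length_derive, (lt_le_end s X); auto; lra.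
  - intros s Hs. apply ccont_R, curve_length_cont, (lt_le_end s X); auto; lra.
  - intros s Hs. rewrite -RtoC_minus Cmod_R. apply Rle_trans with (1 := Cmod_reverse _ _). auto. }
rewrite -!RtoC_minus -RtoC_mult -RtoC_minus Cmod_R in A2. apply Rabs_le_between in A2.
assert (A3 : (y - x) * Cmod (c x) <= Cmod (curve y - curve x) + eps / 2 * (y - x)).
{ replace ((y - x) * Cmod (c x)) with (Cmod ((y - x)%R * c x)%C).
  2: { rewrite Cmod_mult Cmod_R Rabs_pos_eq; lra. }
  replace ((y - x)%R * c x)%C with ((curve y - curve x) - (curve y - curve x - (y - x)%R * c x))%C by ring.
  apply Rle_trans with (1 := Cmod_minus_le _ _). lra. }
lra.
Qed.

Variables (T : Rbar) (gamma : R -> C).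
Hypothesis HTS : forall x : R, 0 <= x -> (Rbar_lt x S <-> Rbar_lt (x * x) T).
Hypothesis Hgamma : forall t, 0 <= t -> gamma t = curve (sqrt t).

Lemma sqrt_lt_S (t : R) : in_time T t -> Rbar_lt (sqrt t) S.
Proof.
intros [H0 Ht]. apply HTS; [apply sqrt_pos|]. now rewrite sqrt_sqrt.
Qed.

Lemma polygon_le (t a : R) (p : list R) : in_time T t -> Sorted Rle (a :: p) ->
  List.Forall (fun s => 0 <= s <= t) (a :: p) ->
  polygon_length gamma (a :: p) <= curve_length (sqrt t) - curve_length (sqrt a).
Proof.
intros Ht. revert a. induction p as [|b p IH]; intros a Hs Hf.
- change (polygon_length gamma (a :: nil)) with 0. inversion Hf as [|? ? Ha _]. subst.
  assert (curve_length (sqrt a) <= curve_length (sqrt t)); [|lra].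
  apply curve_length_le; [apply sqrt_le_1_alt; lra|now apply sqrt_lt_S].
- apply Sorted_inv in Hs. destruct Hs as [Hs Hab]. inversion Hab as [|? ? Hab']. subst.
  inversion Hf as [|? ? Ha Hf']. subst. inversion Hf' as [|? ? Hb _]. subst.
  specialize (IH b Hs Hf').
  change (polygon_length gamma (a :: b :: p)) with
    (Cmod (gamma b - gamma a)%C + polygon_length gamma (b :: p)).
  rewrite !Hgamma; try lra.
  assert (Cmod (curve (sqrt b) - curve (sqrt a)) <= curve_length (sqrt b) - curve_length (sqrt a)); [|lra].
  apply chord_le.
  + split; [apply sqrt_pos|apply sqrt_le_1_alt; lra].
  + apply (lt_le_end _ (sqrt t)); [apply sqrt_le_1_alt; lra|now apply sqrt_lt_S].
Qed.

Lemma polygon_append (p : list R) (a b : R) :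
  Sorted Rle p -> List.Forall (fun s => 0 <= s <= a) p -> 0 <= a <= b ->
  exists q, Sorted Rle q /\ List.Forall (fun s => 0 <= s <= b) q /\
    polygon_length gamma p + Cmod (gamma b - gamma a) <= polygon_length gamma q.
Proof.
intros Hs Hf Hab. exists (p ++ a :: b :: nil). repeat split.
- induction p as [|x p IH].
  + apply Sorted_cons; [apply Sorted_cons; [apply Sorted_nil|apply HdRel_nil]|apply HdRel_cons; lra].
  + apply Sorted_inv in Hs. destruct Hs as [Hs Hx]. inversion Hf. subst.
    cbn. constructor; [auto|]. destruct p as [|y p]; cbn.
    * constructor. lra.
    * inversion Hx. subst. now constructor.
- apply Forall_app. split.
  + revert Hf. apply Forall_impl. intros s Hs'. lra.
  + apply Forall_cons; [lra|]. apply Forall_cons; [lra|apply Forall_nil].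
- clear Hs Hf. induction p as [|x p IH].
  + cbn. lra.
  + destruct p as [|y p].
    * cbn. generalize (Cmod_ge_0 (gamma a - gamma x)). lra.
    * change (polygon_length gamma (x :: y :: p)) with
        (Cmod (gamma y - gamma x)%C + polygon_length gamma (y :: p)).
      change (polygon_length gamma ((x :: y :: p) ++ a :: b :: nil)) with
        (Cmod (gamma y - gamma x)%C + polygon_length gamma ((y :: p) ++ a :: b :: nil)).
      lra.
Qed.

Lemma arc_length_spec (t : R) : in_time T t -> exists A : R,
  arc_length gamma t = Finite A /\ 0 <= A <= curve_length (sqrt t) /\
  forall p, Sorted Rle p -> List.Forall (fun s => 0 <= s <= t) p -> polygon_length gamma p <= A.
Proof.
intros Ht. unfold arc_length.
set (E := fun S0 => exists p : list R, Sorted Rle p /\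
  List.Forall (fun s => 0 <= s <= t) p /\ S0 = polygon_length gamma p).
destruct (Lub_Rbar_correct E) as [Hub Hl].
assert (H0 : Rbar_le 0 (Lub_Rbar E)).
{ apply Hub. exists nil. repeat split; constructor. }
assert (H1 : Rbar_le (Lub_Rbar E) (curve_length (sqrt t))).
{ apply Hl. intros x [p [Hs [Hf ->]]].
  change (polygon_length gamma p <= curve_length (sqrt t)). destruct p as [|a p].
  - assert (curve_length 0 <= curve_length (sqrt t)); [|rewrite curve_length_0 in H; exact H].
    apply curve_length_le; [apply sqrt_pos|now apply sqrt_lt_S].
  - apply Rle_trans with (1 := polygon_le t a p Ht Hs Hf).
    assert (curve_length 0 <= curve_length (sqrt a)); [|rewrite curve_length_0 in H; lra].
    inversion Hf. subst.
    apply curve_length_le; [apply sqrt_pos|]. apply (lt_le_end _ (sqrt t)); [|now apply sqrt_lt_S].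
    apply sqrt_le_1_alt. lra. }
destruct (Lub_Rbar E) as [A| |]; cbn in *; try easy.
exists A. split; [easy|]. split; [easy|].
intros p Hs Hf. apply (Hub (polygon_length gamma p)). now exists p.
Qed.

Theorem arc_length_eq (t : R) : in_time T t -> arc_length gamma t = Finite (curve_length (sqrt t)).
Proof.
intros Ht.
set (A := fun x => real (arc_length gamma (x * x))).
assert (Hin : forall x : R, 0 <= x -> Rbar_lt x S -> in_time T (x * x)).
{ intros x H0 Hx. split; [nra|]. now apply HTS. }
assert (Hmono : forall x y, 0 <= x <= y -> Rbar_lt y S -> A x + Cmod (curve y - curve x) <= A y).
{ intros x y Hxy Hy. assert (Hx : Rbar_lt x S) by (apply (lt_le_end x y); auto; lra).
  destruct (arc_length_spec (x * x) (Hin x ltac:(lra) Hx)) as [Ax [Ex [_ Bx]]].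
  destruct (arc_length_spec (y * y) (Hin y ltac:(lra) Hy)) as [Ay [Ey [_ By]]].
  assert (Hle : Rbar_le (arc_length gamma (x * x)) (Ay - Cmod (curve y - curve x))).
  { apply Lub_Rbar_correct. intros r [p [Hs [Hf ->]]]. cbn.
    destruct (polygon_append p (x * x) (y * y) Hs Hf ltac:(nra)) as [q [Q1 [Q2 Q3]]].
    assert (X := By q Q1 Q2).
    rewrite !Hgamma in Q3; try nra. rewrite !sqrt_square in Q3; lra. }
  unfold A. rewrite Ex Ey. rewrite Ex in Hle. cbn in *. lra. }
set (X := sqrt t).
assert (HX : 0 <= X) by apply sqrt_pos.
assert (HXS : Rbar_lt X S) by now apply sqrt_lt_S.
assert (EX : X * X = t) by (apply sqrt_sqrt, Ht).
destruct (arc_length_spec t Ht) as [At [Et [Bt _]]].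
assert (HAX : A X = At) by (unfold A; now rewrite EX Et).
rewrite Et. f_equal. apply Rle_antisym; [apply Bt|]. fold X.
apply Rnot_lt_le. intros Hlt.
set (eps := (curve_length X - At) / (2 * (X + 1))).
assert (Heps : 0 < eps) by (apply Rdiv_lt_0_compat; lra).
destruct (chord_ge X eps HX HXS Heps) as [d [Hd Hch]].
assert (Hstep : forall x y, 0 <= x <= y -> y <= X -> y - x < d ->
  A x - curve_length x + eps * x <= A y - curve_length y + eps * y).
{ intros x y Hxy HyX Hyx. assert (H1 := Hch x y Hxy HyX Hyx).
  assert (H2 := Hmono x y Hxy (lt_le_end y X HyX HXS)). lra. }
destruct (nfloor_ex (X / d)) as [n [_ Hn]].
{ apply Rdiv_le_0_compat; lra. }
assert (Hn1 : 0 < INR n + 1) by (generalize (pos_INR n); lra).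
set (h := X / (INR n + 1)).
assert (Hh : 0 <= h < d).
{ split; [apply Rdiv_le_0_compat; lra|]. unfold h.
  apply Rlt_div_l; [lra|]. apply Rlt_div_l in Hn; [|lra]. lra. }
assert (Hk : forall k, (k <= n + 1)%nat ->
  A 0 - curve_length 0 + eps * 0 <= A (INR k * h) - curve_length (INR k * h) + eps * (INR k * h)).
{ induction k as [|k IH]; intros Hkn.
  - rewrite Rmult_0_l. lra.
  - apply Rle_trans with (1 := IH ltac:(lia)).
    assert (P := pos_INR k). rewrite S_INR.
    apply Hstep; [split; nra| |lra].
    apply Rle_trans with ((INR n + 1) * h).
    + apply Rmult_le_compat_r; [lra|]. rewrite -!S_INR. apply le_INR. lia.
    + unfold h. right. field. lra. }
specialize (Hk (n + 1)%nat (Nat.le_refl _)).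
replace (INR (n + 1) * h) with X in Hk.
2: { rewrite plus_INR. unfold h. cbn. field. lra. }
rewrite curve_length_0 HAX in Hk.
assert (HA0 : 0 <= A 0).
{ destruct (arc_length_spec (0 * 0) (Hin 0 (Rle_refl 0) HS)) as [A0 [E0 [B0 _]]].
  unfold A. rewrite E0. apply B0. }
assert (eps * (X + 1) = (curve_length X - At) / 2) by (unfold eps; field; lra).
lra.
Qed.

Section Reparametrization.

Variables (L : Rbar) (eta : R -> C).
Hypothesis Heta : arclength_reparam T gamma L eta.
Hypothesis HST : forall x : R, Rbar_lt x S -> exists y : R, x < y /\ Rbar_lt y S.

Lemma in_time_square (x : R) : 0 <= x -> Rbar_lt x S -> in_time T (x * x).
Proof. intros H0 Hx. split; [nra|]. now apply HTS. Qed.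

Lemma eta_length (x : R) : 0 <= x -> Rbar_lt x S -> eta (curve_length x) = curve x.
Proof.
intros H0 Hx. assert (H := reparam_eq _ _ _ _ Heta (x * x) (in_time_square x H0 Hx)).
rewrite arc_length_eq in H; [|now apply in_time_square].
rewrite Hgamma in H; [|nra]. now rewrite sqrt_square in H.
Qed.

Lemma length_lt_L (x : R) : 0 <= x -> Rbar_lt x S -> in_time L (curve_length x).
Proof.
intros H0 Hx. split; [rewrite -curve_length_0; now apply curve_length_le|].
destruct (HST x Hx) as [y [Hxy Hy]].
apply (Rbar_lt_le_trans _ (curve_length y)); [now apply curve_length_lt|].
rewrite (reparam_length _ _ _ _ Heta). apply Lub_Rbar_correct.
exists (y * y). split; [apply in_time_square; auto; lra|].
rewrite arc_length_eq; [|apply in_time_square; auto; lra].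
rewrite sqrt_square; [easy|lra].
Qed.

Lemma length_surj (s : R) : in_time L s ->
  exists x, 0 <= x /\ Rbar_lt x S /\ curve_length x = s.
Proof.
intros [H0 HL].
destruct (classic (exists y, 0 <= y /\ Rbar_lt y S /\ s < curve_length y)) as [[y [Hy0 [Hy Hsy]]]|Hno].
- destruct (Req_dec s 0) as [->|Hs].
  { exists 0. split; [lra|]. split; [exact HS|apply curve_length_0]. }
  assert (Hy1 : 0 < y).
  { destruct (Req_dec y 0) as [->|]; [rewrite curve_length_0 in Hsy; lra|lra]. }
  destruct (IVT_interv (fun x => curve_length x - s) 0 y) as [x [Hx Ex]].
  + intros a Ha. apply continuity_pt_filterlim.
    apply: continuous_minus; [|apply: continuous_const].
    apply curve_length_cont, (lt_le_end a y); auto; lra.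
  + exact Hy1.
  + rewrite curve_length_0. lra.
  + lra.
  + exists x. split; [lra|]. split; [apply (lt_le_end x y); auto; lra|lra].
- exfalso. apply (Rbar_lt_not_le _ _ HL). rewrite (reparam_length _ _ _ _ Heta).
  apply Lub_Rbar_correct. intros r [t [Ht ->]]. rewrite arc_length_eq; auto. cbn.
  apply Rnot_lt_le. intros Hlt. apply Hno. exists (sqrt t).
  split; [apply sqrt_pos|]. split; [now apply sqrt_lt_S|exact Hlt].
Qed.

Definition length_inv (s : R) : R :=
  epsilon (inhabits 0) (fun x => 0 <= x /\ Rbar_lt x S /\ curve_length x = s).

Lemma length_inv_spec (s : R) : in_time L s ->
  0 <= length_inv s /\ Rbar_lt (length_inv s) S /\ curve_length (length_inv s) = s.
Proof. intros Hs. exact (epsilon_spec (inhabits 0) _ (length_surj s Hs)). Qed.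

Lemma length_inv_length (x : R) : 0 <= x -> Rbar_lt x S -> length_inv (curve_length x) = x.
Proof.
intros H0 Hx. destruct (length_inv_spec _ (length_lt_L x H0 Hx)) as [_ [H1 H2]].
now apply curve_length_inj.
Qed.

Lemma length_inv_close (x eps : R) : Rbar_lt x S -> 0 < eps ->
  exists d, 0 < d /\ forall y : R, Rbar_lt y S -> Rabs (curve_length y - curve_length x) < d ->
    Rabs (y - x) < eps.
Proof.
intros Hx Heps. destruct (HST x Hx) as [z [Hxz Hz]].
set (r := x + Rmin eps (z - x)). set (l := x - eps).
assert (Hm := Rmin_pos eps (z - x) Heps ltac:(lra)).
assert (Hrz : r <= z) by (unfold r; generalize (Rmin_r eps (z - x)); lra).
assert (Hre : r <= x + eps) by (unfold r; generalize (Rmin_l eps (z - x)); lra).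
assert (Hr : Rbar_lt r S) by now apply (lt_le_end r z).
assert (Hl : curve_length l < curve_length x) by (apply curve_length_lt; auto; unfold l; lra).
assert (Hr' : curve_length x < curve_length r) by (apply curve_length_lt; auto; unfold r; lra).
exists (Rmin (curve_length r - curve_length x) (curve_length x - curve_length l)).
split; [apply Rmin_pos; lra|]. intros y Hy Hd. apply Rabs_def2 in Hd.
assert (X1 := Rmin_l (curve_length r - curve_length x) (curve_length x - curve_length l)).
assert (X2 := Rmin_r (curve_length r - curve_length x) (curve_length x - curve_length l)).
apply Rabs_def1.
- destruct (Rlt_le_dec (y - x) eps) as [H|H]; [exact H|exfalso].
  assert (curve_length r <= curve_length y) by (apply curve_length_le; auto; lra). lra.
- destruct (Rlt_le_dec (- eps) (y - x)) as [H|H]; [exact H|exfalso].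
  assert (curve_length y <= curve_length l); [|lra].
  apply curve_length_le; [unfold l; lra|]. apply (lt_le_end l x); auto. unfold l. lra.
Qed.

Lemma continuous_on_length_inv (u : R -> C) :
  (forall x : R, Rbar_lt x S -> ccont u x) ->
  continuous_on (U := C_UniformSpace) (in_time L) (fun s => u (length_inv s)).
Proof.
intros Hu s Hs. destruct (length_inv_spec s Hs) as [H0 [H1 H2]].
apply filterlim_locally. intros eps.
destruct (Hu _ H1) as [C1 C2].
destruct (filter_and _ _ (proj1 (filterlim_locally _ _) C1 eps)
  (proj1 (filterlim_locally _ _) C2 eps))
  as [d Hd].
destruct (length_inv_close _ d H1 (cond_pos d)) as [d' [Hd' Hclose]].
exists (mkposreal d' Hd'). intros r Hr Ir.
destruct (length_inv_spec r Ir) as [R0 [R1 R2]].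
apply (Hd (length_inv r)). change (Rabs (length_inv r - length_inv s) < d).
apply Hclose; [exact R1|]. rewrite R2 H2. exact Hr.
Qed.

Definition tangent (x : R) : C := (c x / Cmod (c x))%C.

Lemma tangent_cont (x : R) : Rbar_lt x S -> ccont tangent x.
Proof.
intros Hx. apply ccont_div; [now apply Hcc| |].
- apply ccont_R. now apply continuous_Cmod, Hcc.
- intros E. injection E. intros E'. apply (Hc0 x Hx). now apply Cmod_eq_0.
Qed.

Lemma eta_slope (x : R) : 0 <= x -> Rbar_lt x S ->
  has_cslope (in_time L) eta (curve_length x) (tangent x).
Proof.
intros H0 Hx eps Heps. assert (Hp : 0 < Cmod (c x)) by now apply Cmod_gt_0, Hc0.
set (q := Cmod (c x)) in *.
set (k := Rmin (q / 2) (eps * q / 4)).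
assert (Hk : 0 < k) by (apply Rmin_pos; [lra|apply Rdiv_lt_0_compat; [nra|lra]]).
destruct (curve_slope x k Hx H0 Hk) as [d1 [Hd1 H1]].
destruct (curve_length_slope x k Hx Hk) as [d2 [Hd2 H2]].
destruct (length_inv_close x (Rmin d1 d2) Hx (Rmin_pos _ _ Hd1 Hd2)) as [d [Hd Hcl]].
exists d. split; [exact Hd|]. intros s Is Hs.
destruct (length_surj s Is) as [y [Y0 [Y1 <-]]].
rewrite !eta_length; auto.
assert (Hyx := Hcl y Y1 Hs).
specialize (H1 y Y0 Y1 (Rlt_le_trans _ _ _ Hyx (Rmin_l _ _))).
specialize (H2 y (Rlt_le_trans _ _ _ Hyx (Rmin_r _ _))). fold q in H2.
set (D := Rabs (y - x)) in *. set (dl := curve_length y - curve_length x) in *.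
assert (HD : 0 <= D) by apply Rabs_pos.
assert (Hk1 : k <= q / 2) by apply Rmin_l.
assert (Hk2 : k <= eps * q / 4) by apply Rmin_r.
assert (Hdl : q / 2 * D <= Rabs dl).
{ assert (X : Rabs ((y - x) * q) <= Rabs (dl - (y - x) * q) + Rabs dl).
  { replace ((y - x) * q) with (- (dl - (y - x) * q) + dl) at 1 by ring.
    rewrite -(Rabs_Ropp (dl - (y - x) * q)). apply Rabs_triang. }
  rewrite Rabs_mult (Rabs_pos_eq q) in X; [|lra]. fold D in X. nra. }
assert (Hqn : RtoC q <> 0) by (intros E; injection E; lra).
replace (curve y - curve x - dl * tangent x)%C with
  ((curve y - curve x - (y - x)%R * c x) - (dl - (y - x) * q)%R * (c x / q))%C.
2: { unfold tangent. fold q. rewrite (RtoC_minus dl) (RtoC_mult (y - x)). field. auto. }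
apply Rle_trans with (1 := Cmod_minus_le _ _).
rewrite Cmod_mult Cmod_R Cmod_div; auto. rewrite Cmod_R (Rabs_pos_eq q); [|lra].
fold q. replace (q / q) with 1 by (field; lra).
assert (k * D <= eps * q / 4 * D) by (apply Rmult_le_compat_r; lra).
assert (eps * (q / 2 * D) <= eps * Rabs dl) by (apply Rmult_le_compat_l; lra).
lra.
Qed.

Lemma locally_in_length (s : R) : 0 < s -> Rbar_lt s L -> locally s (in_time L).
Proof.
intros H0 Hs. generalize (filter_and _ _ (open_Rbar_gt' s 0 H0) (open_Rbar_lt' s L Hs)).
apply filter_imp. intros r [H1 H2]. cbn in H1. split; [lra|exact H2].
Qed.

Theorem flow_line_of_tangent {X : UniformSpace} (proj : X -> C)
    (U : X -> Prop) (h : X -> R) (teta : R -> X) :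
  continuous_on (in_time L) teta ->
  (forall s, in_time L s -> proj (teta s) = eta s) ->
  (forall x : R, 0 < x -> Rbar_lt x S ->
    U (teta (curve_length x)) /\ tangent x = expi (h (teta (curve_length x)))) ->
  flow_line proj U h L teta.
Proof.
intros Hc Hproj Hx.
assert (Hsl : forall s, in_time L s ->
  has_cslope (in_time L) (fun r => proj (teta r)) s (tangent (length_inv s))).
{ intros s Hs eps Heps. destruct (length_inv_spec s Hs) as [X0 [X1 X2]].
  destruct (eta_slope _ X0 X1 eps Heps) as [d [Hd H]]. exists d. split; [exact Hd|].
  intros r Hr Hrs. rewrite !Hproj; auto. rewrite X2 in H. now apply H. }
split; [exact Hc|]. split.
- exists (fun s => tangent (length_inv s)). split.
  + intros s Hs. now apply has_cslope_deriv_on, Hsl.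
  + apply continuous_on_length_inv. apply tangent_cont.
- intros s H0 Hs. assert (Is : in_time L s) by (split; [lra|exact Hs]).
  destruct (length_inv_spec s Is) as [X0 [X1 X2]].
  assert (Hpos : 0 < length_inv s).
  { destruct (Req_dec (length_inv s) 0) as [E|E]; [|lra].
    rewrite E curve_length_0 in X2. lra. }
  destruct (Hx _ Hpos X1) as [HU Ht]. rewrite X2 in HU Ht. split; [exact HU|].
  rewrite -Ht. apply (has_cslope_is_derive (in_time L)); [now apply locally_in_length|now apply Hsl].
Qed.

Lemma eta_length_inv (s : R) : in_time L s -> curve (length_inv s) = eta s.
Proof.
intros Hs. destruct (length_inv_spec s Hs) as [X0 [X1 X2]].
now rewrite -(eta_length _ X0 X1) X2.
Qed.

Lemma eta_continuous : continuous_on (U := C_UniformSpace) (in_time L) eta.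
Proof.
apply (continuous_on_eq (U := R_UniformSpace) (V := C_UniformSpace) _ (fun s => curve (length_inv s))).
- apply eta_length_inv.
- now apply continuous_on_length_inv.
Qed.

End Reparametrization.

Theorem arclength_reparam_exists : exists L eta, arclength_reparam T gamma L eta.
Proof.
exists (Lub_Rbar (fun s => exists t, in_time T t /\ s = arc_length gamma t)),
  (fun s => curve (epsilon (inhabits 0) (fun x => 0 <= x /\ Rbar_lt x S /\ curve_length x = s))).
split.
- intros t Ht. now rewrite arc_length_eq.
- reflexivity.
- intros t Ht. rewrite arc_length_eq; auto. cbn.
  destruct (epsilon_spec (inhabits 0)
    (fun x => 0 <= x /\ Rbar_lt x S /\ curve_length x = curve_length (sqrt t))) as [H0 [H1 H2]].
  { exists (sqrt t). split; [apply sqrt_pos|]. split; [now apply sqrt_lt_S|easy]. }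
  rewrite Hgamma; [|apply Ht]. f_equal. apply curve_length_inj; auto. now apply sqrt_lt_S.
Qed.

End RegularCurve.

(** * Arguments *)

Lemma expi_plus (a b : R) : expi (a + b) = (expi a * expi b)%C.
Proof. unfold expi. apply Cext; cbn; rewrite ?cos_plus ?sin_plus; ring. Qed.

Lemma expi_0 : expi 0 = 1.
Proof. unfold expi. now rewrite cos_0 sin_0. Qed.

Lemma expi_opp (a : R) : (expi a * expi (- a))%C = 1.
Proof. rewrite -expi_plus Rplus_opp_r. apply expi_0. Qed.

Lemma expi_PI : expi PI = (- (1))%C.
Proof. unfold expi. rewrite cos_PI sin_PI. apply Cext; cbn; ring. Qed.

Lemma Cmod_expi (a : R) : Cmod (expi a) = 1.
Proof.
apply Rsqr_inj; [apply Cmod_ge_0|lra|]. unfold Rsqr. rewrite Cmod_sqr.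
unfold expi, Re, Im; cbn. generalize (sin2_cos2 a). unfold Rsqr. lra.
Qed.

Lemma expi_neq0 (a : R) : expi a <> 0.
Proof. intros E. generalize (Cmod_expi a). rewrite E Cmod_0. lra. Qed.

Lemma Cmod_polar (k a : R) : 0 <= k -> Cmod (k * expi a)%C = k.
Proof. intros Hk. rewrite Cmod_mult Cmod_expi Cmod_R Rabs_pos_eq; lra. Qed.

Lemma cexp_polar (z : C) : cexp z = (exp (Re z) * expi (Im z))%C.
Proof. unfold cexp, expi. apply Cext; unfold Re, Im; cbn; ring. Qed.

Lemma polar_solve (z : C) (m k a : R) : 0 < m -> 0 < k ->
  (z * (m * expi a))%C = RtoC k -> z = (Cmod z * expi (- a))%C.
Proof.
intros Hm Hk E.
assert (Hmn : RtoC m <> 0) by (intros E'; injection E'; lra).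
assert (Ez : z = ((k / m)%R * expi (- a))%C).
{ rewrite RtoC_div; [|lra]. rewrite -E. transitivity (z * (expi a * expi (- a)))%C.
  - rewrite expi_opp. ring.
  - field. exact Hmn. }
rewrite {2}Ez Cmod_polar; [exact Ez|]. apply Rlt_le, Rdiv_lt_0_compat; lra.
Qed.

Lemma Re_div_Cmod_bound (z : C) : z <> 0 -> -1 <= Re z / Cmod z <= 1.
Proof.
intros Hz. assert (Hp : 0 < Cmod z) by now apply Cmod_gt_0.
generalize (Re_Cmod z). intros H%Rabs_le_between.
split; [apply Rle_div_r; lra|apply Rle_div_l; lra].
Qed.

Lemma acos_close (x eps : R) : -1 <= x <= 1 -> 0 < eps ->
  exists d, 0 < d /\ forall y, -1 <= y <= 1 -> Rabs (y - x) < d -> Rabs (acos y - acos x) < eps.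
Proof.
intros Hx Heps. assert (Ha := acos_bound x). set (a := acos x) in *.
assert (Ea : cos a = x) by now apply cos_acos.
assert (Hup : exists d, 0 < d /\ forall y, -1 <= y <= 1 -> Rabs (y - x) < d -> acos y < a + eps).
{ destruct (Rle_dec (a + eps) PI) as [H|H].
  - assert (Hc : cos (a + eps) < cos a) by (apply cos_decreasing_1; lra).
    exists (x - cos (a + eps)). split; [lra|]. intros y Hy Hd. apply Rabs_def2 in Hd.
    apply Rnot_le_lt. intros Hle. assert (B := acos_bound y).
    assert (cos (acos y) <= cos (a + eps)) by (apply cos_decr_1; lra).
    rewrite cos_acos in H0; lra.
  - exists 1. split; [lra|]. intros y _ _. generalize (acos_bound y). lra. }
assert (Hdn : exists d, 0 < d /\ forall y, -1 <= y <= 1 -> Rabs (y - x) < d -> a - eps < acos y).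
{ destruct (Rle_dec 0 (a - eps)) as [H|H].
  - assert (Hc : cos a < cos (a - eps)) by (apply cos_decreasing_1; lra).
    exists (cos (a - eps) - x). split; [lra|]. intros y Hy Hd. apply Rabs_def2 in Hd.
    apply Rnot_le_lt. intros Hle. assert (B := acos_bound y).
    assert (cos (a - eps) <= cos (acos y)) by (apply cos_decr_1; lra).
    rewrite cos_acos in H0; lra.
  - exists 1. split; [lra|]. intros y _ _. generalize (acos_bound y). lra. }
destruct Hup as [d1 [Hd1 H1]], Hdn as [d2 [Hd2 H2]].
exists (Rmin d1 d2). split; [now apply Rmin_pos|]. intros y Hy Hd.
specialize (H1 y Hy (Rlt_le_trans _ _ _ Hd (Rmin_l _ _))).
specialize (H2 y Hy (Rlt_le_trans _ _ _ Hd (Rmin_r _ _))).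
apply Rabs_def1; lra.
Qed.

Lemma argH_continuous (f : R -> C) (s : R) :
  ccont f s -> f s <> 0 -> continuous (fun r => argH (f r)) s.
Proof.
intros Hf Hn. assert (Hp : 0 < Cmod (f s)) by now apply Cmod_gt_0.
assert (Hm := continuous_Cmod f s Hf).
assert (Hq : continuous (fun r => Re (f r) / Cmod (f r)) s).
{ apply continuous_Rdiv; [apply Hf|exact Hm|lra]. }
apply filterlim_locally. intros eps.
destruct (acos_close _ eps (Re_div_Cmod_bound _ Hn) (cond_pos eps)) as [d [Hd H]].
generalize (filter_and _ _ (proj1 (filterlim_locally _ _) Hq (mkposreal d Hd))
  (proj1 (filterlim_locally _ _) Hm (mkposreal _ Hp))).
apply filter_imp. intros r [H1 H2]. cbn in H1, H2.
change (Rabs (Re (f r) / Cmod (f r) - Re (f s) / Cmod (f s)) < d) in H1.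
change (Rabs (Cmod (f r) - Cmod (f s)) < Cmod (f s)) in H2.
apply Rabs_def2 in H2. apply H; [|exact H1].
apply Re_div_Cmod_bound, Cmod_gt_0. lra.
Qed.

Lemma argH_polar (k a : R) : 0 < k -> 0 <= a <= PI -> argH (k * expi a)%C = a.
Proof.
intros Hk Ha. unfold argH. rewrite Cmod_polar; [|lra].
replace (Re (k * expi a)%C) with (k * cos a) by (unfold Re, expi; cbn; ring).
replace (k * cos a / k) with (cos a) by (field; lra). now apply acos_cos.
Qed.

Lemma sin_0_constant (S : Rbar) (phi : R -> R) :
  (forall x : R, Rbar_lt x S -> continuous phi x) ->
  (forall x : R, 0 <= x -> Rbar_lt x S -> sin (phi x) = 0) ->
  forall x : R, 0 <= x -> Rbar_lt x S -> phi x = phi 0.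
Proof.
intros Hc Hs x H0 Hx. destruct (Req_dec (phi x) (phi 0)) as [E|E]; [exact E|exfalso].
assert (HxS : forall y, y <= x -> Rbar_lt y S).
{ intros y Hy. now apply (Rbar_le_lt_trans y x). }
assert (H0S := HxS 0 H0).
assert (Hd : forall y, 0 <= y <= x -> sin (phi y - phi 0) = 0).
{ intros y Hy. rewrite sin_minus (Hs y) ?(Hs 0); try lra; try (apply HxS; lra). }
assert (Hx0 : 0 < x).
{ destruct (Req_dec x 0) as [E'|]; [now rewrite E' in E|lra]. }
set (d := phi x - phi 0). set (m := Rmin (Rabs d) 1).
assert (Hdn : d <> 0) by (unfold d; lra).
assert (Hm : 0 < m) by (apply Rmin_pos; [now apply Rabs_pos_lt|lra]).
assert (Hm1 : m <= 1) by apply Rmin_r.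
assert (Hmd : m <= Rabs d) by apply Rmin_l.
assert (Hex : forall s : R, s = 1 \/ s = -1 -> s * d = Rabs d ->
  exists y, 0 <= y <= x /\ s * (phi y - phi 0) = m / 2).
{ intros s Hs1 Hsd.
  destruct (IVT_interv (fun y => s * (phi y - phi 0) - m / 2) 0 x) as [y [Hy Ey]].
  - intros a Ha. apply continuity_pt_filterlim.
    apply (continuous_minus (fun y => s * (phi y - phi 0)) (fun _ => m / 2));
      [|apply: continuous_const].
    apply (continuous_mult (fun _ => s) (fun y => phi y - phi 0));
      [apply: continuous_const|].
    apply (continuous_minus phi (fun _ => phi 0)); [|apply: continuous_const].
    apply Hc, HxS. lra.
  - exact Hx0.
  - rewrite Rminus_diag. lra.
  - fold d. rewrite Hsd. lra.
  - exists y. split; [exact Hy|lra]. }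
assert (Hsin : sin (m / 2) <> 0).
{ apply Rgt_not_eq, sin_gt_0; [lra|]. generalize PI_RGT_0 PI2_1. lra. }
destruct (Rcase_abs d) as [Hneg|Hpos].
- destruct (Hex (-1)) as [y [Hy Ey]]; [auto|rewrite Rabs_left; lra|].
  apply Hsin. rewrite -Ey. replace (-1 * (phi y - phi 0)) with (- (phi y - phi 0)) by ring.
  rewrite sin_neg Hd; auto. ring.
- destruct (Hex 1) as [y [Hy Ey]]; [auto|rewrite Rabs_pos_eq; lra|].
  apply Hsin. rewrite -Ey Rmult_1_l. now apply Hd.
Qed.

Theorem proposition7 (rho : R) (z0 : C) (T : Rbar) (W : R -> R)
    (z gamma : R -> C) (Hz0 : 0 <= Im z0) (Hz0' : z0 <> RtoC 0)
    (Hsle : SLE0 rho z0 T W z gamma) :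
  (exists (L : Rbar) (eta : R -> C), arclength_reparam T gamma L eta) /\
  forall (L : Rbar) (eta : R -> C), arclength_reparam T gamma L eta ->
    (Im z0 = 0 ->
       flow_line (X := C_UniformSpace) (fun w : C => w) upper
         (h_real rho (Re z0)) L eta) /\
    (forall r theta : R, 0 < r -> 0 < theta < PI ->
       z0 = (r * expi theta)%C ->
       (exists teta : R -> log_surface,
          is_lift z0 L eta (r, theta - PI) teta) /\
       forall teta : R -> log_surface,
         is_lift z0 L eta (r, theta - PI) teta ->
         flow_line (log_proj z0) (log_upper z0) (h_log rho z0) L teta).
Proof.
assert (HT := lifetime_pos _ _ _ _ _ _ Hsle).
destruct (tip_description _ _ _ _ _ _ Hsle) as [N [HN0 [Hg0 [HN [HS [HIm Hforce]]]]]].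
set (S := root_time T). set (sqrt_curve := fun x => gamma (Rmax 0 x * Rmax 0 x)).
set (c := sqrt_velocity rho gamma N).
set (lam := fun x => Im (N (Rmax 0 x * Rmax 0 x))).
assert (HS0 : Rbar_lt 0 S) by (apply (root_time_lt T 0); [lra|now rewrite Rmult_0_l]).
assert (HTS : forall x : R, 0 <= x -> (Rbar_lt x S <-> Rbar_lt (x * x) T))
  by (intros x Hx; apply (root_time_lt T x Hx)).
assert (HCc : forall x : R, Rbar_lt x S -> ccont sqrt_curve x).
{ intros x Hx. apply (sqrt_curve_cont rho T gamma N); auto. }
assert (HCd : forall x : R, 0 < x -> Rbar_lt x S -> cderive sqrt_curve x (c x)).
{ intros x H0 Hx. apply (cderive_ext_loc (fun r => gamma (r * r))).
  - generalize (open_Rbar_gt' x 0 H0). apply filter_imp. intros r Hr. cbn in Hr.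
    unfold sqrt_curve. now rewrite Rmax_right; [|lra].
  - apply (sqrt_curve_derive rho T gamma N); auto. }
assert (Hcc : forall x : R, Rbar_lt x S -> ccont c x).
{ intros x Hx. apply (sqrt_velocity_cont rho T gamma N); auto. }
assert (Hc0 : forall x : R, Rbar_lt x S -> c x <> 0).
{ intros x Hx. apply (sqrt_velocity_neq0 rho T gamma N); auto. }
assert (HCg : forall t, 0 <= t -> gamma t = sqrt_curve (sqrt t)).
{ intros t Ht. unfold sqrt_curve. rewrite Rmax_right; [|apply sqrt_pos]. now rewrite sqrt_sqrt. }
assert (HST : forall x : R, Rbar_lt x S -> exists y : R, x < y /\ Rbar_lt y S).
{ intros x. apply Rbar_lt_between. }
assert (Hlc : forall x : R, Rbar_lt x S -> continuous lam x).
{ intros x Hx. apply (sqrt_N_cont T N); auto. }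
assert (Hup : forall x : R, 0 < x -> Rbar_lt x S -> upper (sqrt_curve x)).
{ intros x H0 Hx. unfold sqrt_curve. rewrite Rmax_right; [|lra].
  apply (curve_Im_pos T gamma); auto; [nra|]. apply HTS; [lra|exact Hx]. }
assert (Hlam0 : lam 0 = 0).
{ unfold lam. now rewrite (Rmax_left 0 0); [|lra]; rewrite Rmult_0_l HN0. }
assert (HC0 : sqrt_curve 0 = 0).
{ unfold sqrt_curve. now rewrite (Rmax_left 0 0); [|lra]; rewrite Rmult_0_l. }
assert (Hpole : forall x : R, 0 <= x -> Rbar_lt x S -> exists k m : R, 0 < k /\ 0 < m /\
  RtoC k = ((sqrt_curve x - z0) * (sqrt_curve x - Cconj z0) * (m * expi (lam x)))%C).
{ intros x H0 Hx. unfold sqrt_curve, lam. rewrite Rmax_right; [|lra].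
  destruct (Hforce (x * x)) as [k [Hk E]].
  { split; [nra|]. now apply HTS. }
  exists k, (exp (Re (N (x * x)))). split; [exact Hk|]. split; [apply exp_pos|].
  now rewrite E cexp_polar. }
assert (Htan : forall x : R, 0 < x -> Rbar_lt x S ->
  tangent c x = expi (PI - argH (sqrt_curve x) + rho / 4 * lam x)).
{ intros x H0 Hx. destruct (argH_spec _ (Hup x H0 Hx)) as [_ Eg].
  assert (Hp : 0 < Cmod (sqrt_curve x)) by (apply Cmod_gt_0, Im_pos_neq0, Hup; auto).
  set (g := argH (sqrt_curve x)) in *.
  set (n := N (x * x)).
  assert (El : lam x = Im n) by (unfold lam; now rewrite Rmax_right; [|lra]).
  assert (E : c x = ((4 * x * exp (rho / 4 * Re n) / Cmod (sqrt_curve x))%R *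
    expi (PI - g + rho / 4 * lam x))%C).
  { unfold c. rewrite sqrt_velocity_pos; auto. fold n.
    replace (gamma (x * x)) with (sqrt_curve x) by (unfold sqrt_curve; now rewrite Rmax_right; [|lra]).
    rewrite {1}Eg. replace (rho / 4 * n)%C with ((rho / 4)%R * n)%C by (rewrite RtoC_div; [easy|lra]).
    rewrite cexp_polar.
    replace (Re ((rho / 4)%R * n)%C) with (rho / 4 * Re n) by (unfold Re; cbn; ring).
    replace (Im ((rho / 4)%R * n)%C) with (rho / 4 * lam x) by (rewrite El; unfold Im; cbn; ring).
    replace (PI - g + rho / 4 * lam x) with (PI + (- g + rho / 4 * lam x)) by ring.
    rewrite !expi_plus expi_PI RtoC_div; [|lra]. rewrite (RtoC_mult (4 * x)).
    assert (E1 := expi_opp g). assert (E2 := expi_neq0 g).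
    assert (Hpn : RtoC (Cmod (sqrt_curve x)) <> 0) by (intros E'; injection E'; lra).
    replace (expi (- g)) with (/ expi g)%C; [field; auto|].
    rewrite -(Cmult_1_l (/ expi g)) -E1. field. exact E2. }
  unfold tangent. rewrite E Cmod_polar.
  - set (k := 4 * x * exp (rho / 4 * Re n) / Cmod (sqrt_curve x)).
    assert (Hk : 0 < k).
    { apply Rdiv_lt_0_compat; [|exact Hp]. apply Rmult_lt_0_compat; [lra|apply exp_pos]. }
    field. intros E'; injection E'; lra.
  - apply Rlt_le, Rdiv_lt_0_compat; [|exact Hp]. apply Rmult_lt_0_compat; [lra|apply exp_pos]. }
split.
{ now apply (arclength_reparam_exists S sqrt_curve c). }
intros L eta Heta.
assert (Hlen : forall x : R, 0 <= x -> Rbar_lt x S -> eta (curve_length c x) = sqrt_curve x).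
{ intros x H0 Hx. now apply (eta_length S sqrt_curve c HS0 HCc HCd Hcc T gamma HTS HCg L). }
split.
- intros Hre. apply (flow_line_of_tangent S sqrt_curve c HS0 HCc HCd Hcc Hc0 T gamma HTS HCg L eta Heta HST).
  + now apply (eta_continuous S sqrt_curve c HS0 HCc HCd Hcc Hc0 T gamma HTS HCg L eta Heta HST).
  + easy.
  + intros x H0 Hx. rewrite Hlen; auto; [|lra]. split; [now apply Hup|].
    rewrite Htan; auto. f_equal.
    assert (Ez : z0 = RtoC (Re z0)) by (apply Cext; auto).
    set (x0 := Re z0) in *.
    assert (Hx0 : x0 <> 0) by (intros E; apply Hz0'; now rewrite Ez E).
    set (phi := fun y => 2 * argH (sqrt_curve y - x0) + lam y).
    assert (Hne : forall y : R, Rbar_lt y S -> (sqrt_curve y - x0)%C <> 0).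
    { intros y Hy E. assert (Hm := Rmax_l 0 y).
      assert (Hy' : Rbar_lt (Rmax 0 y) S) by (unfold Rmax; destruct (Rle_dec 0 y); auto).
      destruct (Hpole (Rmax 0 y) Hm Hy') as [k [m [Hk [_ E']]]].
      assert (E2 : sqrt_curve (Rmax 0 y) = sqrt_curve y) by (unfold sqrt_curve; now rewrite (Rmax_right 0 (Rmax 0 y))).
      rewrite E2 Ez E !Cmult_0_l in E'. injection E'. lra. }
    assert (Hphi0 : phi 0 = 2 * PI /\ 0 < x0 \/ phi 0 = 0 /\ x0 < 0).
    { unfold phi. rewrite HC0 Hlam0. destruct (Rlt_dec 0 x0) as [Hp|Hp].
      - left. split; [|exact Hp]. replace (0 - x0)%C with (x0 * expi PI)%C.
        + rewrite argH_polar; auto; [ring|]. generalize PI_RGT_0. lra.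
        + rewrite expi_PI. ring.
      - right. split; [|lra]. replace (0 - x0)%C with ((- x0)%R * expi 0)%C.
        + rewrite argH_polar; [ring|lra|]. generalize PI_RGT_0. lra.
        + rewrite expi_0 RtoC_opp. ring. }
    assert (Hphi : phi x = phi 0).
    { apply (sin_0_constant S); [| |lra|exact Hx].
      - intros y Hy. apply: continuous_plus; [|now apply Hlc].
        apply: continuous_mult; [apply: continuous_const|].
        apply argH_continuous; [|now apply Hne].
        apply ccont_minus; [now apply HCc|apply ccont_const].
      - intros y Y0 Hy. destruct (Req_dec y 0) as [->|Hy0].
        + destruct Hphi0 as [[-> _]|[-> _]]; [apply sin_2PI|apply sin_0].
        + destruct (Hpole y Y0 Hy) as [k [m [Hk [Hm E']]]].
          assert (Hu : upper (sqrt_curve y - x0)%C).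
          { generalize (Hup y ltac:(lra) Hy). unfold upper, Im; cbn. lra. }
          destruct (argH_spec _ Hu) as [_ Ea].
          assert (Ec : Cconj x0 = x0) by (apply Cext; cbn; ring).
          rewrite Ez Ec in E'.
          set (a := argH (sqrt_curve y - x0)%C) in *. set (q := Cmod (sqrt_curve y - x0)%C) in *.
          assert (Hq : 0 < q) by (apply Cmod_gt_0, Hne; exact Hy).
          rewrite Ea in E'.
          assert (E2 : RtoC k = ((q * q * m)%R * expi (phi y))%C).
          { rewrite E'. unfold phi. fold a.
            replace (2 * a + lam y) with (a + a + lam y) by ring.
            rewrite !expi_plus !RtoC_mult. ring. }
          apply (f_equal Im) in E2. unfold expi, Im in E2; cbn in E2.
          assert (0 < q * q * m) by (repeat apply Rmult_lt_0_compat; lra). nra. }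
    unfold phi in Hphi at 1. unfold h_real.
    destruct (Rlt_dec 0 x0) as [Hx0'|Hx0']; destruct Hphi0 as [[Ep Hs]|[Ep Hs]];
      rewrite Ep in Hphi; try lra; nra.
- intros r theta Hr Hth Ez.
  assert (Hzi : 0 < Im z0).
  { rewrite Ez. replace (Im (r * expi theta)%C) with (r * sin theta)
      by (unfold Im, expi; cbn; ring).
    apply Rmult_lt_0_compat; [lra|]. apply sin_gt_0; lra. }
  set (angle := fun x => - lam x - argH (sqrt_curve x - Cconj z0)%C).
  assert (Hupb : forall x : R, 0 <= x -> Rbar_lt x S -> upper (sqrt_curve x - Cconj z0)%C).
  { intros x H0 Hx. assert (Hi : 0 <= Im (sqrt_curve x)).
    { destruct (Req_dec x 0) as [->|Hx0]; [rewrite HC0; cbn; lra|].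
      apply Rlt_le, Hup; auto. lra. }
    unfold upper, Im in *; cbn. lra. }
  assert (Hangc : forall x : R, Rbar_lt x S -> continuous angle x).
  { intros x Hx. apply (continuous_minus (fun x => - lam x)).
    - apply: continuous_opp. now apply Hlc.
    - apply argH_continuous; [apply ccont_minus; [now apply HCc|apply ccont_const]|].
      apply Im_pos_neq0.
      assert (E2 : sqrt_curve (Rmax 0 x) = sqrt_curve x).
      { unfold sqrt_curve. rewrite (Rmax_right 0 (Rmax 0 x)); [easy|apply Rmax_l]. }
      rewrite -E2. apply Hupb; [apply Rmax_l|].
      unfold Rmax; destruct (Rle_dec 0 x); auto. }
  assert (Hang : forall x : R, 0 <= x -> Rbar_lt x S ->
    0 < Cmod (sqrt_curve x - z0) /\ (sqrt_curve x - z0)%C = (Cmod (sqrt_curve x - z0) * expi (angle x))%C).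
  { intros x H0 Hx. destruct (Hpole x H0 Hx) as [k [m [Hk [Hm E]]]].
    assert (Hu := Hupb x H0 Hx). destruct (argH_spec _ Hu) as [_ Ea].
    set (bt := argH (sqrt_curve x - Cconj z0)%C) in *.
    assert (Hp : 0 < Cmod (sqrt_curve x - Cconj z0)) by (apply Cmod_gt_0, Im_pos_neq0, Hu).
    set (q := Cmod (sqrt_curve x - Cconj z0)%C) in *.
    split.
    - apply Cmod_gt_0. intros E0. rewrite E0 !Cmult_0_l in E. injection E. lra.
    - replace (angle x) with (- (bt + lam x)) by (unfold angle; fold bt; ring).
      apply (polar_solve _ (q * m) k); auto; [now apply Rmult_lt_0_compat|].
      rewrite E Ea expi_plus RtoC_mult. ring. }
  assert (Hang0 : angle 0 = theta - PI).
  { unfold angle. rewrite HC0 Hlam0.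
    replace (0 - Cconj z0)%C with (r * expi (PI - theta))%C.
    - rewrite argH_polar; [ring|lra|lra].
    - rewrite Ez. unfold expi. rewrite cos_minus sin_minus cos_PI sin_PI.
      apply Cext; cbn; ring. }
  assert (Hr0 : Cmod (sqrt_curve 0 - z0)%C = r).
  { rewrite HC0. replace (0 - z0)%C with (- z0)%C by ring.
    rewrite Cmod_opp Ez Cmod_polar; lra. }
  assert (Hinv := length_inv_spec S sqrt_curve c HS0 HCc HCd Hcc T gamma HTS HCg L eta Heta).
  assert (Heinv := eta_length_inv S sqrt_curve c HS0 HCc HCd Hcc T gamma HTS HCg L eta Heta).
  assert (HlL := length_lt_L S sqrt_curve c HS0 HCc HCd Hcc Hc0 T gamma HTS HCg L eta Heta HST).
  set (inv := length_inv S c) in *.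
  split.
  + exists (fun s => (Cmod (sqrt_curve (inv s) - z0)%C, angle (inv s))). split.
    * assert (E0 : inv 0 = 0).
      { assert (E0 := length_inv_length S sqrt_curve c HS0 HCc HCd Hcc Hc0 T gamma HTS HCg L eta Heta HST
          0 (Rle_refl 0) HS0).
        now rewrite curve_length_0 in E0. }
      now rewrite E0 Hr0 Hang0.
    * apply (continuous_on_length_inv S sqrt_curve c HS0 HCc HCd Hcc Hc0 T gamma HTS HCg L eta Heta HST
        (fun x => (Cmod (sqrt_curve x - z0)%C, angle x))).
      intros x Hx. split; [|now apply Hangc].
      apply continuous_Cmod, ccont_minus; [now apply HCc|apply ccont_const].
    * intros s Hs. destruct (Hinv s Hs) as [X0 [X1 _]]. now apply (Hang _ X0 X1).
    * intros s Hs. destruct (Hinv s Hs) as [X0 [X1 _]]. rewrite -Heinv; auto.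
      unfold log_proj; cbn [fst snd]. rewrite -(proj2 (Hang _ X0 X1)). ring.
  + intros teta [Tstart Tcont Tpos Tproj].
    assert (Hfs : forall x : R, 0 <= x -> Rbar_lt x S ->
      fst (teta (curve_length c x)) = Cmod (sqrt_curve x - z0) /\
      expi (snd (teta (curve_length c x))) = expi (angle x)).
    { intros x H0 Hx. assert (Hin := HlL x H0 Hx).
      assert (Hp := Tpos _ Hin). assert (E := Tproj _ Hin).
      rewrite Hlen in E; auto. unfold log_proj in E.
      destruct (teta (curve_length c x)) as [ra an]; cbn [fst snd] in *.
      assert (E1 : (sqrt_curve x - z0)%C = (ra * expi an)%C) by (rewrite -E; ring).
      destruct (Hang x H0 Hx) as [Hq E2].
      assert (Era : ra = Cmod (sqrt_curve x - z0)) by (rewrite E1 Cmod_polar; lra).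
      split; [exact Era|].
      rewrite -Era E1 in E2. assert (Hran : RtoC ra <> 0) by (intros E'; injection E'; lra).
      replace (expi an) with (/ ra * (ra * expi an))%C by (field; auto).
      rewrite E2. field. exact Hran. }
    assert (Hsnd : forall x : R, 0 <= x -> Rbar_lt x S ->
      snd (teta (curve_length c x)) = angle x).
    { intros x H0 Hx.
      set (d := fun y => snd (teta (curve_length c (Rmax 0 y))) - angle (Rmax 0 y)).
      assert (Hm : forall y : R, Rbar_lt y S -> Rbar_lt (Rmax 0 y) S).
      { intros y Hy. unfold Rmax; destruct (Rle_dec 0 y); auto. }
      assert (Ed : d x = d 0).
      { apply (sin_0_constant S); auto.
        - intros y Hy.
          apply (continuous_minus (fun y => snd (teta (curve_length c (Rmax 0 y))))
            (fun y => angle (Rmax 0 y))).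
          + apply (filterlim_comp _ _ _ (fun y => teta (curve_length c (Rmax 0 y)))
              (fun p : R * R => snd p) _ (locally (teta (curve_length c (Rmax 0 y))))).
            * apply (filterlim_comp _ _ _ (fun y => curve_length c (Rmax 0 y)) teta _
                (within (in_time L) (locally (curve_length c (Rmax 0 y))))).
              -- intros P HP.
                 assert (Hcl : continuous (fun y => curve_length c (Rmax 0 y)) y).
                 { apply (continuous_comp (Rmax 0) (curve_length c));
                     [apply continuous_Rmax_0|].
                   apply (curve_length_cont S c); auto. }
                 assert (Hly : locally y (fun q : R => Rbar_lt q S)) by exact (open_Rbar_lt' y S Hy).
                 assert (HlP : locally y (fun q : R => in_time L (curve_length c (Rmax 0 q)) ->
                   P (curve_length c (Rmax 0 q)))) by exact (Hcl _ HP).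
                 unfold filtermap. generalize (filter_and _ _ Hly HlP).
                 apply filter_imp. intros q [Q1 Q2]. apply Q2. apply HlL; [apply Rmax_l|].
                 now apply Hm.
              -- apply Tcont, HlL; [apply Rmax_l|now apply Hm].
            * apply (continuous_snd (U := R_UniformSpace) (V := R_UniformSpace)).
          + apply (continuous_comp (Rmax 0) angle); [apply continuous_Rmax_0|].
            apply Hangc. now apply Hm.
        - intros y Y0 Hy. unfold d. rewrite (Rmax_right 0 y); auto.
          destruct (Hfs y Y0 Hy) as [_ E]. injection E. intros E1 E2.
          rewrite sin_minus E1 E2. ring. }
      unfold d in Ed. rewrite (Rmax_right 0 x) in Ed; auto.
      rewrite (Rmax_left 0 0) in Ed; [|lra].
      rewrite (curve_length_0 c) Tstart Hang0 in Ed.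
      change (snd (r, theta - PI)) with (theta - PI) in Ed. lra. }
    apply (flow_line_of_tangent S sqrt_curve c HS0 HCc HCd Hcc Hc0 T gamma HTS HCg L eta Heta HST);
      auto.
    intros x H0 Hx. assert (Hin := HlL x ltac:(lra) Hx).
    assert (Ep := Tproj _ Hin). rewrite Hlen in Ep; auto; [|lra].
    split.
    * split; [now apply Tpos|]. rewrite Ep. now apply Hup.
    * rewrite Htan; auto. f_equal. unfold h_log. rewrite Ep Hsnd; auto; [|lra].
      unfold angle. field.
Qed.
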